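(* Let $d\ge1$, $\alpha\in(0,2)$, $\varepsilon>0$ and $V(x)=\frac12(d+\varepsilon)\log(1+|x|^2)$, $x\in\mathbb R^d$. (1) The Poincaré inequality $$\mu_V(f^2)\le C\,\mathscr E_{\alpha,V}(f,f),\quad f\in\mathscr D(\mathscr E_{\alpha,V}),\ \mu_V(f)=0,$$ holds for some constant $C>0$ if and only if $\varepsilon\ge\alpha$. (2) The super Poincaré inequality $$\mu_V(f^2)\le r\,\mathscr E_{\alpha,V}(f,f)+\beta(r)\mu_V(|f|)^2,\quad r>0,\ f\in\mathscr D(\mathscr E_{\alpha,V}),$$ holds for some function $\beta:(0,\infty)\to(0,\infty)$ if and only if $\varepsilon>\alpha$, and in this case there exists a constant $c>0$ such that the inequality holds with $$\beta(r)=c\Big(1+r^{-\frac d\alpha-\frac{(d+\varepsilon)(2\alpha+d)}{\alpha(\varepsilon-\alpha)}}\Big),\quad r>0,$$ and equivalently, $$\|P_t^{\alpha,V}\|_{L^1(\mu_V)\to L^\infty(\mu_V)}\le\lambda\Big(1+t^{-\frac d\alpha-\frac{(d+\varepsilon)(2\alpha+d)}{\alpha(\varepsilon-\alpha)}}\Big),\quad t>0,$$ holds for some constant $\lambda>0$. (3) If $\varepsilon\in(0,\alpha)$, then there exists a constant $c>0$ such that the weak Poincaré inequality $$\mu_V(f^2)\le\tilde\beta(r)\,\mathscr E_{\alpha,V}(f,f)+r\|f\|_\infty^2,\quad r>0,\ f\in\mathscr D(\mathscr E_{\alpha,V}),\ \mu_V(f)=0,$$ holds for $\tilde\beta(r)=c\big(1+r^{-(\alpha-\varepsilon)/\varepsilon}\big)$,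 $r>0$. Consequently, there exists a constant $\lambda>0$ such that $$\|P_t^{\alpha,V}-\mu_V\|^2_{L^\infty(\mu_V)\to L^2(\mu_V)}\le\frac{\lambda}{t^{\varepsilon/(\alpha-\varepsilon)}},\quad t>0.$$ This $\tilde\beta$ is sharp in the sense that (for $\varepsilon\in(0,\alpha)$) the weak Poincaré inequality does not hold with any function $\tilde\beta:(0,\infty)\to(0,\infty)$ such that $\lim_{r\to0}r^{(\alpha-\varepsilon)/\varepsilon}\tilde\beta(r)=0$.
   Context: $\mu_V(dx):=\big(\int_{\mathbb R^d}e^{-V(y)}dy\big)^{-1}e^{-V(x)}dx$ is a probability measure; $\mu_V(f):=\int f\,d\mu_V$, and in $P_t^{\alpha,V}-\mu_V$ the symbol $\mu_V$ denotes the operator $f\mapsto\mu_V(f)$. The Dirichlet form is $$\mathscr E_{\alpha,V}(f,g):=\iint_{\mathbb R^d\times\mathbb R^d}\frac{(f(x)-f(y))(g(x)-g(y))}{|x-y|^{d+\alpha}}\,dy\,\mu_V(dx),\qquad \mathscr D(\mathscr E_{\alpha,V}):=\{f\in L^2(\mu_V):\mathscr E_{\alpha,V}(f,f)<\infty\},$$ a symmetric Dirichlet form on $L^2(\mu_V)$, and $P_t^{\alpha,V}$ is the associated Markov semigroup. $\|\cdot\|_{L^p(\mu_V)\to L^q(\mu_V)}$ is the operator norm. *)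

(* Defs.v *)
From HB Require Import structures.
From mathcomp Require Import all_boot all_order all_algebra.
From mathcomp Require Import all_classical all_reals all_analysis.
From mathcomp Require Import measurable_realfun ess_sup_inf.

Set Implicit Arguments.
Unset Strict Implicit.
Unset Printing Implicit Defensive.

Import Order.TTheory GRing.Theory Num.Theory.
Import numFieldNormedType.Exports.

Local Open Scope classical_set_scope.
Local Open Scope ring_scope.

(* R^d is d.-tuple R, with the library's product (= Borel) sigma-algebra. *)

Section lebesgue_measure_tuple.
Context {R : realType}.

Definition cons_pair (n : nat) (p : (R * n.-tuple R)%type) : n.+1.-tuple R :=
  [tuple of p.1 :: p.2].

Definition lebesgue_cons (n : nat) (m : set (n.-tuple R) -> \bar R) :
    set (n.+1.-tuple R) -> \bar R :=
  pushforward (lebesgue_measure \x m)%E (@cons_pair n).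

Fixpoint lebesgue_tuple (d : nat) : set (d.-tuple R) -> \bar R :=
  match d with
  | 0 => dirac [tuple]
  | n.+1 => lebesgue_cons (@lebesgue_tuple n)
  end.

Lemma measurable_cons_pair n : measurable_fun setT (@cons_pair n).
Proof. exact: measurable_cons. Qed.

Section lebesgue_cons_measure.
Context (n : nat) (m : {sigma_finite_measure set (n.-tuple R) -> \bar R}).
Local Notation mu := (lebesgue_cons m).

Let measurable_preimage_cons (A : set (n.+1.-tuple R)) :
  measurable A -> measurable (@cons_pair n @^-1` A).
Proof.
by move=> mA; rewrite -[X in measurable X]setTI; exact: measurable_cons_pair.
Qed.

Let lebesgue_cons0 : mu set0 = 0%E.
Proof. by rewrite /lebesgue_cons /pushforward preimage_set0 measure0. Qed.

Let lebesgue_cons_ge0 A : (0 <= mu A)%E.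
Proof. exact: (measure_ge0 (lebesgue_measure \x m)%E). Qed.

Let lebesgue_cons_sigma_additive : semi_sigma_additive mu.
Proof.
move=> F mF tF mUF; rewrite /lebesgue_cons /pushforward preimage_bigcup.
apply: measure_semi_sigma_additive.
- by move=> i; exact: measurable_preimage_cons.
- apply/trivIsetP => i j _ _ ij; rewrite -preimage_setI.
  by move/trivIsetP : tF => /(_ _ _ I I ij) ->; rewrite preimage_set0.
- by rewrite -preimage_bigcup; exact: measurable_preimage_cons.
Qed.

HB.instance Definition _ := isMeasure.Build _ _ _ mu
  lebesgue_cons0 lebesgue_cons_ge0 lebesgue_cons_sigma_additive.

Let lebesgue_cons_sigma_finite : sigma_finite setT mu.
Proof.
have /sigma_finiteP[F [TF ndF Foo]] := sigma_finiteT (@lebesgue_measure R).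
have /sigma_finiteP[G [TG ndG Goo]] := sigma_finiteT m.
pose g (x : n.+1.-tuple R) : (R * n.-tuple R)%type :=
  (tnth x ord0, [tuple of behead x]).
have gK : cancel (@cons_pair n) g by case=> a t; congr pair; exact/val_inj.
have mg : measurable_fun setT g.
  apply: measurable_fun_pair; first exact: measurable_tnth.
  exact: measurable_behead.
exists (fun i => g @^-1` (F i `*` G i)).
  rewrite -preimage_bigcup (_ : \bigcup_i _ = setT) ?preimage_setT//.
  apply/seteqP; split => // -[x y] _.
  have [[i _ Fx] [j _ Gy]] : (\bigcup_i F i) x /\ (\bigcup_i G i) y.
    by rewrite -TF -TG.
  exists (maxn i j) => //; split => /=.
  - by move: x Fx; exact/subsetPset/ndF/leq_maxl.
  - by move: y Gy; exact/subsetPset/ndG/leq_maxr.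
move=> i; have [mFi Fioo] := Foo i; have [mGi Gioo] := Goo i; split.
  by rewrite -[X in measurable X]setTI; apply: mg => //; exact: measurableX.
rewrite /lebesgue_cons /pushforward (_ : _ @^-1` _ = F i `*` G i); last first.
  by apply/seteqP; split => p; rewrite /preimage /mkset gK.
by rewrite product_measure1E// lte_mul_pinfty// ge0_fin_numE.
Qed.

HB.instance Definition _ := Measure_isSigmaFinite.Build _ _ _ mu
  lebesgue_cons_sigma_finite.

End lebesgue_cons_measure.

Lemma lebesgue_tuple_sigma_finite_measure d :
  exists m : {sigma_finite_measure set (d.-tuple R) -> \bar R},
    @lebesgue_tuple d = m.
Proof.
elim: d => [|n [m mE]] /=; first by exists (@dirac _ _ [tuple] R).
by exists (lebesgue_cons m); rewrite mE.
Qed.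

Section lebesgue_tuple_measure.
Variable d : nat.
Local Notation mu := (@lebesgue_tuple d).

Let lebesgue_tuple0 : mu set0 = 0%E.
Proof.
by have [m ->] := lebesgue_tuple_sigma_finite_measure d; exact: measure0.
Qed.

Let lebesgue_tuple_ge0 A : (0 <= mu A)%E.
Proof.
by have [m ->] := lebesgue_tuple_sigma_finite_measure d; exact: measure_ge0.
Qed.

Let lebesgue_tuple_sigma_additive : semi_sigma_additive mu.
Proof.
have [m ->] := lebesgue_tuple_sigma_finite_measure d.
exact: measure_semi_sigma_additive.
Qed.

HB.instance Definition _ := isMeasure.Build _ _ _ mu
  lebesgue_tuple0 lebesgue_tuple_ge0 lebesgue_tuple_sigma_additive.

Let lebesgue_tuple_sigma_finite : sigma_finite setT mu.
Proof.
by have [m ->] := lebesgue_tuple_sigma_finite_measure d; exact: sigma_finiteT.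
Qed.

HB.instance Definition _ := Measure_isSigmaFinite.Build _ _ _ mu
  lebesgue_tuple_sigma_finite.

End lebesgue_tuple_measure.

End lebesgue_measure_tuple.

Section euclidean.
Context {R : realType} {d : nat}.
Implicit Types x y : d.-tuple R.

Definition enorm x : R := Num.sqrt (\sum_(i < d) tnth x i ^+ 2).

Definition tuple_sub x y : d.-tuple R :=
  [tuple tnth x i - tnth y i | i < d].

End euclidean.

Section gibbs_measure.
Context {R : realType} {d : nat}.
Local Open Scope ereal_scope.

(* If the integral is infinite this is 0, and then so is gibbs V; it is finite
   for log_potential d eps with 0 < d and 0 < eps. *)
Definition partition_function (V : d.-tuple R -> R) : R :=
  fine (\int[@lebesgue_tuple R d]_y (expR (- V y))%:E).

Definition gibbs (V : d.-tuple R -> R) (A : set (d.-tuple R)) : \bar R :=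
  (partition_function V)^-1%:E
  * \int[@lebesgue_tuple R d]_(x in A) (expR (- V x))%:E.

Section gibbs_is_measure.
Variable V : {mfun d.-tuple R >-> R}.

Let Zge0 : 0 <= (partition_function V)^-1%:E.
Proof.
by rewrite lee_fin invr_ge0 fine_ge0// integral_ge0// => x _;
  rewrite lee_fin expR_ge0.
Qed.

Let density_ge0 A : 0 <= \int[@lebesgue_tuple R d]_(x in A) (expR (- V x))%:E.
Proof. by apply: integral_ge0 => x _; rewrite lee_fin expR_ge0. Qed.

Let measurable_density (A : set (d.-tuple R)) :
  measurable_fun A (fun x => (expR (- V x))%:E).
Proof.
apply: measurable_funTS; apply/measurable_EFinP.
by apply: measurableT_comp => //; exact: measurableT_comp.
Qed.

Let gibbs0 : gibbs V set0 = 0.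
Proof. by rewrite /gibbs integral_set0 mule0. Qed.

Let gibbs_ge0 A : 0 <= gibbs V A.
Proof. exact: mule_ge0. Qed.

Let gibbs_sigma_additive : semi_sigma_additive (gibbs V).
Proof.
move=> F mF tF mUF.
rewrite {2}/gibbs ge0_integral_bigcup//.
rewrite -nneseriesZl//.
by apply: is_cvg_nneseries => i _ _; exact: gibbs_ge0.
Qed.

HB.instance Definition _ := isMeasure.Build _ _ _ (gibbs V)
  gibbs0 gibbs_ge0 gibbs_sigma_additive.

End gibbs_is_measure.
End gibbs_measure.

Section log_potential.
Context {R : realType} (d : nat).

Lemma measurable_enorm : measurable_fun setT (@enorm R d).
Proof.
apply: (@measurableT_comp _ _ _ _ _ _ (@Num.sqrt R) _
  (fun x : d.-tuple R => \sum_(i < d) tnth x i ^+ 2)).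
  apply: continuous_measurable_fun; exact: sqrt_continuous.
apply: measurable_sum => i; apply: measurable_funX.
exact: measurable_tnth.
Qed.

Definition log_potential (eps : R) (x : d.-tuple R) : R :=
  2^-1 * (d%:R + eps) * ln (1 + enorm x ^+ 2).

Lemma measurable_log_potential eps : measurable_fun setT (log_potential eps).
Proof.
apply: measurable_funM => //.
apply: measurableT_comp; first exact: measurable_ln.
apply: measurable_funD => //; apply: measurable_funX.
exact: measurable_enorm.
Qed.

HB.instance Definition _ eps := isMeasurableFun.Build _ _ _ _
  (log_potential eps) (measurable_log_potential eps).

End log_potential.
Arguments log_potential {R} d eps x.

Section operators.
Context {disp : measure_display} {T : measurableType disp} {R : realType}.
Variable mu : {measure set T -> \bar R}.
Implicit Types (f g : T -> R) (S : (T -> R) -> T -> R).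

(* Functions represent their mu-a.e. classes: an operator on L^2(mu) respects
   a.e. equality and satisfies its algebraic identities a.e. *)
Record markov_semigroup (P : R -> (T -> R) -> T -> R) : Prop := {
  semigroup_Lfun : forall t f, 0 < t ->
    f \in Lfun mu 2%:E -> P t f \in Lfun mu 2%:E ;
  semigroup_ae_eq : forall t f g, 0 < t ->
    f \in Lfun mu 2%:E -> g \in Lfun mu 2%:E ->
    {ae mu, forall x, f x = g x} -> {ae mu, forall x, P t f x = P t g x} ;
  semigroup_linear : forall t a f g, 0 < t ->
    f \in Lfun mu 2%:E -> g \in Lfun mu 2%:E ->
    {ae mu, forall x, P t (fun y => a * f y + g y) x = a * P t f x + P t g x} ;
  semigroup_contraction : forall t f, 0 < t -> f \in Lfun mu 2%:E ->
    ('N[mu]_2%:E [EFin \o P t f] <= 'N[mu]_2%:E [EFin \o f])%E ;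
  semigroup_symmetric : forall t f g, 0 < t ->
    f \in Lfun mu 2%:E -> g \in Lfun mu 2%:E ->
    \int[mu]_x (P t f x * g x) = \int[mu]_x (f x * P t g x) ;
  semigroupD : forall s t f, 0 < s -> 0 < t -> f \in Lfun mu 2%:E ->
    {ae mu, forall x, P (s + t) f x = P s (P t f) x} ;
  semigroup_continuous : forall f, f \in Lfun mu 2%:E ->
    ('N[mu]_2%:E [EFin \o (P t f \- f)%R])%E @[t --> 0^'+] --> 0%E ;
  semigroup_positive : forall t f, 0 < t -> f \in Lfun mu 2%:E ->
    {ae mu, forall x, 0 <= f x} -> {ae mu, forall x, 0 <= P t f x} ;
  semigroup1 : forall t, 0 < t -> {ae mu, forall x, P t (cst 1) x = 1}
}.

(* The correspondence between a semigroup and its form is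
   E(f, g) = lim_(t -> 0+) t^-1 <f - P_t f, g>, the domain being the set of f
   in L^2 for which t^-1 <f - P_t f, f> has a finite limit. *)
Definition approximating_form (P : R -> (T -> R) -> T -> R) (t : R) f g : R :=
  t^-1 * \int[mu]_x ((f x - P t f x) * g x).

Record associated_semigroup (E : (T -> R) -> (T -> R) -> \bar R)
    (D : set (T -> R)) (P : R -> (T -> R) -> T -> R) : Prop := {
  associated_markov : markov_semigroup P ;
  associated_domain : forall f, f \in Lfun mu 2%:E ->
    D f <-> cvg (approximating_form P t f f @[t --> 0^'+]) ;
  associated_form : forall f g, D f -> D g ->
    (approximating_form P t f g)%:E @[t --> 0^'+] --> E f g
}.

(* S is only given on L^2(mu), so the supremum runs over the unit ball of L^p
   intersected with L^2. For a finite measure mu and p = +oo the intersection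
   is all of L^oo; for p = 1 it is dense in L^1, which gives the norm of the
   bounded extension of S to L^1. *)
Definition operator_norm (p q : \bar R) S : \bar R :=
  ereal_sup [set ('N[mu]_q [EFin \o S f])%E | f in
    [set f | [/\ f \in Lfun mu 2%:E, f \in Lfun mu p &
                 ('N[mu]_p [EFin \o f] <= 1)%E]]].

End operators.

Section functional_inequalities.
Context {R : realType} {d : nat}.
Variables (alpha : R) (V : {mfun d.-tuple R >-> R}).
Implicit Types f g : d.-tuple R -> R.
Local Open Scope ereal_scope.

(* On the diagonal x = y the quotient is 0 by the convention 0^-1 = 0. *)
Definition dirichlet_form f g : \bar R :=
  \int[gibbs V]_x \int[@lebesgue_tuple R d]_y
    ((f x - f y) * (g x - g y) /
     enorm (tuple_sub x y) `^ (d%:R + alpha))%:E.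

Definition form_domain : set (d.-tuple R -> R) :=
  [set f | f \in Lfun (gibbs V) 2%:E /\ dirichlet_form f f < +oo].

Definition poincare_inequality (C : R) : Prop :=
  forall f, form_domain f -> \int[gibbs V]_x (f x)%:E = 0 ->
  \int[gibbs V]_x (f x ^+ 2)%:E <= C%:E * dirichlet_form f f.

Definition super_poincare_inequality (beta : R -> R) : Prop :=
  forall r f, (0 < r)%R -> form_domain f ->
  \int[gibbs V]_x (f x ^+ 2)%:E <=
    r%:E * dirichlet_form f f
    + (beta r)%:E * (\int[gibbs V]_x `|f x|%:E) ^+ 2.

Definition weak_poincare_inequality (beta : R -> R) : Prop :=
  forall r f, (0 < r)%R -> form_domain f -> \int[gibbs V]_x (f x)%:E = 0 ->
  \int[gibbs V]_x (f x ^+ 2)%:E <=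
    (beta r)%:E * dirichlet_form f f
    + r%:E * ('N[gibbs V]_+oo [EFin \o f]) ^+ 2.

End functional_inequalities.

(* Main.v *)
(** With w(x) = (1 + |x|^2)^(-(d+eps)/2) the density of mu_V up to a constant,
    |x - y| <= 2 max(|x|, |y|) shows that w(x) w(y) is at most
    C (w(x) + w(y)) |x - y|^(-(d+alpha)) when eps >= alpha, and at most
    (1 + r^2)^((alpha-eps)/2) times this on the ball of radius r when
    eps < alpha. The variance is thus bounded by the energy, in the second case
    up to the tail mu_V(|x| > r), which is of order r^(-eps). For the super
    Poincare inequality f(x) is compared with its average over a small cube
    around x if |x| <= r; if |x| > r, over a fixed cube around the origin, where
    the symmetry of the energy allows one to use the weight w(y) of the near
    point y and gains the factor r^(-(eps-alpha)).

    Conversely, a ramp which is 0 on |x_1| <= n and 1 on |x_1| >= 2n has energy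
    at most C n^(-alpha) and variance of order n^(-eps).

    On the semigroup side, the convexity of t |-> <P_t f, f> gives
    E(P_t f, P_t f) <= (||P_(t/2) f||^2 - ||P_t f||^2) / t, which turns the
    functional inequalities into recursions between the times t/2 and t, and the
    bound from L^1 to L^oo follows from that from L^1 to L^2 by duality. *)

Require Import Defs.
From HB Require Import structures.
From mathcomp Require Import all_boot all_order all_algebra.
From mathcomp Require Import all_classical all_reals all_analysis.
From mathcomp Require Import measurable_realfun ess_sup_inf.
From mathcomp Require Import ring lra.

Set Implicit Arguments.
Unset Strict Implicit.
Unset Printing Implicit Defensive.

Import Order.TTheory GRing.Theory Num.Theory.
Import numFieldNormedType.Exports.

Local Open Scope classical_set_scope.
Local Open Scope ring_scope.

(** The semigroup is tied to the form only through the limit of t^-1 <f - P_t f, g>, so the argument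
    in time uses neither spectral calculus nor Gronwall's lemma. The identity <P_s f, P_t f> =
    <P_(s+t) f, f> and AM-GM give midpoint convexity, and monotonicity in t takes the place of
    continuity. The recursions are closed by [half_iteration]: the free parameter r of the
    functional inequality is spent on making the recursion factor 1/2, with r proportional to t for
    super Poincare and, for large t, to t^(-1/theta) for weak Poincare, where theta =
    (alpha-eps)/eps. In space, every functional inequality goes through [energy_comparison], which
    reduces it to a pointwise bound of K(x, y) |x - y|^(d+alpha) by the weights at x and y. Cubes
    are used instead of balls, since their volume is explicit by induction on d, and sums over
    dyadic cubes replace polar coordinates. *)

(** * Midpoint convex functions *)

(** Repeated halving of the interval gives the inequality for dyadic l; an arbitrary l is rounded
    down to a dyadic number, and monotonicity of g controls the error. *)
Lemma midpoint_convex_slope (R : realType) (g : R -> R) :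
  (forall s t, 0 < s -> s <= t -> g t <= g s) ->
  (forall s t, 0 < s -> 0 < t -> g ((s + t) / 2) <= (g s + g t) / 2) ->
  forall a b l, 0 < a -> a <= b -> 0 <= l <= 1 ->
  g (a + l * (b - a)) <= g a + l * (g b - g a).
Proof.
move=> gni gmid.
have dyadic n : forall k a b, 0 < a -> a <= b -> (k <= 2 ^ n)%N ->
    g (a + k%:R / 2 ^+ n * (b - a)) <= g a + k%:R / 2 ^+ n * (g b - g a).
  elim: n => [|n IH] k a b a0 ab.
    rewrite expn0 expr0 divr1; case: k => [|[|//]] _.
      by rewrite !mul0r !addr0.
    by rewrite !mul1r !subrKC.
  move=> kn; have b0 := lt_le_trans a0 ab.
  set m := (a + b) / 2.
  have [m0 am mb] : [/\ 0 < m, a <= m & m <= b] by rewrite /m; split; lra.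
  have gm := gmid a b a0 b0; rewrite -/m in gm.
  have e2 : 2 ^+ n != 0 :> R by rewrite expf_neq0.
  (* The dyadic point lies in the left or the right half of [a, b]; the induction hypothesis on that
     half is combined with [gm] at the midpoint. *)
  have [k2|k2] := leqP k (2 ^ n).
    have := IH k a m a0 am k2.
    have -> : a + k%:R / 2 ^+ n * (m - a) = a + k%:R / 2 ^+ n.+1 * (b - a).
      by rewrite /m exprS; field.
    move=> /le_trans; apply.
    have -> : k%:R / 2 ^+ n.+1 = (k%:R / 2 ^+ n) / 2 :> R by rewrite exprS; field.
    set q : R := k%:R / 2 ^+ n.
    have q0 : 0 <= q by rewrite divr_ge0// exprn_ge0.
    by have := ler_wpM2l q0 gm; lra.
  have k2' : (k - 2 ^ n <= 2 ^ n)%N.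
    by rewrite leq_subLR addnn -mul2n -expnS.
  have := IH (k - 2 ^ n)%N m b m0 mb k2'.
  rewrite natrB 1?ltnW// natrX mulrBl divff//.
  have -> : m + (k%:R / 2 ^+ n - 1) * (b - m) = a + k%:R / 2 ^+ n.+1 * (b - a).
    by rewrite /m exprS; field.
  move=> /le_trans; apply.
  have -> : k%:R / 2 ^+ n.+1 = (k%:R / 2 ^+ n) / 2 :> R by rewrite exprS; field.
  set q : R := k%:R / 2 ^+ n.
  have q2 : 0 <= 2 - q.
    rewrite subr_ge0 ler_pdivrMr ?exprn_gt0// -exprS -natrX ler_nat//.
  by have := ler_wpM2l q2 gm; lra.
move=> a b l a0 ab /andP[l0 l1].
have gab : g b <= g a by exact: gni.
apply/ler_addgt0Pl => e e0.
(* Rounding l changes the right-hand side by at most (g a - g b) / 2^n. *)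
have [n hn] : exists n, (g a - g b) / 2 ^+ n <= e.
  exists (Num.truncn ((g a - g b) / e)).+1.
  set n := (Num.truncn _).+1.
  have hn : (g a - g b) / e < n%:R by rewrite Num.Theory.truncnS_gt.
  rewrite ler_pdivrMr ?exprn_gt0//; rewrite ltr_pdivrMr// in hn.
  rewrite (le_trans (ltW hn))// mulrC ler_pM2l//.
  by rewrite -natrX ler_nat ltnW// ltn_expl.
pose k := Num.truncn (l * 2 ^+ n).
have l2 : 0 <= l * 2 ^+ n by rewrite mulr_ge0// exprn_ge0.
have := Num.Theory.truncn_itv l2; rewrite -/k => /andP[k1 k2].
have kn : (k <= 2 ^ n)%N.
  by rewrite -(ler_nat R) (le_trans k1)// natrX ler_piMl// exprn_ge0.
have e2 : 0 < 2 ^+ n :> R by rewrite exprn_gt0.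
have q1 : k%:R / 2 ^+ n <= l by rewrite ler_pdivrMr.
have q2 : l <= k%:R / 2 ^+ n + (2 ^+ n)^-1.
  by rewrite -[X in _ + X]mul1r -mulrDl ler_pdivlMr// natr1 ltW.
have q0 : 0 <= k%:R / 2 ^+ n :> R by rewrite divr_ge0// ltW.
apply: (le_trans (y := g (a + k%:R / 2 ^+ n * (b - a)))).
  apply: gni.
  - by apply: ltr_wpDr => //; rewrite mulr_ge0// subr_ge0.
  - by rewrite lerD2l ler_wpM2r// subr_ge0.
apply: (le_trans (dyadic n k a b a0 ab kn)).
rewrite -subr_ge0 in gab.
have := ler_wpM2r gab q2; lra.
Qed.

(** By convexity the quotients grow as s decreases to 0 and stay below the slope on [a - u, a], so
    they converge to their supremum. *)
Lemma midpoint_convex_right_slope (R : realType) (g : R -> R) (a u : R) :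
  (forall s t, 0 < s -> s <= t -> g t <= g s) ->
  (forall s t, 0 < s -> 0 < t -> g ((s + t) / 2) <= (g s + g t) / 2) ->
  0 < u -> u < a ->
  exists2 S, s^-1 * (g a - g (a + s)) @[s --> 0^'+] --> S &
    S <= (g (a - u) - g a) / u.
Proof.
move=> gni gmid u0 ua; have cvxg := midpoint_convex_slope gni gmid.
have a0 := lt_trans u0 ua.
have ub s : 0 < s -> s^-1 * (g a - g (a + s)) <= (g (a - u) - g a) / u.
  move=> s0; rewrite mulrC ler_pdivrMr// mulrAC ler_pdivlMr//.
  have us0 : 0 < u + s by rewrite addr_gt0.
  have aus : a - u <= a + s by lra.
  have l01 : 0 <= u / (u + s) <= 1.
    rewrite divr_ge0 ?(ltW u0) ?(ltW us0)//= ler_pdivrMr// mul1r.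
    by rewrite lerDl ltW.
  have au0 : 0 < a - u by rewrite subr_gt0.
  have := cvxg _ _ _ au0 aus l01.
  rewrite (_ : a - u + _ = a); last by field; rewrite gt_eqF.
  rewrite -lerBlDl mulrAC ler_pdivlMr// => h.
  by move: h; rewrite mulrDr; lra.
have sub : [set s^-1 * (g a - g (a + s)) | s in [set` `]0, +oo[ : interval R]]
    `<=` [set x | x <= (g (a - u) - g a) / u].
  by move=> y [s]; rewrite /= in_itv/= andbT => s0 <-; exact: ub.
exists (sup [set s^-1 * (g a - g (a + s)) | s in [set` `]0, +oo[ : interval R]]).
- apply: (nonincreasing_at_right_cvgr (f := fun s => s^-1 * (g a - g (a + s)))) => //.
  + move=> s t; rewrite !in_itv/= !andbT => s0 t0 st.
    have := cvxg a (a + t) (s / t) a0.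
    rewrite lerDl (ltW t0) divr_ge0 ?(ltW s0) ?(ltW t0)// ler_pdivrMr// mul1r st.
    rewrite (_ : a + s / t * _ = a + s); last by field; rewrite gt_eqF.
    move=> /(_ isT isT) h.
    rewrite -(ler_pM2l s0) [leRHS]mulVKf ?gt_eqF// mulrA; move: h; rewrite !mulrBr; lra.
  + by exists ((g (a - u) - g a) / u) => y /sub.
- apply: ge_sup; last exact: sub.
  by exists (1^-1 * (g a - g (a + 1))), 1 => //=; rewrite in_itv/= ltr01.
Qed.

(** * Square integrable functions *)

Section square_integrable.
Context {disp : measure_display} {T : measurableType disp} {R : realType}.
Context {mu : {measure set T -> \bar R}}.
Implicit Types f g : T -> R.
Local Notation L2 := (Lfun mu 2%:E).

Lemma Lfun_measurable p f : f \in Lfun mu p -> measurable_fun setT f.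
Proof. by rewrite inE => /andP[/[!inE]]. Qed.

Lemma sqr_LnormE f :
  ('N[mu]_2%:E [EFin \o f] ^+ 2 = \int[mu]_x (f x ^+ 2)%:E)%E.
Proof.
rewrite unlock /Lnorm poweR12_sqrt ?sqr_sqrte; first last.
- by apply: integral_ge0 => x _; exact: poweR_ge0.
- by apply: integral_ge0 => x _; exact: poweR_ge0.
apply: eq_integral => x _ /=.
by rewrite powR_mulrn// real_normK// num_real.
Qed.

Lemma Lfun2P f : f \in L2 <->
  measurable_fun setT f /\ mu.-integrable setT (EFin \o (fun x => f x ^+ 2)).
Proof.
split=> [fL|[mf /integrableP[_ fi]]].
  by split; [exact: Lfun_measurable fL | exact: Lfun2_integrable_sqr].
rewrite inE; apply/andP; split; rewrite inE//= /finite_norm.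
rewrite ltNge leye_eq; apply/negP => /eqP N.
have := sqr_LnormE f; rewrite N => h.
move: fi; rewrite (_ : (\int[mu]_x _ = +oo)%E)//.
under eq_integral do rewrite gee0_abs ?lee_fin ?sqr_ge0//=.
by rewrite -h expe2 mulyy.
Qed.

Lemma Lfun2_dominated f g : measurable_fun setT f -> g \in L2 ->
  {ae mu, forall x, `|f x| <= `|g x|} -> f \in L2.
Proof.
move=> mf /Lfun2P[mg /integrableP[mg2 gi]] fg; apply/Lfun2P; split => //.
apply/integrableP; split.
  by apply/measurable_EFinP; exact: measurable_funX.
apply: le_lt_trans gi.
apply: ae_ge0_le_integral => //.
- apply: measurableT_comp => //.
  by apply/measurable_EFinP; exact: measurable_funX.
- exact: measurableT_comp.
- apply: filterS fg => x /= fg _; rewrite lee_fin !ger0_norm ?sqr_ge0//.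
  by rewrite -(real_normK (num_real (f x))) -(real_normK (num_real (g x))) lerXn2r.
Qed.

Lemma Lfun2_abs f : f \in L2 -> (fun x => `|f x|) \in L2.
Proof.
move=> fL; apply: (Lfun2_dominated _ fL).
  by apply: measurableT_comp => //; exact: Lfun_measurable fL.
by apply/nearW => x; rewrite normr_id.
Qed.

Lemma Lfun2Z f (a : R) : f \in L2 -> (fun x => a * f x) \in L2.
Proof.
move=> fL; rewrite (_ : (fun _ => _) = a \o* f).
  by apply: Lfun_scale => //; rewrite ler1n.
by apply/funext => x /=; rewrite mulrC.
Qed.

Lemma Lfun2D f g : f \in L2 -> g \in L2 -> (fun x => f x + g x) \in L2.
Proof. by have [_] := @Lfun_addr_closed _ _ _ mu 2%:E (lee1n 2); exact. Qed.

Lemma Lfun2B f g : f \in L2 -> g \in L2 -> (fun x => f x - g x) \in L2.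
Proof.
move=> fL /(Lfun2Z (-1)) gL.
rewrite (_ : (fun _ => _) = fun x => f x + -1 * g x); first exact: Lfun2D.
by apply/funext => x; rewrite mulN1r.
Qed.

Lemma integrable_mul2 f g : f \in L2 -> g \in L2 ->
  mu.-integrable setT (EFin \o (fun x => f x * g x)).
Proof. by move=> fL gL; apply/Lfun1_integrable/Lfun2_mul_Lfun1. Qed.

Lemma ae_eq_Rintegral f g : measurable_fun setT f -> measurable_fun setT g ->
  {ae mu, forall x, f x = g x} -> \int[mu]_x f x = \int[mu]_x g x.
Proof.
move=> mf mg fg; congr fine; apply: ae_eq_integral => //.
- exact/measurable_EFinP.
- exact/measurable_EFinP.
- by apply: filterS fg => x /= -> _.
Qed.

Lemma ae_le_Rintegral f g :
  mu.-integrable setT (EFin \o f) -> mu.-integrable setT (EFin \o g) ->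
  {ae mu, forall x, f x <= g x} -> \int[mu]_x f x <= \int[mu]_x g x.
Proof.
move=> fi gi fg; rewrite -subr_ge0 -RintegralB//.
have mfg : measurable_fun setT (fun x => g x - f x).
  by apply: measurable_funB; apply/measurable_EFinP/(measurable_int mu).
rewrite (_ : \int[mu]_x _ = \int[mu]_x `|g x - f x|); last first.
  apply: ae_eq_Rintegral => //; first exact: measurableT_comp.
  by apply: filterS fg => x fg; rewrite ger0_norm// subr_ge0.
by apply: Rintegral_ge0.
Qed.

Lemma EFin_Rintegral f : mu.-integrable setT (EFin \o f) ->
  (\int[mu]_x f x)%:E = (\int[mu]_x (f x)%:E)%E.
Proof. by move=> fi; rewrite fineK// integrable_fin_num. Qed.

Definition inner f g := \int[mu]_x (f x * g x).

Lemma innerC f g : inner f g = inner g f.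
Proof. by apply: eq_Rintegral => x _; rewrite mulrC. Qed.

Lemma innerE f : f \in L2 ->
  (inner f f)%:E = (\int[mu]_x (f x ^+ 2)%:E)%E.
Proof. by move=> fL; rewrite EFin_Rintegral//; exact: integrable_mul2. Qed.

Lemma inner_ge0 f : 0 <= inner f f.
Proof. by apply: Rintegral_ge0 => x _; rewrite -expr2 sqr_ge0. Qed.

Lemma innerBl f g h : f \in L2 -> g \in L2 -> h \in L2 ->
  inner (fun x => f x - g x) h = inner f h - inner g h.
Proof.
move=> fL gL hL; rewrite /inner -RintegralB//; try exact: integrable_mul2.
by apply: eq_Rintegral => x _; rewrite mulrBl.
Qed.

Lemma inner_ae_eq f g h : f \in L2 -> g \in L2 -> h \in L2 ->
  {ae mu, forall x, f x = g x} -> inner f h = inner g h.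
Proof.
move=> /Lfun_measurable mf /Lfun_measurable mg /Lfun_measurable mh fg.
apply: ae_eq_Rintegral; try exact: measurable_funM.
by apply: filterS fg => x ->.
Qed.

(** AM-GM; it stands in for Cauchy-Schwarz in the midpoint convexity of t |-> <P_t f, f> and in the
    duality argument from L^1 to L^oo. *)
Lemma inner_le_sqr f g : f \in L2 -> g \in L2 ->
  inner f g <= (inner f f + inner g g) / 2.
Proof.
move=> fL gL; rewrite ler_pdivlMr// mulrC.
rewrite -RintegralZl//; last exact: integrable_mul2.
rewrite -RintegralD//; try exact: integrable_mul2.
apply: ae_le_Rintegral.
- rewrite (_ : EFin \o _ = (EFin \o (fun x => (2 * f x) * g x))).
    by apply: integrable_mul2 => //; exact: Lfun2Z.
  by apply/funext => x /=; rewrite mulrA.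
- rewrite (_ : EFin \o _ = (EFin \o (fun x => f x * f x)%R) \+
      (EFin \o (fun x => g x * g x)%R))%E//.
  by apply: integrableD => //; exact: integrable_mul2.
- by apply/nearW => x; have := sqr_ge0 (f x - g x); rewrite sqrrB !expr2; lra.
Qed.

Lemma Lnorm2_le f g : f \in L2 -> g \in L2 ->
  ('N[mu]_2%:E [EFin \o f] <= 'N[mu]_2%:E [EFin \o g])%E ->
  inner f f <= inner g g.
Proof.
move=> fL gL fg; rewrite -lee_fin !innerE// -!sqr_LnormE.
by rewrite lee_sqr// Lnorm_ge0.
Qed.

End square_integrable.

(** * Symmetric Markov semigroups *)

Section semigroup.
Context {disp : measure_display} {T : measurableType disp} {R : realType}.
Context {mu : {measure set T -> \bar R}} {P : R -> (T -> R) -> T -> R}.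
Hypothesis muT : mu setT = 1%E.
Hypothesis sgP : markov_semigroup mu P.
Implicit Types f g : T -> R.
Local Notation L2 := (Lfun mu 2%:E).

Lemma Lfun2_cst (a : R) : cst a \in L2.
Proof.
apply/Lfun2P; split => //.
have -> : EFin \o (fun x : T => cst a x ^+ 2) = (fun=> (a ^+ 2)%:E) by [].
apply/integrableP; split => //.
by rewrite integral_cst//= muT mule1 ltry.
Qed.

Lemma Rintegral_probability_cst (a : R) : \int[mu]_x a = a.
Proof. by rewrite Rintegral_cst// muT mulr1. Qed.

Lemma semigroup_inner s t f : 0 < s -> 0 < t -> f \in L2 ->
  inner (mu := mu) (P s f) (P t f) = inner (mu := mu) (P (s + t) f) f.
Proof.
move=> s0 t0 fL; have PtL := semigroup_Lfun sgP t0 fL.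
rewrite /inner (semigroup_symmetric sgP s0 fL PtL) -/(inner _ _) innerC.
apply: inner_ae_eq => //.
- exact: (semigroup_Lfun sgP).
- by apply: (semigroup_Lfun sgP) => //; exact: addr_gt0.
- by have := semigroupD sgP s0 t0 fL; apply: filterS.
Qed.

Lemma semigroup_inner_half t f : 0 < t -> f \in L2 ->
  inner (mu := mu) (P t f) f = inner (mu := mu) (P (t / 2) f) (P (t / 2) f).
Proof.
by move=> t0 fL; rewrite semigroup_inner ?divr_gt0// -splitr.
Qed.

(** For s < t, P_t f = P_(t-s) (P_s f) almost everywhere, and P_(t-s) is a contraction. *)
Lemma semigroup_energy_decr s t f : 0 < s -> s <= t -> f \in L2 ->
  inner (mu := mu) (P t f) (P t f) <= inner (mu := mu) (P s f) (P s f).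
Proof.
move=> s0; rewrite le_eqVlt => /predU1P[->//|st] fL.
have ts0 : 0 < t - s by rewrite subr_gt0.
have PsL := semigroup_Lfun sgP s0 fL.
have PtsL := semigroup_Lfun sgP ts0 PsL.
have PtL := semigroup_Lfun sgP (lt_trans s0 st) fL.
have := semigroupD sgP ts0 s0 fL; rewrite subrK => PD.
rewrite (inner_ae_eq _ _ _ PD)// innerC (inner_ae_eq _ _ _ PD)//.
apply: Lnorm2_le => //; exact: (semigroup_contraction sgP).
Qed.

Lemma semigroup_energy_le t f : 0 < t -> f \in L2 ->
  inner (mu := mu) (P t f) (P t f) <= inner (mu := mu) f f.
Proof.
move=> t0 fL; have PtL := semigroup_Lfun sgP t0 fL.
by apply: Lnorm2_le => //; exact: (semigroup_contraction sgP).
Qed.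

(* The function t |-> <P_t f, f> is midpoint convex and nonincreasing, hence
   convex, so minus its right derivative at 2t, which is E(P_t f, P_t f), is at
   most its slope on [t, 2t]. *)
Lemma semigroup_dissipation E D t f : associated_semigroup mu E D P ->
  0 < t -> f \in L2 ->
  D (P t f) /\
  (E (P t f) (P t f) <=
    ((inner (mu := mu) (P (t / 2) f) (P (t / 2) f)
      - inner (mu := mu) (P t f) (P t f)) / t)%:E)%E.
Proof.
move=> [_ dom form] t0 fL; have PtL := semigroup_Lfun sgP t0 fL.
pose g s := inner (mu := mu) (P s f) f.
have gni r s : 0 < r -> r <= s -> g s <= g r.
  move=> r0 rs; rewrite /g !semigroup_inner_half//; last exact: lt_le_trans rs.
  by apply: semigroup_energy_decr; rewrite ?divr_gt0// ler_pM2r// invr_gt0.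
(* <P_((r+s)/2) f, f> = <P_(r/2) f, P_(s/2) f>, to which AM-GM applies. *)
have gmid r s : 0 < r -> 0 < s -> g ((r + s) / 2) <= (g r + g s) / 2.
  move=> r0 s0; rewrite /g (semigroup_inner_half r0)// (semigroup_inner_half s0)//.
  rewrite mulrDl -semigroup_inner ?divr_gt0//.
  by apply: inner_le_sqr; apply: (semigroup_Lfun sgP) => //; rewrite divr_gt0.
have t2 : t < t + t by rewrite ltrDl.
have [S Scvg Sle] := midpoint_convex_right_slope gni gmid t0 t2.
have gtt : g (t + t) = inner (mu := mu) (P t f) (P t f) by rewrite semigroup_inner.
(* <P_t f - P_s (P_t f), P_t f> = g(2t) - g(2t + s), so the approximating form at P_t f is a
   difference quotient of g at 2t. *)
have apprE : {near 0^'+, (fun s => s^-1 * (g (t + t) - g (t + t + s))) =1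
    (fun s => approximating_form mu P s (P t f) (P t f))}.
  near=> s; have s0 : 0 < s by near: s; exact: nbhs_right_gt.
  rewrite /approximating_form; congr (_ * _).
  have PsL := semigroup_Lfun sgP s0 PtL.
  have PstL : P (s + t) f \in L2 by apply: (semigroup_Lfun sgP) => //; exact: addr_gt0.
  rewrite -/(inner (fun x => _ - _) _) innerBl// -gtt; congr (_ - _).
  rewrite (inner_ae_eq (g := P (s + t) f))//; last first.
    by have := semigroupD sgP s0 t0 fL; apply: filterS.
  rewrite semigroup_inner ?addr_gt0// /g (_ : s + t + t = t + t + s)//.
  by ring.
have cvgS : approximating_form mu P s (P t f) (P t f) @[s --> 0^'+] --> S.
  by apply: cvg_trans Scvg; apply: near_eq_cvg; apply: filterS apprE => s ->.
have DPt : D (P t f) by apply/dom => //; apply/cvg_ex; exists S.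
split=> //.
have -> : E (P t f) (P t f) = S%:E.
  apply: (cvg_unique _ (form _ _ DPt DPt)) => //.
  by apply: cvg_EFin => //; exact: nearW.
rewrite lee_fin (le_trans Sle)// addrK gtt /g semigroup_inner_half//.
Unshelve. all: by end_near. Qed.

(** Symmetry and P_t 1 = 1 make mu invariant. *)
Lemma semigroup_mean t f : 0 < t -> f \in L2 ->
  \int[mu]_x P t f x = \int[mu]_x f x.
Proof.
move=> t0 fL; have PtL := semigroup_Lfun sgP t0 fL.
have L1 := Lfun2_cst 1.
have PL1 := semigroup_Lfun sgP t0 L1.
transitivity (inner (mu := mu) (P t f) (cst 1)).
  by apply: eq_Rintegral => x _; rewrite mulr1.
rewrite /inner (semigroup_symmetric sgP t0 fL L1) -/(inner _ _) innerC.
rewrite (inner_ae_eq (g := cst 1))//; last exact: (semigroup1 sgP).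
by apply: eq_Rintegral => x _; rewrite mul1r.
Qed.

Lemma semigroupZD t a f g : 0 < t -> f \in L2 -> g \in L2 ->
  {ae mu, forall x, P t (fun y => a * f y + g y) x = a * P t f x + P t g x}.
Proof. by move=> t0; exact: (semigroup_linear sgP). Qed.

Lemma semigroup_le t f g : 0 < t -> f \in L2 -> g \in L2 ->
  {ae mu, forall x, f x <= g x} -> {ae mu, forall x, P t f x <= P t g x}.
Proof.
move=> t0 fL gL fg.
have hL : (fun y => -1 * f y + g y) \in L2 by apply: Lfun2D => //; exact: Lfun2Z.
have h0 : {ae mu, forall x, 0 <= -1 * f x + g x}.
  by apply: filterS fg => x; lra.
have := semigroup_positive sgP t0 hL h0; have := semigroupZD (-1) t0 fL gL.
by apply: filterS2 => x ->; lra.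
Qed.

Lemma semigroup_cst t a : 0 < t -> {ae mu, forall x, P t (cst a) x = a}.
Proof.
move=> t0; have L1 := Lfun2_cst 1; have L0 := Lfun2_cst 0.
(* Linearity with f = g = 0 and factor -1 forces P_t 0 = 0; the constant a is then handled as a * 1
   + 0. *)
have := semigroupZD (-1) t0 L0 L0.
have -> : (fun y : T => -1 * cst (0 : R) y + cst 0 y) = cst 0.
  by apply/funext => x /=; rewrite mulr0 addr0.
move=> P0; have := semigroupZD a t0 L1 L0.
have -> : (fun y : T => a * cst (1 : R) y + cst 0 y) = cst a.
  by apply/funext => x /=; rewrite mulr1 addr0.
move=> Pa; have P1 := semigroup1 sgP t0.
by apply: filterS3 P0 Pa P1 => x P0 -> ->; move: P0; lra.
Qed.

Lemma semigroup_bounded t f M : 0 < t -> f \in L2 ->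
  {ae mu, forall x, `|f x| <= M} -> {ae mu, forall x, `|P t f x| <= M}.
Proof.
move=> t0 fL fM.
have L1 a := Lfun2_cst a.
have le1 : {ae mu, forall x, f x <= cst M x}.
  by apply: filterS fM => x; rewrite ler_norml => /andP[].
have ge1 : {ae mu, forall x, cst (- M) x <= f x}.
  by apply: filterS fM => x; rewrite ler_norml => /andP[].
have := semigroup_le t0 (L1 _) fL ge1; have := semigroup_le t0 fL (L1 _) le1.
have := semigroup_cst M t0; have := semigroup_cst (- M) t0.
move=> A B C D; apply: filterS2 (filterI A B) (filterI C D) => x /= [eA eB] [h1 h2].
by rewrite eB in h1; rewrite eA in h2; rewrite ler_norml h1 h2.
Qed.

(** From -|f| <= f <= |f| one gets |P_t f| <= P_t |f|, whose mean is that of |f|. *)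
Lemma semigroup_norm1 t f : 0 < t -> f \in L2 ->
  \int[mu]_x `|P t f x| <= \int[mu]_x `|f x|.
Proof.
move=> t0 fL; have aL := Lfun2_abs fL; have NL := Lfun2Z (-1) aL.
rewrite -(semigroup_mean t0 aL).
have i1 h : h \in L2 -> mu.-integrable setT (EFin \o h).
  move=> hL; have := integrable_mul2 hL (Lfun2_cst 1).
  by congr (integrable _ _ _); apply/funext => x /=; rewrite mulr1.
apply: ae_le_Rintegral.
- by apply: i1; apply: Lfun2_abs; exact: (semigroup_Lfun sgP).
- by apply: i1; exact: (semigroup_Lfun sgP).
- have le1 : {ae mu, forall x, f x <= `|f x|} by apply/nearW => x; exact: ler_norm.
  have ge1 : {ae mu, forall x, -1 * `|f x| <= f x}.
    by apply/nearW => x; have := ler_norm (- f x); rewrite normrN; lra.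
  have := semigroup_le t0 fL aL le1; have := semigroup_le t0 NL fL ge1.
  have := semigroupZD (-1) t0 aL (Lfun2_cst 0).
  have -> : (fun y : T => -1 * `|f y| + cst (0 : R) y) = (fun y => -1 * `|f y|).
    by apply/funext => x /=; rewrite addr0.
  have := semigroup_cst 0 t0.
  move=> A B C D; apply: filterS2 (filterI A B) (filterI C D) => x /= [eA eB] [h1 h2].
  by rewrite eB eA addr0 mulN1r in h1; rewrite ler_norml h1 h2.
Qed.

End semigroup.

(* Compare the supremum of phi on ]0, T] with its half. *)
Lemma half_iteration (R : realType) (phi : R -> R) (T B K : R) :
  (forall t, 0 < t -> t <= T -> phi t <= B) ->
  (forall t, 0 < t -> t <= T -> phi t <= phi (t / 2) / 2 + K) ->
  forall t, 0 < t -> t <= T -> phi t <= 2 * K.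
Proof.
move=> phiB phiK t t0 tT.
pose A := [set phi t | t in [set t | 0 < t <= T]].
(* B makes the supremum finite, so that half of it can be subtracted from both sides at the end. *)
have ubA : has_ubound A by exists B => _ [s /andP[s0 sT] <-]; exact: phiB.
have leA s : 0 < s -> s <= T -> phi s <= sup A.
  by move=> s0 sT; apply: ub_le_sup => //; exists s => //=; rewrite s0 sT.
have : sup A <= sup A / 2 + K.
  apply: ge_sup; first by exists (phi t), t => //=; rewrite t0 tT.
  move=> _ [s /andP[s0 sT] <-]; apply: (le_trans (phiK s s0 sT)).
  rewrite lerD2r ler_pM2r ?invr_gt0//; apply: leA; first by rewrite divr_gt0.
  by rewrite ler_pdivrMr// (le_trans sT)// ler_peMr ?ler1n//; lra.
by have := leA t t0 tT; lra.
Qed.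

Lemma powR_ge1 (R : realType) (a p : R) : 1 <= a -> 0 <= p -> 1 <= a `^ p.
Proof. by move=> a1 p0; rewrite -[leLHS](powRr0 a) ler_powR. Qed.

Lemma powRN_ge1 (R : realType) (a p : R) : 0 < a <= 1 -> 0 <= p -> 1 <= a `^ (- p).
Proof. by move=> a1 p0; rewrite -[leLHS](powRr0 a) ger_powR// oppr_le0. Qed.

Lemma powR2N_lt1 (R : realType) (a : R) : 0 < a -> 2 `^ (- a) < 1 :> R.
Proof.
move=> a0; rewrite powRN invf_lt1 ?powR_gt0//.
have {1}-> : 1 = 1 `^ a :> R by rewrite powR1.
by rewrite gt0_ltr_powR// ?nnegrE// ltr1n.
Qed.

Lemma le_powRN (R : realType) (a s t : R) :
  0 < a -> 0 < s -> s <= t -> t `^ (- a) <= s `^ (- a).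
Proof.
move=> a0 s0 st; have t0 := lt_le_trans s0 st.
rewrite !powRN lef_pV2 ?posrE ?powR_gt0// ge0_ler_powR ?nnegrE//; exact: ltW.
Qed.

(** * From functional inequalities to semigroup bounds *)

Section decay.
Context {disp : measure_display} {T : measurableType disp} {R : realType}.
Context {mu : {measure set T -> \bar R}} {P : R -> (T -> R) -> T -> R}.
Context {E : (T -> R) -> (T -> R) -> \bar R} {D : set (T -> R)}.
Hypothesis muT : mu setT = 1%E.
Hypothesis asP : associated_semigroup mu E D P.
Implicit Types f g : T -> R.
Local Notation L2 := (Lfun mu 2%:E).
Local Notation inner := (inner (mu := mu)).

Let sgP : markov_semigroup mu P := associated_markov asP.

Lemma integrable_Lfun2 f : f \in L2 -> mu.-integrable setT (EFin \o f).
Proof.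
move=> fL; have := integrable_mul2 fL (Lfun2_cst muT 1).
by congr (integrable _ _ _); apply/funext => x /=; rewrite mulr1.
Qed.

Lemma integrable_abs_Lfun2 f : f \in L2 ->
  mu.-integrable setT (EFin \o (fun x => `|f x|)).
Proof. by move=> fL; apply: integrable_Lfun2; exact: Lfun2_abs. Qed.

Lemma Lnormy_le f M : measurable_fun setT f -> 0 <= M ->
  ('N[mu]_+oo [EFin \o f] <= M%:E)%E <-> {ae mu, forall x, `|f x| <= M}.
Proof.
move=> mf M0; rewrite unlock /Lnorm muT lte01; split.
  by move=> /ess_supP; apply: filterS => x.
by move=> fM; apply/ess_supP; apply: filterS fM => x.
Qed.

Lemma measurable_gt f K : measurable_fun setT f ->
  measurable [set x | K < f x].
Proof.
move=> mf; rewrite (_ : [set x | _] = setT `&` f @^-1` `]K, +oo[); first exact: mf.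
by apply/seteqP; split=> x /=; rewrite in_itv/= andbT// => -[].
Qed.

Lemma Lfun2_indic A : measurable A -> \1_A \in L2.
Proof.
move=> mA; apply: (Lfun2_dominated _ (Lfun2_cst muT 1)).
  exact: measurable_indic.
by apply/nearW => x; rewrite indicE /= normr1; case: (_ \in _); rewrite ?normr1 ?normr0.
Qed.

(** Test with A = {f > K}: the integral of the nonnegative function (f - K) 1_A is then at most 0,
    so A is a null set. *)
Lemma ae_le_of_inner_indic f K : f \in L2 ->
  (forall A, measurable A -> inner f \1_A <= K * inner \1_A \1_A) ->
  {ae mu, forall x, f x <= K}.
Proof.
move=> fL fK; have mf := Lfun_measurable fL.
have mA := measurable_gt K mf; set A := [set x | _] in mA.
have AL := Lfun2_indic mA.
have fKL : (fun x => f x - K) \in L2 by apply: Lfun2B => //; exact: Lfun2_cst.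
pose F x := (f x - K) * \1_A x.
have F0 x : 0 <= F x.
  rewrite /F indicE; have [|] := boolP (x \in A); last by rewrite mulr0.
  by rewrite inE /A/= mulr1 subr_ge0 => /ltW.
have Fi : mu.-integrable setT (EFin \o F) by exact: integrable_mul2.
have : \int[mu]_x F x <= 0.
  rewrite -[leLHS]/(inner (fun x => f x - K) \1_A).
  rewrite innerBl//; last exact: (Lfun2_cst muT).
  rewrite subr_le0 (le_trans (fK A mA))// /inner -RintegralZl//; last exact: integrable_mul2.
  rewrite le_eqVlt; apply/orP; left; apply/eqP; apply: eq_Rintegral => x _.
  by rewrite indicE; case: (_ \in _); rewrite ?mulr1// !mulr0.
move=> intF.
have : (\int[mu]_x `|(F x)%:E| = 0)%E.
  under eq_integral do rewrite gee0_abs ?lee_fin//.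
  apply/eqP; rewrite eq_le -[X in (X <= _)%E]EFin_Rintegral// lee_fin intF/=.
  by apply: integral_ge0 => x _; rewrite lee_fin.
have mF : measurable_fun setT (EFin \o F) by exact: (measurable_int mu).
move/(ae_eq_integral_abs mu measurableT mF).
apply: filterS => x /= /(_ I) [Fx0]; rewrite leNgt; apply/negP => Kfx.
by move: Fx0; rewrite /F indicE mem_set// mulr1 => /eqP; rewrite subr_eq0 gt_eqF.
Qed.

Section nash.
Variables c p : R.
Hypothesis c0 : 0 < c.
Hypothesis p0 : 0 < p.
Hypothesis superP : forall r f, 0 < r -> D f -> f \in L2 ->
  (\int[mu]_x (f x ^+ 2)%:E <=
    r%:E * E f f + (c * (1 + r `^ (- p)))%:E * (\int[mu]_x `|f x|%:E) ^+ 2)%E.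

(** With w(s) = 1 + s^-p one has w(s / 2) <= 2^p w(s), so delta 2^p = 1/2 gives the recursion factor
    1/2 for <P_s f, P_s f> / w(s). K bounds the remaining term by K w(s), because delta <= 1. *)
Let delta : R := (2 * 2 `^ p)^-1.
Let K : R := c * delta `^ (- p).

Let delta0 : 0 < delta.
Proof. by rewrite invr_gt0 mulr_gt0// powR_gt0. Qed.

Let delta1 : delta <= 1.
Proof.
rewrite invf_le1 ?mulr_gt0// ?powR_gt0// (le_trans (y := 2 * 1))//.
  by rewrite mulr1 ler1n.
by rewrite ler_pM2l// powR_ge1 ?ler1n// ltW.
Qed.

(** The inequality is applied to P_t f with r = delta t, which cancels the factor 1/t of
    [semigroup_dissipation]; the L^1 norm stays at most 1 by [semigroup_norm1]. *)
Lemma super_poincare_step t f : 0 < t -> f \in L2 -> \int[mu]_x `|f x| <= 1 ->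
  inner (P t f) (P t f) <=
  delta * inner (P (t / 2) f) (P (t / 2) f) + c * (1 + (delta * t) `^ (- p)).
Proof.
move=> t0 fL f1; have PtL := semigroup_Lfun sgP t0 fL.
have [DPt EPt] := semigroup_dissipation sgP asP t0 fL.
have dt0 : 0 < delta * t by rewrite mulr_gt0.
have := superP dt0 DPt PtL; rewrite -innerE//.
set h := inner (P t f) (P t f); set h2 := inner (P (t / 2) f) _ in EPt *.
set b := c * _; have b0 : 0 <= b.
  by rewrite mulr_ge0 ?addr_ge0 ?powR_ge0 ?ltW.
have N1 : ((\int[mu]_x `|P t f x|%:E) ^+ 2 <= 1)%E.
  rewrite -EFin_Rintegral ?integrable_abs_Lfun2// -EFin_expe lee_fin.
  rewrite expr_le1//; last by apply: Rintegral_ge0.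
  exact: le_trans (semigroup_norm1 muT sgP t0 fL) f1.
move=> H; suff : h <= delta * (h2 - h) + b.
  have h0 : 0 <= h by exact: inner_ge0.
  by have := mulr_ge0 (ltW delta0) h0; rewrite mulrBr; lra.
rewrite -lee_fin (le_trans H)// EFinD leeD//.
  rewrite (le_trans (lee_wpmul2l _ EPt)) ?lee_fin ?(ltW dt0)//.
  by rewrite -mulrA [t * _]mulrC divfK ?gt_eqF.
by rewrite -[leRHS]mule1 lee_wpmul2l// lee_fin.
Qed.

(** [half_iteration] for <P_s f, P_s f> / w(s). The a priori bound <f, f> depends on the L^2 norm of
    f, but the resulting bound involves only its L^1 norm. *)
Lemma super_poincare_L1_L2 t f : 0 < t -> f \in L2 -> \int[mu]_x `|f x| <= 1 ->
  inner (P t f) (P t f) <= 2 * K * (1 + t `^ (- p)).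
Proof.
move=> t0 fL f1; rewrite -ler_pdivrMr ?addr_gt0 ?ltr01 ?powR_gt0//.
pose w s : R := 1 + s `^ (- p); pose h s := inner (P s f) (P s f).
have w0 s : 0 < s -> 0 < w s by move=> s0; rewrite addr_gt0 ?powR_gt0.
have w1 s : 1 <= w s by rewrite lerDl powR_ge0.
have ff := inner_ge0 (mu := mu) f.
apply: (half_iteration (phi := fun s => h s / w s) (T := t) (B := inner f f)) => // s s0 _.
  rewrite ler_pdivrMr ?w0// (le_trans (semigroup_energy_le sgP s0 fL))//.
  by rewrite ler_peMr.
rewrite ler_pdivrMr ?w0// (le_trans (super_poincare_step s0 fL f1))//.
have s20 : 0 < s / 2 by rewrite divr_gt0.
rewrite mulrDl lerD//.
- have w2 : w (s / 2) <= 2 `^ p * w s.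
    rewrite /w mulrDr mulr1 lerD//.
      by rewrite powR_ge1 ?ler1n// ltW.
    by rewrite powRM ?invr_ge0 ?(ltW s0)// mulrC -powR_inv1// -powRrM mulN1r opprK.
  have h20 : 0 <= h (s / 2) by exact: inner_ge0.
  have d2 : delta * (2 * w (s / 2)) <= w s.
    have e : 2 * delta * 2 `^ p = 1 by rewrite /delta; field; rewrite gt_eqF ?powR_gt0.
    rewrite mulrCA mulrA (le_trans (ler_wpM2l _ w2)) ?mulr_ge0 ?(ltW delta0)//.
    by rewrite mulrA e mul1r.
  rewrite -/(h _) (_ : _ / 2 * _ = h (s / 2) * w s / (2 * w (s / 2))); last first.
    by rewrite invfM [2^-1 * _]mulrC !mulrA [h _ * w s * _]mulrAC [LHS]mulrAC.
  rewrite ler_pdivlMr ?mulr_gt0 ?w0//.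
  by rewrite mulrAC [leRHS]mulrC ler_wpM2r.
- rewrite /K -mulrA ler_wpM2l ?(ltW c0)// powRM ?(ltW s0)// ?(ltW delta0)//.
  rewrite /w mulrDr mulr1 lerD2r.
  by rewrite powRN_ge1 ?delta0 ?delta1// ltW.
Qed.

(* Since P_t = P_(t/2) P_(t/2), the integral of P_t f against g is the inner
   product of P_(t/2) f and P_(t/2) g; take for g normalized indicators. *)
Lemma super_poincare_L1_Linfty t f : 0 < t -> f \in L2 ->
  \int[mu]_x `|f x| <= 1 ->
  {ae mu, forall x, P t f x <= 2 * K * (1 + (t / 2) `^ (- p))}.
Proof.
move=> t0 fL f1; have PtL := semigroup_Lfun sgP t0 fL.
have t20 : 0 < t / 2 by rewrite divr_gt0.
apply: ae_le_of_inner_indic => // A mA; have AL := Lfun2_indic mA.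
set M := 2 * K * _; set m := inner \1_A \1_A.
have M0 : 0 < M.
  by rewrite !mulr_gt0 ?powR_gt0// addr_gt0 ?powR_gt0.
have m0 : 0 <= m by exact: inner_ge0.
have mE : m = \int[mu]_x \1_A x.
  apply: eq_Rintegral => x _.
  by rewrite indicE; case: (_ \in _); rewrite ?mulr1// mulr0.
have bound g : g \in L2 -> \int[mu]_x `|g x| <= 1 -> inner (P t f) g <= M.
  move=> gL g1; have PgL := semigroup_Lfun sgP t20 gL.
  have PfL := semigroup_Lfun sgP t20 fL.
  rewrite (inner_ae_eq (g := P (t / 2) (P (t / 2) f)))//; last 2 first.
  - exact: (semigroup_Lfun sgP).
  - by have := semigroupD sgP t20 t20 fL; rewrite -splitr.
  rewrite /inner (semigroup_symmetric sgP t20 PfL gL).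
  apply: (le_trans (inner_le_sqr PfL PgL)).
  have := super_poincare_L1_L2 t20 fL f1; have := super_poincare_L1_L2 t20 gL g1.
  rewrite -/M; lra.
(* The test function is 1_A / (m + e / M); the shift avoids dividing by m = mu(A), which may be
   0. *)
apply/ler_addgt0Pl => e e0; rewrite addrC.
have me0 : 0 < m + e / M by rewrite ltr_wpDl// divr_gt0.
have -> : M * m + e = M * (m + e / M) by rewrite mulrDr mulrCA divff ?mulr1// gt_eqF.
rewrite -ler_pdivrMr// -[leLHS]mulrC /inner -RintegralZl//; last exact: integrable_mul2.
under eq_Rintegral do rewrite mulrCA.
apply: bound; first exact: Lfun2Z.
under eq_Rintegral do rewrite normrM ger0_norm ?invr_ge0 ?(ltW me0)// [`|\1_A _|]ger0_norm//.
rewrite RintegralZl//; last exact: integrable_Lfun2.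
by rewrite -mE mulrC ler_pdivrMr// mul1r lerDl divr_ge0// ltW.
Qed.

Lemma super_poincare_ultracontractive :
  exists2 lambda : R, 0 < lambda & forall t, 0 < t ->
    (operator_norm mu 1 +oo (P t) <= (lambda * (1 + t `^ (- p)))%:E)%E.
Proof.
exists (2 * K * 2 `^ p) => [|t t0].
  by rewrite !mulr_gt0 ?powR_gt0.
apply: ge_ereal_sup => _ [f [fL _ f1] <-].
have PtL := semigroup_Lfun sgP t0 fL.
have {}f1 : \int[mu]_x `|f x| <= 1.
  rewrite -lee_fin EFin_Rintegral ?integrable_abs_Lfun2//.
  by move: f1; rewrite Lnorm1.
apply/Lnormy_le; first exact: Lfun_measurable PtL.
  by rewrite !mulr_ge0 ?addr_ge0 ?powR_ge0 ?(ltW c0).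
(* The lower bound on P_t f is the upper bound for -f. *)
have NfL := Lfun2Z (-1) fL.
have Nf1 : \int[mu]_x `|-1 * f x| <= 1.
  by under eq_Rintegral do rewrite mulN1r normrN.
have := semigroupZD sgP (-1) t0 fL (Lfun2_cst muT 0).
rewrite (_ : (fun y => _) = (fun x => -1 * f x)); last first.
  by apply/funext => x; rewrite addr0.
move=> PN; have P0 := semigroup_cst muT sgP 0 t0.
have le1 := super_poincare_L1_Linfty t0 fL f1.
have le2 := super_poincare_L1_Linfty t0 NfL Nf1.
have KK : 2 * K * (1 + (t / 2) `^ (- p)) <= 2 * K * 2 `^ p * (1 + t `^ (- p)).
  rewrite -[leRHS]mulrA ler_wpM2l ?mulr_ge0 ?powR_ge0 ?(ltW c0)//.
  rewrite mulrDr mulr1 lerD//; first by rewrite powR_ge1 ?ler1n// ltW.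
  by rewrite powRM ?invr_ge0 ?(ltW t0)// mulrC -powR_inv1// -powRrM mulN1r opprK.
apply: filterS2 (filterI PN P0) (filterI le1 le2) => x /= [eA eB] [h1 h2].
rewrite (le_trans _ KK)// ler_norml h1 andbT.
by rewrite eA eB in h2; move: h2; lra.
Qed.

End nash.

Section weak.
Variables c theta : R.
Hypothesis c0 : 0 < c.
Hypothesis theta0 : 0 < theta.
Hypothesis weakP : forall r f, 0 < r -> D f -> f \in L2 ->
  (\int[mu]_x (f x)%:E = 0)%E ->
  (\int[mu]_x (f x ^+ 2)%:E <=
    (c * (1 + r `^ (- theta)))%:E * E f f
    + r%:E * ('N[mu]_+oo [EFin \o f]) ^+ 2)%E.

(** The quantity iterated is <P_s f, P_s f> s^(1/theta). Replacing s by s / 2 costs 2^(1/theta), and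
    with the r chosen in [weak_poincare_decay] the recursion factor becomes (B + s) / (4 s), which
    is at most 1/2 as soon as s >= B. *)
Let B : R := 4 * c * 2 `^ theta^-1.
Let K : R := B `^ theta^-1.

Let B0 : 0 < B. Proof. by rewrite !mulr_gt0// powR_gt0. Qed.

(** The bound 2 is the one satisfied by f - mu(f) when |f| <= 1; P_t f inherits it by
    [semigroup_bounded], which produces the term 4 r. *)
Lemma weak_poincare_step t r f : 0 < t -> 0 < r -> f \in L2 ->
  \int[mu]_x f x = 0 -> {ae mu, forall x, `|f x| <= 2} ->
  inner (P t f) (P t f) <=
  c * (1 + r `^ (- theta)) / t * inner (P (t / 2) f) (P (t / 2) f) + 4 * r.
Proof.
move=> t0 r0 fL fm fM; have PtL := semigroup_Lfun sgP t0 fL.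
have [DPt EPt] := semigroup_dissipation sgP asP t0 fL.
have Pm : (\int[mu]_x (P t f x)%:E = 0)%E.
  by rewrite -EFin_Rintegral ?integrable_Lfun2// (semigroup_mean muT sgP)// fm.
have := weakP r0 DPt PtL Pm; rewrite -innerE//.
set h := inner (P t f) (P t f); set h2 := inner (P (t / 2) f) _ in EPt *.
set b := c * _; have b0 : 0 <= b.
  by rewrite mulr_ge0 ?addr_ge0 ?powR_ge0 ?(ltW c0).
have N1 : (('N[mu]_+oo [EFin \o P t f]) ^+ 2 <= 4%:E)%E.
  have N2 : ('N[mu]_+oo [EFin \o P t f] <= 2%:E)%E.
    by apply/Lnormy_le => //; [exact: Lfun_measurable PtL | exact: (semigroup_bounded muT sgP)].
  rewrite (le_trans (y := (2%:E ^+ 2)%E))//; first by rewrite lee_sqr ?Lnorm_ge0.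
  by rewrite -EFin_expe lee_fin -natrX.
move=> H; have h0 : 0 <= h by exact: inner_ge0.
suff : h <= b * ((h2 - h) / t) + r * 4.
  have := mulr_ge0 (divr_ge0 b0 (ltW t0)) h0.
  by rewrite mulrA mulrAC mulrBr; lra.
rewrite -lee_fin (le_trans H)// EFinD leeD//.
  by rewrite (le_trans (lee_wpmul2l _ EPt)) ?lee_fin// lee_fin.
by rewrite EFinM lee_wpmul2l// lee_fin ltW.
Qed.

Lemma weak_poincare_decay t f : 0 < t -> f \in L2 ->
  \int[mu]_x f x = 0 -> {ae mu, forall x, `|f x| <= 2} ->
  inner (P t f) (P t f) <= 8 * K / t `^ theta^-1.
Proof.
move=> t0 fL fm fM; rewrite ler_pdivlMr ?powR_gt0//.
pose h s := inner (P s f) (P s f).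
have h4 s : 0 < s -> h s <= 4.
  move=> s0; apply: (le_trans (semigroup_energy_le sgP s0 fL)).
  have L2c := Lfun2_cst muT 2.
  apply: (le_trans (y := inner (cst 2) (cst 2))).
    apply: ae_le_Rintegral; try exact: integrable_mul2.
    apply: filterS fM => x fM; rewrite -!expr2 -(real_normK (num_real (f x))).
    by rewrite /= lerXn2r ?nnegrE.
  rewrite /inner (_ : \int[mu]_x _ = \int[mu]_x (2 * 2)); last exact: eq_Rintegral.
  by rewrite Rintegral_cst// muT mulr1 -natrM.
have h0 s : 0 <= h s by exact: inner_ge0.
have q0 : 0 <= theta^-1 by rewrite invr_ge0 ltW.
rewrite (_ : 8 * K = 2 * (4 * K)); last by ring.
apply: (half_iteration (phi := fun s => h s * s `^ theta^-1) (T := t)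
  (B := 4 * t `^ theta^-1)) => // s s0 st.
  rewrite ler_pM ?h0 ?powR_ge0 ?h4// ge0_ler_powR// ?nnegrE; exact: ltW.
have s20 : 0 < s / 2 by rewrite divr_gt0.
(* For s <= B the trivial bound 4 on h suffices. *)
have [sB|Bs] := leP s B.
  rewrite (le_trans (y := 4 * K))//.
    rewrite ler_pM ?h0 ?powR_ge0 ?h4// /K ge0_ler_powR// ?nnegrE; exact: ltW.
  by rewrite lerDr !mulr_ge0 ?powR_ge0.
(* With this r, r s^(1/theta) = K does not depend on s and r^(-theta) = s / B. *)
pose r := K * s `^ (- theta^-1).
have r0 : 0 < r by rewrite mulr_gt0 ?powR_gt0.
have := weak_poincare_step s0 r0 fL fm fM; rewrite -/(h _) -/(h _) => step.
have sq0 : 0 < s `^ theta^-1 by rewrite powR_gt0.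
have rE : r `^ (- theta) = s / B.
  rewrite powRM ?powR_ge0// /K -!powRrM mulrNN mulVf ?gt_eqF//.
  by rewrite mulrN mulVf ?gt_eqF// powRr1 ?(ltW s0)// powR_inv1 ?(ltW B0)// mulrC.
have rs : r * s `^ theta^-1 = K by rewrite /r powRN mulfVK// gt_eqF.
have := ler_wpM2r (ltW sq0) step; rewrite mulrDl -[4 * r * _]mulrA rs.
move=> /le_trans; apply; rewrite lerD2r rE.
have sE : s `^ theta^-1 = 2 `^ theta^-1 * (s / 2) `^ theta^-1.
  by rewrite -powRM ?(ltW s20)// [2 * _]mulrC divfK.
set X := h (s / 2) * (s / 2) `^ theta^-1.
have X0 : 0 <= X by rewrite mulr_ge0 ?powR_ge0 ?h0.
rewrite (_ : c * _ / s * _ * _ = c * 2 `^ theta^-1 * (1 + s / B) / s * X); last first.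
  by rewrite sE /X; ring.
rewrite [leRHS]mulrC ler_wpM2r// ler_pdivrMr//.
have -> : c * 2 `^ theta^-1 = B / 4 by rewrite /B; field.
have -> : B / 4 * (1 + s / B) = (B + s) / 4 by field; rewrite gt_eqF.
by move: Bs; lra.
Qed.

(** P_t f - mu(f) = P_t (f - mu(f)) almost everywhere, and f - mu(f) has mean 0 and is bounded by 2
    when |f| <= 1. *)
Lemma weak_poincare_semigroup :
  exists2 lambda : R, 0 < lambda & forall t, 0 < t ->
    (operator_norm mu +oo 2%:E
       (fun f x => P t f x - \int[mu]_y f y)%R ^+ 2 <=
     (lambda / t `^ theta^-1)%:E)%E.
Proof.
exists (8 * K) => [|t t0]; first by rewrite mulr_gt0// powR_gt0.
set S := fun (f : T -> R) x => P t f x - \int[mu]_y f y.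
set b := 8 * K / _; have b0 : 0 <= b by rewrite !mulr_ge0 ?invr_ge0 ?powR_ge0.
have Sb f : f \in L2 -> ('N[mu]_+oo [EFin \o f] <= 1)%E ->
    ('N[mu]_2%:E [EFin \o S f] ^+ 2 <= b%:E)%E.
  move=> fL /Lnormy_le => /(_ (Lfun_measurable fL) ler01) f1.
  set m := \int[mu]_y f y.
  have m1 : `|m| <= 1.
    rewrite (le_trans (le_normr_Rintegral _ (integrable_Lfun2 fL)))//.
    rewrite (le_trans (y := \int[mu]_x (cst 1 x)))//.
      apply: ae_le_Rintegral => //; first exact: integrable_abs_Lfun2.
      exact: (integrable_Lfun2 (Lfun2_cst muT 1)).
    by rewrite Rintegral_cst// muT mulr1.
  pose f0 x := -1 * cst m x + f x.
  have f0L : f0 \in L2 by apply: Lfun2D => //; apply: Lfun2Z; exact: Lfun2_cst.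
  have f0m : \int[mu]_x f0 x = 0.
    rewrite /f0 RintegralD//; last 2 first.
    - by apply: integrable_Lfun2; apply: Lfun2Z; exact: Lfun2_cst.
    - exact: integrable_Lfun2.
    rewrite RintegralZl//; last exact: (integrable_Lfun2 (Lfun2_cst muT m)).
    by rewrite Rintegral_cst// muT/= mulr1 mulN1r addNr.
  have f0M : {ae mu, forall x, `|f0 x| <= 2}.
    apply: filterS f1 => x fx; rewrite /f0 /= mulN1r.
    by rewrite (le_trans (ler_normD _ _))// normrN; move: m1 fx; lra.
  have PtL := semigroup_Lfun sgP t0 fL; have Pt0L := semigroup_Lfun sgP t0 f0L.
  have SL : S f \in L2 by apply: Lfun2B => //; exact: (Lfun2_cst muT).
  have SE : {ae mu, forall x, S f x = P t f0 x}.
    have := semigroupZD sgP (-1) t0 (Lfun2_cst muT m) fL.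
    have := semigroup_cst muT sgP m t0.
    by apply: filterS2 => x e1 e2; rewrite /S e2 e1 mulN1r addrC.
  rewrite sqr_LnormE -innerE// (inner_ae_eq _ _ _ SE)// innerC.
  by rewrite (inner_ae_eq _ _ _ SE)// lee_fin weak_poincare_decay.
rewrite -[leRHS]sqr_sqrte ?lee_fin// lee_sqr ?sqrte_ge0//.
  apply: ge_ereal_sup => _ [f [fL _ f1] <-].
  by rewrite -lee_sqr ?sqrte_ge0 ?Lnorm_ge0// sqr_sqrte ?lee_fin// Sb.
(* Comparing squares requires the operator norm to be nonnegative; f = 0 is a member of the unit
   ball that shows it. *)
apply: (le_trans (Lnorm_ge0 mu 2%:E (EFin \o S (cst 0)))).
apply: ereal_sup_ubound; exists (cst 0) => //; split.
- exact: Lfun2_cst.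
- rewrite inE; apply/andP; split; rewrite inE//= /finite_norm.
  by rewrite (Lnorm0 mu).
- by rewrite (Lnorm0 mu).
Qed.

End weak.
End decay.

(** * Lebesgue measure of cubes and dyadic integrals *)

Section density.
Context {disp : measure_display} {T : measurableType disp} {R : realType}.
Context {mu nu : {measure set T -> \bar R}} {w : T -> R}.
Hypothesis mw : measurable_fun setT w.
Hypothesis w0 : forall x, 0 <= w x.
Hypothesis nuE : forall A, measurable A -> nu A = (\int[mu]_(x in A) (w x)%:E)%E.

Import HBNNSimple.

Let mwE : measurable_fun setT (EFin \o w).
Proof. exact/measurable_EFinP. Qed.

Let integral_density_indic A : measurable A ->
  (\int[nu]_x (\1_A x)%:E = \int[mu]_x ((\1_A x)%:E * (w x)%:E))%E.
Proof.
move=> mA; rewrite integral_indic//= setIT nuE// integral_mkcond.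
apply: eq_integral => x _; rewrite patchE indicE.
by case: (_ \in _); rewrite ?mul1e ?mul0e.
Qed.

Let integral_density_nnsfun (f : {nnsfun T >-> R}) :
  (\int[nu]_x (f x)%:E = \int[mu]_x ((f x)%:E * (w x)%:E))%E.
Proof.
under [LHS]eq_integral do rewrite fimfunE -fsumEFin//.
rewrite ge0_integral_fsum//; last 2 first.
- by move=> r; exact/measurable_EFinP/measurableT_comp.
- by move=> r x _; rewrite EFinM nnfun_muleindic_ge0.
under [RHS]eq_integral => x _.
  rewrite muleC fimfunE -fsumEFin// ge0_mule_fsumr; last first.
    by move=> r; rewrite EFinM nnfun_muleindic_ge0.
  over.
rewrite ge0_integral_fsum//; last 2 first.
- by move=> r; apply: emeasurable_funM => //; exact/measurable_EFinP/measurableT_comp.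
- move=> r x _; rewrite mule_ge0//; first by rewrite lee_fin.
  by rewrite EFinM nnfun_muleindic_ge0.
apply: eq_fsbigr => r _; rewrite integralZl_indic_nnsfun//= integral_density_indic//.
have mi : measurable_fun setT (fun x => ((\1_(f @^-1` [set r]) x)%:E * (w x)%:E)%E).
  by apply: emeasurable_funM => //; exact/measurable_EFinP/measurable_indic.
(* A negative level has an empty preimage; for r >= 0 the scalar can be taken out of the
   integral. *)
have [r0|r0] := ltP r 0.
  rewrite preimage_nnfun0// indic0.
  by rewrite !integral0_eq ?mule0// => x _; rewrite ?mul0e ?mulr0 ?mule0.
rewrite -ge0_integralZl//.
- by apply: eq_integral => x _; rewrite EFinM muleA [RHS]muleC.
- by move=> x _; rewrite mule_ge0 ?lee_fin.
Qed.

(** From indicators to simple functions by linearity, then to all measurable functions by monotone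
    convergence. *)
Lemma ge0_integral_density (f : T -> \bar R) : measurable_fun setT f ->
  (forall x, 0 <= f x)%E ->
  (\int[nu]_x f x = \int[mu]_x (f x * (w x)%:E))%E.
Proof.
move=> mf f0; pose f_ := nnsfun_approx measurableT mf.
have f_cvg x : (f_ n x)%:E @[n --> \oo] --> f x by exact: cvg_nnsfun_approx.
have nd_f x : nondecreasing_seq (fun n => (f_ n x)%:E).
  by move=> m n mn; rewrite lee_fin; exact/lefP/nd_nnsfun_approx.
transitivity (limn (fun n => \int[nu]_x (f_ n x)%:E)%E).
  rewrite -monotone_convergence//=.
  - by apply: eq_integral => x _; apply/esym/cvg_lim.
  - by move=> n; exact/measurable_EFinP/measurable_funTS.
  - by move=> n x _; rewrite lee_fin.
transitivity (limn (fun n => \int[mu]_x ((f_ n x)%:E * (w x)%:E))%E).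
  by apply: congr_lim; apply/funext => n; exact: integral_density_nnsfun.
rewrite -monotone_convergence//=.
- by apply: eq_integral => x _; apply/cvg_lim => //; apply: cvgeMr.
- move=> n; apply: emeasurable_funM => //.
  exact/measurable_EFinP/measurable_funTS.
- by move=> n x _; rewrite mule_ge0 ?lee_fin.
- by move=> x _ m n mn; rewrite lee_wpmul2r ?lee_fin ?w0//; exact: nd_f.
Qed.

End density.

Section boxes.
Context {R : realType}.

Definition box d (c : d.-tuple R) (s : R) : set (d.-tuple R) :=
  [set y | forall i, `|tnth y i - tnth c i| <= s].

Lemma measurable_box d (c : d.-tuple R) s : measurable (box c s).
Proof.
rewrite (_ : box c s = \bigcap_(i in [set: 'I_d])
    (setT `&` (fun y => tnth y i) @^-1` `[tnth c i - s, tnth c i + s])).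
  apply: fin_bigcap_measurable => // i _.
  by apply: measurable_tnth => //; exact: measurable_itv.
apply/seteqP; split => [y ys i _|y ys i].
  by split => //; rewrite /preimage/= in_itv/= -ler_distl.
by have [_] := ys i I; rewrite /preimage/= in_itv/= -ler_distl.
Qed.

(** Under [cons_pair] the cube corresponds to an interval times a cube in one dimension less. *)
Lemma lebesgue_tuple_box d (c : d.-tuple R) s : 0 <= s ->
  lebesgue_tuple (box c s) = ((2 * s) ^+ d)%:E.
Proof.
move=> s0; elim: d c => [|d IH] c.
  rewrite /= expr0 diracE mem_set// => -[]//.
pose c' : d.-tuple R := [tuple of behead c].
have c'E i : tnth c' i = tnth c (lift ord0 i).
  by rewrite tnth_behead; congr tnth; apply/val_inj; rewrite /= inordK// ltnS.
have -> : lebesgue_tuple (box c s) =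
    (lebesgue_measure \x @lebesgue_tuple R d)%E
      (`[tnth c ord0 - s, tnth c ord0 + s] `*` box c' s).
  rewrite /= /lebesgue_cons /pushforward; congr (_ _).
  apply/seteqP; split => -[a y] /=.
    move=> H; split; first by have := H ord0; rewrite in_itv/= -ler_distl tnth0.
    by move=> i; have := H (lift ord0 i); rewrite tnthS c'E.
  case=> /=; rewrite in_itv/= -ler_distl => ac H i.
  case: (unliftP ord0 i) => [j ->|->]; last by rewrite tnth0.
  by rewrite tnthS -c'E; exact: H.
rewrite product_measure1E//; last exact: measurable_box.
have IHc : (@lebesgue_tuple R d) (box c' s) = ((2 * s) ^+ d)%:E := IH c'.
rewrite /= in IHc *; rewrite IHc; rewrite lebesgue_measure_itv/= lte_fin.
(* [lebesgue_measure_itv] singles out degenerate intervals, hence the case s = 0, in which both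
   sides vanish. *)
have [s_gt0|sle0] := ltP 0 s.
  rewrite ifT; last by lra.
  by rewrite -EFinD -EFinM exprS; congr (_ * _)%:E; ring.
have -> : s = 0 by apply/eqP; rewrite eq_le s0 sle0.
by rewrite subr0 addr0 ltxx mul0e mulr0 expr0n.
Qed.

End boxes.

Section euclidean_distance.
Context {R : realType} {d : nat}.
Implicit Types x y : d.-tuple R.
Local Notation dist x y := (enorm (tuple_sub x y)).

Lemma enorm_ge0 x : 0 <= enorm x.
Proof. exact: sqrtr_ge0. Qed.

Lemma sqr_enorm x : enorm x ^+ 2 = \sum_(i < d) tnth x i ^+ 2.
Proof. by rewrite sqr_sqrtr// sumr_ge0// => i _; exact: sqr_ge0. Qed.

Lemma sqr_edist x y : dist x y ^+ 2 = \sum_(i < d) (tnth x i - tnth y i) ^+ 2.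
Proof. by rewrite sqr_enorm; apply: eq_bigr => i _; rewrite tnth_mktuple. Qed.

Lemma edistC x y : dist x y = dist y x.
Proof.
apply/eqP; rewrite -(eqrXn2 (n := 2))// ?enorm_ge0// !sqr_edist; apply/eqP.
by apply: eq_bigr => i _; rewrite -sqrrN opprB.
Qed.

Lemma tnth_le_enorm x i : `|tnth x i| <= enorm x.
Proof.
rewrite -(ler_pXn2r (n := 2))// ?nnegrE ?enorm_ge0// sqr_enorm real_normK ?num_real//.
by rewrite (bigD1 i)//= lerDl sumr_ge0// => j _; exact: sqr_ge0.
Qed.

Lemma tnth_le_edist x y i : `|tnth x i - tnth y i| <= dist x y.
Proof. by have := tnth_le_enorm (tuple_sub x y) i; rewrite tnth_mktuple. Qed.

(** Inequalities between squares, summed over the coordinates, play the part of the triangle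
    inequality: here (x_i + y_i)^2 >= 0, and (2 x_i - y_i)^2 >= 0 in [sqr_enorm_le]. *)
Lemma sqr_edist_le x y : dist x y ^+ 2 <= 2 * enorm x ^+ 2 + 2 * enorm y ^+ 2.
Proof.
rewrite sqr_edist !sqr_enorm !mulr_sumr -big_split/=; apply: ler_sum => i _.
by have := sqr_ge0 (tnth x i + tnth y i); rewrite !expr2; lra.
Qed.

Lemma sqr_enorm_le x y : enorm y ^+ 2 <= 2 * enorm x ^+ 2 + 2 * dist x y ^+ 2.
Proof.
rewrite sqr_edist !sqr_enorm !mulr_sumr -big_split/=; apply: ler_sum => i _.
by have := sqr_ge0 (2 * tnth x i - tnth y i); rewrite !expr2; lra.
Qed.

Lemma box_edist x y s : 0 <= s -> box x s y -> dist x y ^+ 2 <= d%:R * s ^+ 2.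
Proof.
move=> s0 xsy; rewrite sqr_edist mulr_natl -[d in leRHS]card_ord -sumr_const.
apply: ler_sum => i _; rewrite -(real_normK (num_real _)) lerXn2r ?nnegrE//.
by rewrite distrC; exact: xsy.
Qed.

Lemma edist_box x y s : dist x y <= s -> box x s y.
Proof. by move=> xys i; rewrite distrC (le_trans (tnth_le_edist _ _ _)). Qed.

Lemma measurable_edist :
  measurable_fun setT (fun z : d.-tuple R * d.-tuple R => dist z.1 z.2).
Proof.
rewrite (_ : (fun z => _) = Num.sqrt \o
    (fun z : d.-tuple R * d.-tuple R => \sum_(i < d) (tnth z.1 i - tnth z.2 i) ^+ 2)).
  apply: measurableT_comp.
    by apply: continuous_measurable_fun; exact: sqrt_continuous.
  apply: measurable_sum => i; apply: measurable_funX; apply: measurable_funB.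
    apply: (measurableT_comp (f := fun x : d.-tuple R => tnth x i)) => //.
    exact: measurable_tnth.
  apply: (measurableT_comp (f := fun x : d.-tuple R => tnth x i)) => //.
  exact: measurable_tnth.
apply/funext => z /=; congr Num.sqrt; apply: eq_bigr => i _.
by rewrite tnth_mktuple.
Qed.

Lemma measurable_edistr x : measurable_fun setT (fun y => dist x y).
Proof.
exact: (measurableT_comp measurable_edist (@pair1_measurable _ _ _ _ x)).
Qed.

End euclidean_distance.

(** * Integrals of powers of the distance *)

Section dyadic.
Context {R : realType} {d : nat}.
Implicit Types x y : d.-tuple R.
Local Notation dist x y := (enorm (tuple_sub x y)).
Local Notation leb := (@lebesgue_tuple R d).
Local Open Scope ereal_scope.

(** F is at most the sum over k of c k times the indicator of the cube of half-width r k. These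
    cubes may overlap, which is harmless for an upper bound and avoids computing volumes of
    shells. *)
Lemma integral_le_dyadic x (F : d.-tuple R -> R) (c r : nat -> R) (C q : R) :
  measurable_fun setT F -> (forall y, 0 <= F y)%R ->
  (forall k, 0 <= c k)%R -> (forall k, 0 <= r k)%R ->
  (0 <= C)%R -> (0 < q < 1)%R ->
  (forall k, c k * (2 * r k) ^+ d <= C * q ^+ k)%R ->
  (forall y, F y != 0 -> exists2 k, dist x y <= r k & F y <= c k)%R ->
  \int[leb]_y (F y)%:E <= (C / (1 - q))%:E.
Proof.
move=> mF F0 c0 r0 C0 /andP[q0 q1] cr Fc.
pose G k y := (c k)%:E * (\1_(box x (r k)) y)%:E.
have G0 k y : 0 <= G k y by rewrite mule_ge0 ?lee_fin.
have mG k : measurable_fun setT (G k).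
  apply: measurable_funeM; apply/measurable_EFinP; apply: measurable_indic.
  exact: measurable_box.
apply: (@le_trans _ _ (\int[leb]_y \sum_(k <oo) G k y)).
  apply: ge0_le_integral => //.
  - by move=> y _; rewrite lee_fin.
  - exact/measurable_EFinP.
  - by apply: ge0_emeasurable_sum => *.
  - move=> y _; have [->|/Fc[k yk Fk]] := eqVneq (F y) 0%R.
      exact: nneseries_ge0.
    apply: (@le_trans _ _ (G k y)).
      by rewrite /G indicE mem_set ?mule1 ?lee_fin//; exact: edist_box.
    rewrite (@nneseriesD1 _ _ k)// leeDl//.
    exact: nneseries_ge0.
rewrite integral_nneseries//.
have GE k : \int[leb]_y G k y = (c k * (2 * r k) ^+ d)%:E.
  rewrite ge0_integralZl//.
  - rewrite integral_indic//; last exact: measurable_box.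
    by rewrite setIT EFinM; congr (_ * _); exact: lebesgue_tuple_box.
  - by apply/measurable_EFinP; apply: measurable_indic; exact: measurable_box.
  - by rewrite lee_fin.
under eq_eseriesr do rewrite GE.
apply: lime_le.
  apply: is_cvg_nneseries => k _ _; rewrite lee_fin.
  by rewrite mulr_ge0// exprn_ge0// mulr_ge0.
apply: nearW => n; rewrite sumEFin lee_fin.
apply: le_trans (geometric_le_lim n C0 q0 _); last by rewrite gtr0_norm.
by rewrite /series/=; apply: ler_sum => k _.
Qed.

Lemma dyadic_ge1 (t : R) : (1 <= t)%R ->
  exists k, (2 ^+ k <= t)%R /\ (t < 2 ^+ k.+1)%R.
Proof.
move=> t1; have ex : exists n, (t < 2 ^+ n.+1)%R.
  exists (Num.truncn t).+1; rewrite (lt_trans (Num.Theory.truncnS_gt t))//.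
  by rewrite -natrX ltr_nat ltnW// ltn_expl.
have [k tk min] := ex_minnP ex; exists k; split => //.
case: k tk min => [//|k] tk min; rewrite leNgt; apply/negP => tk'.
by have := min k tk'; rewrite ltnn.
Qed.

Let powRX2 (a : R) k : ((2 ^+ k) `^ a = (2 `^ a) ^+ k)%R.
Proof. by rewrite -powR_mulrn// -powRrM mulrC powRrM powR_mulrn ?powR_ge0. Qed.

(** Shells s <= |x - y| < 2 s with s = 2^k r: each lies in a cube of volume (4 s)^d and the
    integrand is at most s^-(d+a), so the k-th term is 4^d r^-a (2^-a)^k. *)
Lemma integral_edist_gt x (a r : R) : (0 < a)%R -> (0 < r)%R ->
  \int[leb]_y (if (r <= dist x y)%R then dist x y `^ (- (d%:R + a)) else 0)%:E
  <= (4 ^+ d / (1 - 2 `^ (- a)) * r `^ (- a))%:E.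
Proof.
move=> a0 r0; rewrite mulrAC.
have da0 : (0 < d%:R + a)%R by rewrite ltr_wpDl.
apply: (@integral_le_dyadic x _ (fun k => (2 ^+ k * r) `^ (- (d%:R + a)))%R
  (fun k => (2 ^+ k.+1 * r)%R)).
- apply: measurable_fun_ifT => //.
    exact: (measurable_fun_ler (measurable_cst _) (measurable_edistr x)).
  exact: (measurableT_comp (measurable_powR _) (measurable_edistr x)).
- by move=> y; case: ifP => // _; exact: powR_ge0.
- by move=> k; exact: powR_ge0.
- by move=> k; rewrite mulr_ge0 ?exprn_ge0// ltW.
- by rewrite mulr_ge0 ?powR_ge0// exprn_ge0.
- by rewrite powR_gt0//= powR2N_lt1.
- move=> k; set s := (2 ^+ k * r)%R.
  have s0 : (0 < s)%R by rewrite mulr_gt0// exprn_gt0.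
  rewrite exprS -mulrA -/s mulrA -natrM exprMn opprD powRD; last first.
    by apply/implyP => _; rewrite gt_eqF.
  rewrite (powRN _ d%:R) powR_mulrn ?(ltW s0)//.
  rewrite [leLHS](_ : _ = 4 ^+ d * s `^ (- a))%R; last first.
    by field; rewrite expf_neq0// gt_eqF.
  rewrite /s powRM ?exprn_ge0 ?(ltW r0)// powRX2; lra.
- move=> y; case: ifPn => [rxy _|]; last by rewrite eqxx.
  have t1 : (1 <= dist x y / r)%R by rewrite ler_pdivlMr// mul1r.
  have [k []] := dyadic_ge1 t1; rewrite ler_pdivlMr// ltr_pdivrMr// => k1 k2.
  exists k; first exact: ltW.
  by apply: le_powRN => //; rewrite mulr_gt0// exprn_gt0.
Qed.

(** Shells s / 2 < |x - y| <= s with s = r / 2^k; the ratio is now 2^-(2-a), and a < 2 makes the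
    series converge. *)
Lemma integral_edist_le x (a r : R) : (0 < a < 2)%R -> (0 < r)%R ->
  \int[leb]_y (if (dist x y <= r)%R
               then dist x y ^+ 2 * dist x y `^ (- (d%:R + a)) else 0)%:E
  <= (2 ^+ d * 2 `^ (d%:R + a) / (1 - 2 `^ (- (2 - a))) * r `^ (2 - a))%:E.
Proof.
move=> /andP[a0 a2] r0; rewrite mulrAC.
have da0 : (0 < d%:R + a)%R by rewrite ltr_wpDl.
apply: (@integral_le_dyadic x _
  (fun k => (r / 2 ^+ k) ^+ 2 * (r / 2 ^+ k.+1) `^ (- (d%:R + a)))%R
  (fun k => (r / 2 ^+ k)%R)).
- apply: measurable_fun_ifT => //.
    exact: (measurable_fun_ler (measurable_edistr x) (measurable_cst _)).
  apply: measurable_funM; first exact: measurable_funX (measurable_edistr x).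
  exact: (measurableT_comp (measurable_powR _) (measurable_edistr x)).
- by move=> y; case: ifP => // _; rewrite mulr_ge0 ?powR_ge0 ?sqr_ge0.
- by move=> k; rewrite mulr_ge0 ?powR_ge0 ?sqr_ge0.
- by move=> k; rewrite divr_ge0 ?exprn_ge0// ltW.
- by rewrite !mulr_ge0 ?powR_ge0// exprn_ge0.
- by rewrite powR_gt0//= powR2N_lt1// subr_gt0.
- move=> k; set s := (r / 2 ^+ k)%R.
  have s0 : (0 < s)%R by rewrite divr_gt0// exprn_gt0.
  have -> : (r / 2 ^+ k.+1 = s / 2)%R by rewrite /s exprS invfM mulrCA mulrC.
  have half : (2^-1 `^ (- (d%:R + a)) = 2 `^ (d%:R + a))%R.
    by rewrite -powR_inv1// -powRrM mulN1r opprK.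
  rewrite powRM ?invr_ge0 ?(ltW s0)// half.
  rewrite opprD powRD; last by apply/implyP => _; rewrite gt_eqF.
  rewrite (powRN _ d%:R) powR_mulrn ?(ltW s0)// [((2 * s) ^+ d)%R]exprMn.
  rewrite -[(s ^+ 2)%R]powR_mulrn ?(ltW s0)//.
  rewrite [leLHS](_ : _ = 2 ^+ d * 2 `^ (d%:R + a) * (s `^ 2 * s `^ (- a)))%R; last first.
    by field; rewrite expf_neq0// gt_eqF.
  rewrite -powRD; last by apply/implyP => _; rewrite gt_eqF.
  have -> : (s `^ (2 - a) = r `^ (2 - a) * 2 `^ (- (2 - a)) ^+ k)%R.
    rewrite /s powRM ?invr_ge0 ?exprn_ge0 ?(ltW r0)//.
    by rewrite -powRX2 -(powR_inv1 (exprn_ge0 _ _))// -powRrM mulN1r.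
  lra.
- move=> y; case: ifPn => [xyr|]; last by rewrite eqxx.
  (* The point y at distance 0 lies in no shell, but there the factor |x - y|^2 vanishes. *)
  have [->|xy0 _] := eqVneq (dist x y) 0%R; first by rewrite expr0n/= mul0r eqxx.
  have {}xy0 : (0 < dist x y)%R by rewrite lt_def xy0 enorm_ge0.
  have t1 : (1 <= r / dist x y)%R by rewrite ler_pdivlMr// mul1r.
  have [k []] := dyadic_ge1 t1; rewrite ler_pdivlMr// ltr_pdivrMr// => k1 k2.
  have xyk : (dist x y <= r / 2 ^+ k)%R by rewrite ler_pdivlMr ?exprn_gt0// mulrC.
  exists k => //; rewrite ler_pM ?powR_ge0 ?sqr_ge0//.
    by rewrite lerXn2r ?nnegrE ?enorm_ge0// divr_ge0 ?exprn_ge0// ltW.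
  apply: le_powRN => //; first by rewrite divr_gt0// exprn_gt0.
  by rewrite ler_pdivrMr ?exprn_gt0// mulrC ltW.
Qed.

End dyadic.

(** * The measure mu_V and the energy *)

Section weight.
Context {R : realType} {d : nat} {eps : R}.
Hypothesis eps0 : 0 < eps.
Implicit Types x y : d.-tuple R.
Local Notation dist x y := (enorm (tuple_sub x y)).
Local Notation leb := (@lebesgue_tuple R d).
Local Notation V := (log_potential d eps).
Local Notation mu := (gibbs V).

Definition weight x : R := expR (- V x).

Let de0 : 0 < d%:R + eps.
Proof. by rewrite ltr_wpDl. Qed.

Let p1 x : 0 < 1 + enorm x ^+ 2.
Proof. by rewrite ltr_wpDr// sqr_ge0. Qed.

Lemma weightE x : weight x = (1 + enorm x ^+ 2) `^ (- ((d%:R + eps) / 2)).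
Proof.
rewrite /weight /log_potential /powR gt_eqF//.
by congr expR; rewrite mulNr [2^-1 * _]mulrC.
Qed.

Lemma weight_ge0 x : 0 <= weight x. Proof. exact: expR_ge0. Qed.

Lemma measurable_weight : measurable_fun setT weight.
Proof.
by apply: measurableT_comp => //; apply: measurableT_comp => //;
  exact: measurable_log_potential.
Qed.

Lemma weight_ge x M : enorm x ^+ 2 <= M ->
  (1 + M) `^ (- ((d%:R + eps) / 2)) <= weight x.
Proof.
move=> xM; rewrite weightE !powRN lef_pV2 ?posrE ?powR_gt0//; last first.
  by rewrite (lt_le_trans (p1 x))// lerD2l.
rewrite ge0_ler_powR ?nnegrE ?divr_ge0 ?(ltW de0) ?(ltW (p1 _))// ?lerD2l//.
by rewrite addr_ge0// (le_trans _ xM)// sqr_ge0.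
Qed.

Lemma weight_le1 x : weight x <= 1.
Proof.
rewrite weightE powRN invf_le1 ?powR_gt0// powR_ge1 ?divr_ge0 ?(ltW de0)//.
by rewrite lerDl sqr_ge0.
Qed.

Lemma powR_sqr (a s : R) : 0 <= a -> (a ^+ 2) `^ (s / 2) = a `^ s.
Proof. by move=> a0; rewrite -powR_mulrn// -powRrM mulrC divfK. Qed.

Lemma weight_le_enorm x : 0 < enorm x -> weight x <= enorm x `^ (- (d%:R + eps)).
Proof.
move=> x0; rewrite weightE !powRN lef_pV2 ?posrE ?powR_gt0//.
rewrite -(powR_sqr _ (ltW x0)) ge0_ler_powR ?nnegrE ?divr_ge0 ?(ltW de0)//.
- by rewrite sqr_ge0.
- exact: ltW.
- by rewrite lerDr.
Qed.

Lemma edist_powR_le x y s : 0 <= s -> enorm x <= enorm y ->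
  dist x y `^ s <= 2 `^ s * (1 + enorm y ^+ 2) `^ (s / 2).
Proof.
move=> s0 xy; rewrite -(powR_sqr s (enorm_ge0 _)) -(powR_sqr s (ler0n _ 2)).
rewrite -powRM ?(ltW (p1 _))// ge0_ler_powR ?nnegrE ?divr_ge0 ?sqr_ge0//.
  by rewrite mulr_ge0 ?sqr_ge0 ?(ltW (p1 _)).
have := sqr_edist_le x y; have : enorm x ^+ 2 <= enorm y ^+ 2.
  by rewrite lerXn2r ?nnegrE ?enorm_ge0.
lra.
Qed.

(** The exponents -(d+eps)/2 of the weight and (d+alpha)/2 from [edist_powR_le] add up to
    (alpha-eps)/2, whose sign separates the regimes of the theorem. *)
Lemma weight_edist_le alpha x y : 0 <= alpha -> enorm x <= enorm y ->
  weight y * dist x y `^ (d%:R + alpha) <=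
  2 `^ (d%:R + alpha) * (1 + enorm y ^+ 2) `^ ((alpha - eps) / 2).
Proof.
move=> a0 xy; have da0 : 0 <= d%:R + alpha by rewrite addr_ge0.
apply: (le_trans (ler_wpM2l (weight_ge0 y) (edist_powR_le da0 xy))).
rewrite mulrCA ler_wpM2l ?powR_ge0// weightE -powRD; last first.
  by apply/implyP => _; rewrite gt_eqF.
by rewrite le_eqVlt; apply/orP; left; apply/eqP; congr powR; field.
Qed.

Definition tuple0 : d.-tuple R := [tuple 0 | i < d].

Lemma edist0 x : dist tuple0 x = enorm x.
Proof.
apply/eqP; rewrite -(eqrXn2 (n := 2))// ?enorm_ge0// sqr_edist sqr_enorm; apply/eqP.
by apply: eq_bigr => i _; rewrite tnth_mktuple sub0r sqrrN.
Qed.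

(** The constant of [integral_edist_gt] for the exponent eps. *)
Definition tail_cst : R := 4 ^+ d / (1 - 2 `^ (- eps)).

Lemma tail_cst_gt0 : 0 < tail_cst.
Proof. by rewrite divr_gt0 ?exprn_gt0// subr_gt0 powR2N_lt1. Qed.

Lemma measurable_enorm_gt (r : R) : measurable [set x : d.-tuple R | r < enorm x].
Proof. by apply: measurable_gt; exact: measurable_enorm. Qed.

Lemma weight_tail r : 0 < r ->
  (\int[leb]_x (\1_[set x | r < enorm x] x * weight x)%:E <=
   (tail_cst * r `^ (- eps))%:E)%E.
Proof.
move=> r0; apply: le_trans (integral_edist_gt tuple0 eps0 r0).
apply: ge0_le_integral => //.
- by move=> x _; rewrite lee_fin mulr_ge0 ?weight_ge0.
- apply/measurable_EFinP; apply: measurable_funM; last exact: measurable_weight.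
  by apply: measurable_indic; exact: measurable_enorm_gt.
- apply/measurable_EFinP; apply: measurable_fun_ifT => //.
    exact: (measurable_fun_ler (measurable_cst _) (measurable_edistr _)).
  exact: (measurableT_comp (measurable_powR _) (measurable_edistr _)).
- move=> x _; rewrite lee_fin indicE edist0.
  have [|xr] := boolP (x \in _); rewrite ?mul0r.
    rewrite inE/= => rx; rewrite (ltW rx) mul1r weight_le_enorm//.
    exact: lt_trans rx.
  by case: ifP => // _; exact: powR_ge0.
Qed.

(** Where |x| <= 1 the weight is at most 1 and the region lies in a cube; elsewhere [weight_tail]
    applies. *)
Lemma weight_integral_lty : (\int[leb]_x (weight x)%:E < +oo)%E.
Proof.
pose g1 x : \bar R := (\1_(box tuple0 1) x)%:E.
pose g2 x : \bar R := (\1_[set x | 1 < enorm x] x * weight x)%:E.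
have mg1 : measurable_fun setT g1.
  by apply/measurable_EFinP; apply: measurable_indic; exact: measurable_box.
have mg2 : measurable_fun setT g2.
  apply/measurable_EFinP; apply: measurable_funM; last exact: measurable_weight.
  by apply: measurable_indic; exact: measurable_enorm_gt.
have g10 x : (0 <= g1 x)%E by rewrite lee_fin.
have g20 x : (0 <= g2 x)%E by rewrite lee_fin mulr_ge0 ?weight_ge0.
apply: (@le_lt_trans _ _ (\int[leb]_x (g1 x + g2 x))%E).
  apply: ge0_le_integral => //.
  - by move=> x _; rewrite lee_fin weight_ge0.
  - by apply/measurable_EFinP; exact: measurable_weight.
  - exact: emeasurable_funD.
  - move=> x _; have [x1|x1] := ltP 1 (enorm x).
      rewrite (le_trans (y := g2 x))//; last by rewrite leeDr.
      by rewrite /g2 indicE mem_set// mul1r.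
    rewrite (le_trans (y := g1 x))//; last by rewrite leeDl.
    rewrite /g1 indicE mem_set ?lee_fin ?weight_le1//; apply: edist_box.
    by rewrite edist0.
rewrite ge0_integralD// lte_add_pinfty//.
  rewrite integral_indic//; last exact: measurable_box.
  by rewrite setIT; have := ltry ((2 * 1) ^+ d : R); rewrite -(lebesgue_tuple_box tuple0 ler01).
by rewrite (le_lt_trans (weight_tail ltr01))// ltry.
Qed.

Lemma box_weight_ge (c : d.-tuple R) s M : 0 <= s ->
  (forall x, box c s x -> enorm x ^+ 2 <= M) ->
  (((1 + M) `^ (- ((d%:R + eps) / 2)) * (2 * s) ^+ d)%:E <=
   \int[leb]_x (\1_(box c s) x * weight x)%:E)%E.
Proof.
move=> s0 cM; set k := _ `^ _.
have mb : measurable (box c s) by exact: measurable_box.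
have -> : ((k * (2 * s) ^+ d)%:E = \int[leb]_x (k%:E * (\1_(box c s) x)%:E))%E.
  rewrite ge0_integralZl//; last 2 first.
  - by apply/measurable_EFinP; exact: measurable_indic.
  - by rewrite lee_fin powR_ge0.
  rewrite integral_indic// setIT EFinM; congr (_ * _)%E; apply: esym.
  exact: (lebesgue_tuple_box c s0).
apply: ge0_le_integral => //.
- by move=> x _; rewrite mule_ge0 ?lee_fin ?powR_ge0.
- by apply: measurable_funeM; apply/measurable_EFinP; exact: measurable_indic.
- apply/measurable_EFinP; apply: measurable_funM; last exact: measurable_weight.
  exact: measurable_indic.
- move=> x _; rewrite indicE; have [|_] := boolP (x \in box c s).
    by rewrite inE => /cM xM; rewrite mule1 mul1r lee_fin weight_ge.
  by rewrite mule0 mul0r.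
Qed.

Local Notation Z := (partition_function V).

(** [partition_function] is a [fine] of an extended integral; finiteness ensures that it is the true
    value. *)
Lemma partition_functionE : (Z%:E = \int[leb]_x (weight x)%:E)%E.
Proof.
rewrite fineK// ge0_fin_numE ?weight_integral_lty//.
by apply: integral_ge0 => x _; rewrite lee_fin weight_ge0.
Qed.

Lemma partition_function_gt0 : 0 < Z.
Proof.
rewrite -lte_fin partition_functionE.
apply: (@lt_le_trans _ _ (\int[leb]_x (\1_(box tuple0 1) x * weight x)%:E)%E).
  apply: (@lt_le_trans _ _ ((1 + d%:R) `^ (- ((d%:R + eps) / 2)) * (2 * 1) ^+ d)%:E).
    by rewrite lte_fin mulr_gt0 ?exprn_gt0 ?powR_gt0//; lra.
  apply: box_weight_ge => // x /(box_edist ler01).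
  by rewrite edist0 expr1n mulr1.
apply: ge0_le_integral => //.
- by move=> x _; rewrite lee_fin mulr_ge0 ?weight_ge0.
- apply/measurable_EFinP; apply: measurable_funM; last exact: measurable_weight.
  by apply: measurable_indic; exact: measurable_box.
- by apply/measurable_EFinP; exact: measurable_weight.
- by move=> x _; rewrite lee_fin ler_piMl ?weight_ge0.
Qed.

Lemma gibbsT : mu setT = 1%E.
Proof.
rewrite /gibbs -partition_functionE -EFinM mulVf//.
by rewrite gt_eqF// partition_function_gt0.
Qed.

Lemma gibbs_integral (f : d.-tuple R -> \bar R) :
  measurable_fun setT f -> (forall x, 0 <= f x)%E ->
  (\int[mu]_x f x = Z^-1%:E * \int[leb]_x (f x * (weight x)%:E))%E.
Proof.
move=> mf f0; have mw := measurable_weight.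
have Z0 : 0 <= Z^-1 by rewrite invr_ge0 ltW// partition_function_gt0.
rewrite (@ge0_integral_density _ _ _ leb mu (fun x => Z^-1 * weight x))//.
- rewrite -ge0_integralZl//.
  + by apply: eq_integral => x _; rewrite EFinM muleCA.
  + by apply: emeasurable_funM => //; exact/measurable_EFinP.
  + by move=> x _; rewrite mule_ge0 ?lee_fin ?weight_ge0.
- exact: measurable_funM.
- by move=> x; rewrite mulr_ge0 ?weight_ge0.
- move=> A mA.
  transitivity (Z^-1%:E * \int[leb]_(x in A) (weight x)%:E)%E => //.
  rewrite -ge0_integralZl//.
  + by apply: measurable_funTS; exact/measurable_EFinP.
  + by move=> x _; rewrite lee_fin expR_ge0.
Qed.

Lemma gibbs_tail r : 0 < r ->
  (mu [set x | (r < enorm x)%R] <= (Z^-1 * tail_cst * r `^ (- eps))%:E)%E.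
Proof.
move=> r0; have mA := measurable_enorm_gt r.
have -> : (mu [set x | (r < enorm x)%R] =
    \int[mu]_x (\1_[set x | (r < enorm x)%R] x)%:E)%E by rewrite integral_indic// setIT.
rewrite gibbs_integral//.
- rewrite -mulrA [leRHS]EFinM lee_wpmul2l//.
    by rewrite lee_fin invr_ge0 ltW// partition_function_gt0.
  by under eq_integral do rewrite -EFinM; exact: weight_tail.
- by apply/measurable_EFinP; exact: measurable_indic.
Qed.

End weight.

Section energy.
Context {R : realType} {d : nat} {alpha eps : R}.
Hypothesis eps0 : 0 < eps.
Local Notation T := (d.-tuple R).
Implicit Types (x y : T) (f : T -> R).
Local Notation dist x y := (enorm (tuple_sub x y)).
Local Notation leb := (@lebesgue_tuple R d).
Local Notation V := (log_potential d eps).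
Local Notation mu := (gibbs V).
Local Notation Z := (partition_function V).
Local Notation w := (@weight R d eps).
Local Notation E f := (dirichlet_form alpha V f f).

Lemma edist_eq0 x y : dist x y = 0 -> x = y.
Proof.
move=> xy0; apply: eq_from_tnth => i; apply/eqP.
by rewrite -subr_eq0 -normr_le0 -xy0 tnth_le_edist.
Qed.

(** The integrand of the energy as a function on the product space, in the form to which Tonelli's
    theorem applies. *)
Definition jump f (z : T * T) : R :=
  (f z.1 - f z.2) * (f z.1 - f z.2) / dist z.1 z.2 `^ (d%:R + alpha).

Lemma jump_ge0 f z : 0 <= jump f z.
Proof. by rewrite divr_ge0 ?powR_ge0// -expr2 sqr_ge0. Qed.

Lemma measurable_fst_comp f : measurable_fun setT f ->
  measurable_fun setT (fun z : T * T => f z.1).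
Proof. by move=> mf; exact: measurableT_comp. Qed.

Lemma measurable_snd_comp f : measurable_fun setT f ->
  measurable_fun setT (fun z : T * T => f z.2).
Proof. by move=> mf; exact: measurableT_comp. Qed.

Lemma measurable_difference f : measurable_fun setT f ->
  measurable_fun setT (fun z : T * T => f z.1 - f z.2).
Proof.
move=> mf; apply: measurable_funB.
  exact: measurable_fst_comp.
exact: measurable_snd_comp.
Qed.

Lemma measurable_jump f : measurable_fun setT f -> measurable_fun setT (jump f).
Proof.
move=> mf; rewrite (_ : jump f = (fun z => (f z.1 - f z.2) * (f z.1 - f z.2) *
    dist z.1 z.2 `^ (- (d%:R + alpha)))).
  apply: measurable_funM; last exact: (measurableT_comp (measurable_powR _) measurable_edist).
  by apply: measurable_funM; exact: measurable_difference.
by apply/funext => z; rewrite powRN.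
Qed.

Lemma energy_fst f : measurable_fun setT f ->
  (\int[leb \x leb]_z (jump f z * w z.1)%:E = Z%:E * E f)%E.
Proof.
move=> mf; have mw := @measurable_weight R d eps.
have mJ := measurable_jump mf.
have mJw : measurable_fun setT (fun z => (jump f z * w z.1)%:E).
  apply/measurable_EFinP; apply: measurable_funM => //.
  exact: measurable_fst_comp.
have J0 z : (0 <= (jump f z)%:E)%E by rewrite lee_fin jump_ge0.
have mJE : measurable_fun setT (fun z => (jump f z)%:E) by exact/measurable_EFinP.
rewrite fubini_tonelli1//; last first.
  by move=> z; rewrite lee_fin mulr_ge0 ?jump_ge0 ?weight_ge0.
rewrite /dirichlet_form gibbs_integral//; last 2 first.
- exact: (measurable_fun_fubini_tonelli_F _ mJE J0).
- by move=> x; apply: integral_ge0 => y _; exact: (J0 (x, y)).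
rewrite muleA -EFinM divff ?mul1e; last by rewrite gt_eqF// partition_function_gt0.
apply: eq_integral => x _; rewrite -ge0_integralZr//.
- exact: (measurableT_comp mJE (@pair1_measurable _ _ _ _ x)).
- by move=> y _; exact: (J0 (x, y)).
- by rewrite lee_fin weight_ge0.
Qed.

(** Integrate in the other order: the jump kernel is symmetric, so the weight may be placed at
    either point. *)
Lemma energy_snd f : measurable_fun setT f ->
  (\int[leb \x leb]_z (jump f z * w z.2)%:E = Z%:E * E f)%E.
Proof.
move=> mf; have mw := @measurable_weight R d eps.
have mJ := measurable_jump mf.
have mJw (g : T * T -> T) : measurable_fun setT g ->
    measurable_fun setT (fun z => (jump f z * w (g z))%:E).
  move=> mg; apply/measurable_EFinP; apply: measurable_funM => //.
  exact: measurableT_comp.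
have Jw0 (g : T * T -> T) z : (0 <= (jump f z * w (g z))%:E)%E.
  by rewrite lee_fin mulr_ge0 ?jump_ge0 ?weight_ge0.
rewrite -(energy_fst mf).
rewrite (fubini_tonelli2 _ (mJw snd measurable_snd) (Jw0 snd)).
rewrite (fubini_tonelli1 _ (mJw fst measurable_fst) (Jw0 fst)).
apply: eq_integral => x _; apply: eq_integral => y _.
by rewrite /= /jump/= edistC; congr ((_ / _ * _)%:E); ring.
Qed.

(** The term A w(x) is integrated by [energy_fst] and B w(y) by [energy_snd]; each yields the full
    energy, hence the factor A + B. *)
Lemma energy_comparison f (K : T * T -> R) (A B : R) :
  measurable_fun setT f -> measurable_fun setT K -> (forall z, 0 <= K z) ->
  0 <= A -> 0 <= B ->
  (forall x y, K (x, y) * dist x y `^ (d%:R + alpha) <= A * w x + B * w y) ->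
  (\int[leb \x leb]_z ((f z.1 - f z.2) ^+ 2 * K z)%:E <=
   (A + B)%:E * (Z%:E * E f))%E.
Proof.
move=> mf mK K0 A0 B0 KAB; have mw := @measurable_weight R d eps.
have mJ := measurable_jump mf.
have J0 := @jump_ge0 f.
pose g1 (z : T * T) : \bar R := (jump f z * w z.1)%:E.
pose g2 (z : T * T) : \bar R := (jump f z * w z.2)%:E.
have m1 : measurable_fun setT g1.
  apply/measurable_EFinP; apply: measurable_funM => //; exact: measurable_fst_comp.
have m2 : measurable_fun setT g2.
  apply/measurable_EFinP; apply: measurable_funM => //; exact: measurable_snd_comp.
have n1 z : setT z -> (0 <= g1 z)%E by rewrite lee_fin mulr_ge0 ?J0 ?weight_ge0.
have n2 z : setT z -> (0 <= g2 z)%E by rewrite lee_fin mulr_ge0 ?J0 ?weight_ge0.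
have A0E : (0 <= A%:E)%E by rewrite lee_fin.
have B0E : (0 <= B%:E)%E by rewrite lee_fin.
have mA := measurable_funeM A%:E m1; have mB := measurable_funeM B%:E m2.
have nA z : setT z -> (0 <= A%:E * g1 z)%E by move=> /n1; exact: mule_ge0.
have nB z : setT z -> (0 <= B%:E * g2 z)%E by move=> /n2; exact: mule_ge0.
have -> : ((A + B)%:E * (Z%:E * E f) =
    \int[leb \x leb]_z (A%:E * g1 z + B%:E * g2 z))%E.
  rewrite (ge0_integralD _ measurableT nA mA nB mB).
  rewrite (ge0_integralZl _ measurableT m1 n1 A0E).
  rewrite (ge0_integralZl _ measurableT m2 n2 B0E).
  by rewrite (energy_fst mf) (energy_snd mf) EFinD ge0_muleDl.
apply: ge0_le_integral => //.
- by move=> z _; rewrite lee_fin mulr_ge0 ?sqr_ge0.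
- apply/measurable_EFinP; apply: measurable_funM => //.
  by apply: measurable_funX; exact: measurable_difference.
- exact: (emeasurable_funD mA mB).
- move=> [x y] _; rewrite /g1 /g2 -!EFinM -EFinD lee_fin /jump/=.
  (* At distance 0 the denominator cannot be cleared, but then x = y and the difference of f
     vanishes. *)
  have [xy0|xy0] := eqVneq (dist x y) 0.
    by rewrite (edist_eq0 xy0) subrr expr0n/= !mul0r !mulr0 addr0.
  have q0 : 0 < dist x y `^ (d%:R + alpha).
    by rewrite powR_gt0// lt_def xy0 enorm_ge0.
  set q := _ `^ _ in q0 *.
  rewrite [leRHS](_ : _ = (f x - f y) ^+ 2 * ((A * w x + B * w y) / q)); last by ring.
  by rewrite ler_wpM2l ?sqr_ge0// ler_pdivlMr.
Qed.

End energy.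

(** * Poincare and weak Poincare inequalities *)

Section poincare.
Context {R : realType} {d : nat} {alpha eps : R}.
Hypothesis alpha0 : 0 < alpha.
Hypothesis eps0 : 0 < eps.
Local Notation T := (d.-tuple R).
Implicit Types (x y : T) (f : T -> R).
Local Notation dist x y := (enorm (tuple_sub x y)).
Local Notation leb := (@lebesgue_tuple R d).
Local Notation V := (log_potential d eps).
Local Notation mu := (gibbs V).
Local Notation Z := (partition_function V).
Local Notation w := (@weight R d eps).
Local Notation E f := (dirichlet_form alpha V f f).
Local Notation L2 := (Lfun mu 2%:E).

Let Z0 : 0 < Z. Proof. exact: partition_function_gt0. Qed.

Let muT : mu setT = 1%E. Proof. exact: gibbsT. Qed.

Lemma dirichlet_form_ge0 f : (0 <= E f)%E.
Proof.
by apply: integral_ge0 => x _; apply: integral_ge0 => y _; exact: (jump_ge0 f (x, y)).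
Qed.

Lemma measurable_weight_fst : measurable_fun setT (fun z : T * T => w z.1).
Proof. exact: (measurable_fst_comp (@measurable_weight R d eps)). Qed.

Lemma measurable_weight_snd : measurable_fun setT (fun z : T * T => w z.2).
Proof. exact: (measurable_snd_comp (@measurable_weight R d eps)). Qed.

(** Integrate (c - f)^2 >= c^2 - 2 c f, where f has mean 0. *)
Lemma sqr_le_variance f c : f \in L2 -> \int[mu]_x f x = 0 ->
  ((c ^+ 2)%:E <= \int[mu]_y ((c - f y) ^+ 2)%:E)%E.
Proof.
move=> fL f0; have cL := Lfun2_cst muT c.
have cfL : (fun y => c - f y) \in L2 by exact: (Lfun2B cL).
rewrite -(innerE cfL) lee_fin.
have fi := integrable_Lfun2 muT fL.
have cc : mu.-integrable setT (EFin \o (fun y => c ^+ 2 - 2 * c * f y)).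
  apply: (integrable_Lfun2 muT).
  by apply: (Lfun2B (Lfun2_cst muT _)); exact: Lfun2Z.
have -> : c ^+ 2 = \int[mu]_y (c ^+ 2 - 2 * c * f y).
  rewrite RintegralB//; last 2 first.
  - exact: (integrable_Lfun2 muT (Lfun2_cst muT _)).
  - by apply: (integrable_Lfun2 muT); exact: Lfun2Z.
  by rewrite [X in _ - X]RintegralZl// f0 mulr0 subr0 (Rintegral_probability_cst muT).
apply: ae_le_Rintegral => //; first exact: integrable_mul2.
by apply/nearW => y; have := sqr_ge0 (f y); rewrite !expr2; lra.
Qed.

(** [sqr_le_variance] with c = f(x), integrated in x against mu. The variance is in fact half of the
    right-hand side; this factor is given up. *)
Lemma variance_le f : f \in L2 -> \int[mu]_x f x = 0 ->
  (\int[mu]_x (f x ^+ 2)%:E <=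
   (Z^-1 * Z^-1)%:E *
   \int[leb \x leb]_z ((f z.1 - f z.2) ^+ 2 * (w z.1 * w z.2))%:E)%E.
Proof.
move=> fL f0; have mf := Lfun_measurable fL.
have mw := @measurable_weight R d eps.
have mwE : measurable_fun setT (EFin \o w) by exact/measurable_EFinP.
pose D z : \bar R := ((f z.1 - f z.2) ^+ 2)%:E.
have mD : measurable_fun setT D.
  by apply/measurable_EFinP; apply: measurable_funX; exact: measurable_difference.
pose H z : \bar R := ((f z.1 - f z.2) ^+ 2 * (w z.1 * w z.2))%:E.
have mH : measurable_fun setT H.
  apply/measurable_EFinP; apply: measurable_funM.
    by apply: measurable_funX; exact: measurable_difference.
  apply: measurable_funM; [exact: measurable_weight_fst|exact: measurable_weight_snd].
have H0 z : (0 <= H z)%E.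
  rewrite lee_fin; apply: mulr_ge0; first exact: sqr_ge0.
  by apply: mulr_ge0; exact: weight_ge0.
have Zi0 : (0 <= Z^-1%:E)%E by rewrite lee_fin invr_ge0 (ltW Z0).
rewrite gibbs_integral//; last 2 first.
- by apply/measurable_EFinP; exact: measurable_funX.
- by move=> x; rewrite lee_fin sqr_ge0.
rewrite EFinM -muleA lee_wpmul2l// (fubini_tonelli1 _ mH H0).
have mFH := measurable_fun_fubini_tonelli_F (m2 := leb) _ mH H0.
rewrite -(ge0_integralZl _ measurableT mFH _ Zi0); last first.
  by move=> x _; apply: integral_ge0 => y _; exact: (H0 (x, y)).
apply: ge0_le_integral => //.
- by move=> x _; rewrite mule_ge0 ?lee_fin ?sqr_ge0 ?weight_ge0.
- by apply: emeasurable_funM => //; apply/measurable_EFinP; exact: measurable_funX.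
- exact: measurable_funeM.
- move=> x _; have w0E : (0 <= (w x)%:E)%E by rewrite lee_fin weight_ge0.
  apply: (le_trans (lee_wpmul2r w0E (sqr_le_variance (f x) fL f0))).
  have mDx : measurable_fun setT (fun y => D (x, y)).
    exact: (measurableT_comp mD (@pair1_measurable _ _ _ _ x)).
  have D0 y : (0 <= D (x, y))%E by rewrite lee_fin sqr_ge0.
  rewrite (gibbs_integral eps0 mDx D0) -muleA lee_wpmul2l//.
  have mDw : measurable_fun setT (fun y => D (x, y) * (w y)%:E)%E.
    exact: emeasurable_funM.
  rewrite -(ge0_integralZr _ measurableT mDw _ w0E); last first.
    by move=> y _; apply: (mule_ge0 (D0 y)); rewrite lee_fin weight_ge0.
  rewrite le_eqVlt; apply/orP; left; apply/eqP; apply: eq_integral => y _.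
  by rewrite /D /H /= -!EFinM; congr (_%:E); ring.
Qed.

(* The density with the larger argument is dominated by the jump kernel. *)
Lemma weight_product_le M x y : 0 <= M ->
  (1 + enorm x ^+ 2) `^ ((alpha - eps) / 2) <= M ->
  (1 + enorm y ^+ 2) `^ ((alpha - eps) / 2) <= M ->
  w x * w y * dist x y `^ (d%:R + alpha) <=
  2 `^ (d%:R + alpha) * M * w x + 2 `^ (d%:R + alpha) * M * w y.
Proof.
move=> M0.
wlog xy : x y / enorm x <= enorm y => [H xM yM|xM yM].
  have [xy|/ltW yx] := leP (enorm x) (enorm y); first exact: H.
  by rewrite edistC [w x * _]mulrC [leRHS]addrC; exact: H.
rewrite (le_trans (y := 2 `^ (d%:R + alpha) * M * w x))//; last first.
  by rewrite lerDl !mulr_ge0 ?powR_ge0 ?weight_ge0.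
rewrite -mulrA [leRHS]mulrC ler_wpM2l ?weight_ge0//.
rewrite (le_trans (weight_edist_le (ltW alpha0) xy))//.
by rewrite ler_wpM2l ?powR_ge0.
Qed.

Lemma log_potential_poincare : alpha <= eps ->
  exists2 C, 0 < C & poincare_inequality alpha V C.
Proof.
move=> ae; pose c := 2 `^ (d%:R + alpha) * 1 : R.
have c0 : 0 < c by rewrite /c mulr1 powR_gt0.
exists (Z^-1 * Z^-1 * (c + c) * Z).
  by rewrite !mulr_gt0 ?invr_gt0 ?addr_gt0.
move=> f [fL fE] f0.
have fm : \int[mu]_x f x = 0 by rewrite /Rintegral f0.
have mf := Lfun_measurable fL.
apply: (le_trans (variance_le fL fm)).
have -> : ((Z^-1 * Z^-1 * (c + c) * Z)%:E * E f =
    (Z^-1 * Z^-1)%:E * ((c + c)%:E * (Z%:E * E f)))%E by rewrite !EFinM !muleA.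
apply: lee_wpmul2l; first by rewrite lee_fin mulr_ge0 ?invr_ge0 ?(ltW Z0).
apply: (energy_comparison eps0 mf (K := fun z => w z.1 * w z.2)).
- apply: measurable_funM; [exact: measurable_weight_fst|exact: measurable_weight_snd].
- by move=> z; rewrite mulr_ge0 ?weight_ge0.
- exact: ltW.
- exact: ltW.
(* The exponent is at most 0 and the base at least 1, so M = 1 serves in [weight_product_le]. *)
- have le1 x : (1 + enorm x ^+ 2) `^ ((alpha - eps) / 2) <= 1 :> R.
    rewrite -[leRHS](powRr0 (1 + enorm x ^+ 2)) ler_powR//.
      by rewrite lerDl sqr_ge0.
    by rewrite pmulr_lle0// subr_le0.
  by move=> x y; apply: weight_product_le.
Qed.

End poincare.

Lemma ge0_integral_prod_mul {d1 d2 : measure_display} {T1 : measurableType d1}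
    {T2 : measurableType d2} {R : realType}
    (m1 : {sigma_finite_measure set T1 -> \bar R})
    (m2 : {sigma_finite_measure set T2 -> \bar R}) (g : T1 -> R) (h : T2 -> R) :
  measurable_fun setT g -> measurable_fun setT h ->
  (forall x, 0 <= g x) -> (forall y, 0 <= h y) ->
  (\int[m1 \x m2]_z (g z.1 * h z.2)%:E =
   (\int[m1]_x (g x)%:E) * (\int[m2]_y (h y)%:E))%E.
Proof.
move=> mg mh g0 h0.
have m12 : measurable_fun setT (fun z : T1 * T2 => (g z.1 * h z.2)%:E).
  by apply/measurable_EFinP; apply: measurable_funM; exact: measurableT_comp.
have n12 (z : T1 * T2) : (0 <= (g z.1 * h z.2)%:E)%E by rewrite lee_fin mulr_ge0.
have mhE : measurable_fun setT (fun y => (h y)%:E) by exact/measurable_EFinP.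
have mgE : measurable_fun setT (fun y => (g y)%:E) by exact/measurable_EFinP.
have hE0 y : setT y -> (0 <= (h y)%:E)%E by rewrite lee_fin.
have gE0 y : setT y -> (0 <= (g y)%:E)%E by rewrite lee_fin.
have ih0 : (0 <= \int[m2]_y (h y)%:E)%E by exact: integral_ge0.
rewrite (fubini_tonelli1 _ m12 n12) -(ge0_integralZr _ measurableT mgE gE0 ih0).
apply: eq_integral => x _; rewrite /fubini_F/=.
by rewrite -(ge0_integralZl _ measurableT mhE hE0 (gE0 x I)).
Qed.

(** Used with a = (f x - f y)^2, b = 4 M^2, u and v the weights at x and y, and p, q telling whether
    x, y lie in the tail: pairs with a point in the tail are charged to b. *)
Lemma indic_split_le {R : realType} (p q : bool) (a b u v : R) :
  0 <= a -> a <= b -> 0 <= u -> 0 <= v ->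
  a * (u * v) <= a * ((~~ p)%:R * u * ((~~ q)%:R * v))
                 + b * (p%:R * u * v + u * (q%:R * v)).
Proof.
move=> a0 ab u0 v0; have uv := mulr_ge0 u0 v0.
have := ler_wpM2r uv ab; have := mulr_ge0 (le_trans a0 ab) uv.
by case: p; case: q => /=; lra.
Qed.

Section clamp.
Context {R : realType}.
Implicit Types a b M : R.

Definition clamp M a : R := Num.max (- M) (Num.min M a).

Lemma clamp_le M a : 0 <= M -> `|clamp M a| <= M.
Proof.
move=> M0; rewrite ler_norml /clamp le_max lexx/= ge_max ge_min lexx andbT; lra.
Qed.

Lemma clamp_id M a : `|a| <= M -> clamp M a = a.
Proof. by rewrite ler_norml /clamp => /andP[Ma aM]; rewrite min_r// max_r. Qed.

Lemma clamp_contraction M a b : `|clamp M a - clamp M b| <= `|a - b|.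
Proof.
wlog ab : a b / a <= b => [H|].
  have [/H//|/ltW ba] := leP a b; rewrite distrC [leRHS]distrC; exact: H.
have cab : clamp M a <= clamp M b by rewrite /clamp le_max2// le_min2.
rewrite distrC [leRHS]distrC !ger0_norm ?subr_ge0//.
rewrite /clamp /Num.max /Num.min; do ![case: ifPn]; rewrite -?leNgt; lra.
Qed.

End clamp.

Section weak_poincare.
Context {R : realType} {d : nat} {alpha eps : R}.
Hypothesis eps0 : 0 < eps.
Hypothesis eps_alpha : eps < alpha.
Local Notation T := (d.-tuple R).
Implicit Types (x y : T) (f : T -> R).
Local Notation dist x y := (enorm (tuple_sub x y)).
Local Notation leb := (@lebesgue_tuple R d).
Local Notation V := (log_potential d eps).
Local Notation mu := (gibbs V).
Local Notation Z := (partition_function V).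
Local Notation w := (@weight R d eps).
Local Notation E f := (dirichlet_form alpha V f f).
Local Notation L2 := (Lfun mu 2%:E).

Let Z0 : 0 < Z. Proof. exact: partition_function_gt0. Qed.

Let muT : mu setT = 1%E. Proof. exact: gibbsT. Qed.

Let alpha0 : 0 < alpha. Proof. exact: lt_trans eps_alpha. Qed.

(** The jump integrand decreases pointwise; this is applied to the truncation [clamp]. *)
Lemma energy_contraction f (g : T -> R) : measurable_fun setT f -> measurable_fun setT g ->
  (forall x y, `|g x - g y| <= `|f x - f y|) -> (E g <= E f)%E.
Proof.
move=> mf mg gf.
have ZE0 : (0 < Z%:E)%E by rewrite lte_fin.
have : (\int[leb \x leb]_z (jump (alpha := alpha) g z * w z.1)%:E <=
    \int[leb \x leb]_z (jump (alpha := alpha) f z * w z.1)%:E)%E; last first.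
  rewrite (energy_fst eps0 mg) (energy_fst eps0 mf).
  by rewrite (lee_pmul2l (isT : Z%:E \is a fin_num) ZE0).
apply: ge0_le_integral => //.
- by move=> z _; rewrite lee_fin mulr_ge0 ?jump_ge0 ?weight_ge0.
- apply/measurable_EFinP; apply: measurable_funM; first exact: measurable_jump.
  exact: measurable_weight_fst.
- apply/measurable_EFinP; apply: measurable_funM; first exact: measurable_jump.
  exact: measurable_weight_fst.
- move=> z _; rewrite lee_fin ler_wpM2r ?weight_ge0//.
  rewrite /jump ler_wpM2r ?invr_ge0 ?powR_ge0// -!expr2.
  by rewrite -real_normK ?num_real// -[leRHS]real_normK ?num_real// lerXn2r ?nnegrE.
Qed.

(** [variance_le] contributes Z^-2 and each integral over the product space gives back one Z. The 2
    in c1 is A + B with A = B; the 8 in c2 is the 4 of (f x - f y)^2 <= 4 M^2, counted once for x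
    and once for y in the tail. *)
Let c1 : R := Z^-1 * (2 * 2 `^ (d%:R + alpha)).
Let c2 : R := 8 * Z^-1 * @tail_cst R d eps.

Lemma weak_poincare_bounded f M r : f \in L2 -> \int[mu]_x f x = 0 ->
  (forall x, `|f x| <= M) -> 0 < r ->
  (\int[mu]_x (f x ^+ 2)%:E <=
    (c1 * (1 + r ^+ 2) `^ ((alpha - eps) / 2))%:E * E f
    + (c2 * r `^ (- eps) * M ^+ 2)%:E)%E.
Proof.
move=> fL f0 fM r0; have mf := Lfun_measurable fL.
have mw := @measurable_weight R d eps.
pose A := [set x : T | r < enorm x].
have mA : measurable A by exact: measurable_enorm_gt.
have mA1 : measurable_fun setT (\1_A : T -> R) by exact: measurable_indic.
have mC1 : measurable_fun setT (\1_(~` A) : T -> R).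
  by apply: measurable_indic; exact: measurableC.
pose K (z : T * T) : R := (\1_(~` A) z.1 * w z.1) * (\1_(~` A) z.2 * w z.2).
have mK : measurable_fun setT K.
  have mCw : measurable_fun setT (fun x => \1_(~` A) x * w x : R).
    exact: measurable_funM.
  apply: measurable_funM; first exact: (measurable_fst_comp mCw).
  exact: (measurable_snd_comp mCw).
have K0 z : 0 <= K z by rewrite !mulr_ge0 ?weight_ge0.
set G := (1 + r ^+ 2) `^ _.
have KE : (\int[leb \x leb]_z ((f z.1 - f z.2) ^+ 2 * K z)%:E <=
    (2 `^ (d%:R + alpha) * G + 2 `^ (d%:R + alpha) * G)%:E * (Z%:E * E f))%E.
  apply: energy_comparison => //; [by rewrite mulr_ge0 ?powR_ge0..|].
  move=> x y; have rhs0 : 0 <= 2 `^ (d%:R + alpha) * G * w x + 2 `^ (d%:R + alpha) * G * w y.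
    by rewrite addr_ge0// !mulr_ge0 ?powR_ge0 ?weight_ge0.
  rewrite /K/= !indicE.
  have [|_] := boolP (x \in ~` A); last by rewrite !mul0r.
  have [|_] := boolP (y \in ~` A); last by rewrite mul0r mulr0 mul0r.
  rewrite !inE /A/= => /negP; rewrite -leNgt => yr /negP; rewrite -leNgt => xr.
  rewrite !mul1r; have le x' : enorm x' <= r ->
      (1 + enorm x' ^+ 2) `^ ((alpha - eps) / 2) <= G.
    move=> xr'; rewrite ge0_ler_powR ?nnegrE ?addr_ge0 ?sqr_ge0//.
      by rewrite divr_ge0// subr_ge0 ltW.
    by rewrite lerD2l lerXn2r ?nnegrE ?enorm_ge0 ?(ltW r0).
  by apply: weight_product_le; rewrite ?powR_ge0//; exact: le.
have mAw : measurable_fun setT (fun x => \1_A x * w x : R) by exact: measurable_funM.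
have Aw0 x : 0 <= \1_A x * w x :> R by rewrite mulr_ge0 ?weight_ge0.
pose H1 (z : T * T) : R := (\1_A z.1 * w z.1) * w z.2.
pose H2 (z : T * T) : R := w z.1 * (\1_A z.2 * w z.2).
pose tc := @tail_cst R d eps * r `^ (- eps).
have tail := weight_tail eps0 r0; rewrite -/A -/tc in tail.
have ZE0 : (0 <= Z%:E)%E by rewrite lee_fin (ltW Z0).
have H1le : (\int[leb \x leb]_z (H1 z)%:E <= (tc * Z)%:E)%E.
  rewrite (ge0_integral_prod_mul _ _ mAw mw Aw0 (@weight_ge0 _ _ _)).
  by rewrite -(partition_functionE eps0) EFinM lee_wpmul2r.
have H2le : (\int[leb \x leb]_z (H2 z)%:E <= (tc * Z)%:E)%E.
  rewrite (ge0_integral_prod_mul _ _ mw mAw (@weight_ge0 _ _ _) Aw0).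
  by rewrite -(partition_functionE eps0) mulrC EFinM lee_wpmul2l.
have m1 : measurable_fun setT (fun z => (H1 z)%:E).
  apply/measurable_EFinP; apply: measurable_funM; last exact: measurable_weight_snd.
  exact: (measurable_fst_comp mAw).
have m2 : measurable_fun setT (fun z => (H2 z)%:E).
  apply/measurable_EFinP; apply: measurable_funM; first exact: measurable_weight_fst.
  exact: (measurable_snd_comp mAw).
have H10 z : 0 <= H1 z by apply: mulr_ge0 => //; exact: weight_ge0.
have H20 z : 0 <= H2 z by apply: mulr_ge0 => //; exact: weight_ge0.
have n1 z : setT z -> (0 <= (H1 z)%:E)%E by rewrite lee_fin.
have n2 z : setT z -> (0 <= (H2 z)%:E)%E by rewrite lee_fin.
have b0 : (0 <= (4 * M ^+ 2)%:E)%E by rewrite lee_fin mulr_ge0 ?sqr_ge0.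
pose D (z : T * T) : R := (f z.1 - f z.2) ^+ 2.
have D0 z : 0 <= D z by exact: sqr_ge0.
have mD : measurable_fun setT D by apply: measurable_funX; exact: measurable_difference.
have mDK : measurable_fun setT (fun z => (D z * K z)%:E).
  by apply/measurable_EFinP; exact: measurable_funM.
have nDK z : setT z -> (0 <= (D z * K z)%:E)%E by rewrite lee_fin mulr_ge0.
have mww : measurable_fun setT (fun z => (D z * (w z.1 * w z.2))%:E).
  apply/measurable_EFinP; apply: measurable_funM => //.
  by apply: measurable_funM; [exact: measurable_weight_fst|exact: measurable_weight_snd].
have mH := emeasurable_funD m1 m2.
have nH z : setT z -> (0 <= (H1 z)%:E + (H2 z)%:E)%E.
  by rewrite -EFinD lee_fin addr_ge0.
have mbH := measurable_funeM (4 * M ^+ 2)%:E mH.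
have nbH z : setT z -> (0 <= (4 * M ^+ 2)%:E * ((H1 z)%:E + (H2 z)%:E))%E.
  by move=> /nH; exact: mule_ge0.
have DM z : D z <= 4 * M ^+ 2.
  have M0 : 0 <= M by apply: le_trans (fM z.1).
  have := fM z.1; have := fM z.2; rewrite !ler_norml => /andP[? ?] /andP[? ?].
  have -> : 4 * M ^+ 2 = (2 * M) ^+ 2 by ring.
  rewrite /D -real_normK ?num_real// lerXn2r ?nnegrE ?mulr_ge0//.
  by rewrite ler_norml; apply/andP; split; lra.
have split_le : (\int[leb \x leb]_z (D z * (w z.1 * w z.2))%:E <=
    \int[leb \x leb]_z (D z * K z)%:E + (4 * M ^+ 2)%:E * (tc * Z + tc * Z)%:E)%E.
  apply: (@le_trans _ _ (\int[leb \x leb]_z ((D z * K z)%:E +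
      (4 * M ^+ 2)%:E * ((H1 z)%:E + (H2 z)%:E)))%E); last first.
    rewrite (ge0_integralD _ measurableT nDK mDK nbH mbH).
    rewrite (ge0_integralZl _ measurableT mH nH b0).
    rewrite (ge0_integralD _ measurableT n1 m1 n2 m2).
    by rewrite leeD2l// lee_wpmul2l// EFinD leeD.
  apply: (ge0_le_integral _ measurableT) => //.
  - move=> z _; rewrite lee_fin; apply: mulr_ge0 => //.
    by apply: mulr_ge0; exact: weight_ge0.
  - exact: (emeasurable_funD mDK mbH).
  - move=> z _; rewrite -(EFinD (H1 z)) -(EFinM (4 * M ^+ 2)) -EFinD lee_fin.
    rewrite /K /H1 /H2 !indicE !in_setC.
    by apply: indic_split_le; rewrite ?weight_ge0 ?D0 ?DM.
apply: (le_trans (variance_le eps0 fL f0)).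
have Zi0 : (0 <= (Z^-1 * Z^-1)%:E)%E by rewrite lee_fin mulr_ge0 ?invr_ge0 ?(ltW Z0).
apply: (le_trans (lee_wpmul2l Zi0 (le_trans split_le (leeD2r _ KE)))).
have tc0 : 0 <= tc by rewrite mulr_ge0 ?powR_ge0// (ltW (tail_cst_gt0 eps0)).
have T0 : (0 <= (4 * M ^+ 2)%:E * (tc * Z + tc * Z)%:E)%E.
  by rewrite mule_ge0// lee_fin addr_ge0// mulr_ge0// (ltW Z0).
have E0 : (0 <= (2 `^ (d%:R + alpha) * G + 2 `^ (d%:R + alpha) * G)%:E * (Z%:E * E f))%E.
  rewrite mule_ge0 ?mule_ge0 ?dirichlet_form_ge0// lee_fin.
  by rewrite addr_ge0// mulr_ge0 ?powR_ge0.
rewrite (ge0_muleDr _ E0 T0).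
apply: leeD.
  rewrite !muleA -!EFinM (_ : _ * _ * _ = c1 * G)//.
  by rewrite /c1; field; rewrite gt_eqF.
rewrite -!EFinM lee_fin le_eqVlt; apply/orP; left; apply/eqP.
by rewrite /c2 /tc; field; rewrite gt_eqF.
Qed.

Let c2_gt0 : 0 < c2.
Proof.
by apply: (mulr_gt0 _ (tail_cst_gt0 eps0)); rewrite mulr_gt0// invr_gt0.
Qed.

Lemma measurable_clamp M f : measurable_fun setT f ->
  measurable_fun setT (fun x => clamp M (f x)).
Proof.
move=> mf; apply: (measurable_maxr (f := cst (- M))) => //.
exact: (measurable_minr (f := cst M)).
Qed.

Lemma log_potential_weak_poincare :
  exists2 c, 0 < c & weak_poincare_inequality alpha V
    (fun r => c * (1 + r `^ (- ((alpha - eps) / eps)))).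
Proof.
pose theta := (alpha - eps) / eps.
have ae0 : 0 < alpha - eps by rewrite subr_gt0.
have theta0 : 0 < theta by rewrite divr_gt0.
have k0 := c2_gt0; set k := c2 in k0.
have c10 : 0 < c1 by rewrite !mulr_gt0 ?invr_gt0 ?powR_gt0 ?Z0.
(* 2^((alpha-eps)/2) comes from 1 + rho^2 <= 2 rho^2, and k^theta from a^(alpha-eps) = k^theta
   r^-theta, for the radii a and rho chosen below. *)
pose c := c1 * 2 `^ ((alpha - eps) / 2) * (1 + k `^ theta).
have k1 : 0 < 1 + k `^ theta by rewrite addr_gt0 ?powR_gt0.
have c0 : 0 < c by apply: (mulr_gt0 _ k1); rewrite (mulr_gt0 c10)// powR_gt0.
exists c => // r f r0 [fL fE] f0; rewrite -/theta.
have mf := Lfun_measurable fL.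
have E0 := dirichlet_form_ge0 (alpha := alpha) (eps := eps) f.
have bE0 : (0 <= (c * (1 + r `^ (- theta)))%:E * E f)%E.
  by rewrite mule_ge0// lee_fin mulr_ge0 ?(ltW c0)// addr_ge0 ?powR_ge0.
have N0 := Lnorm_ge0 mu +oo (EFin \o f).
(* If the norm is infinite, so is the right-hand side, since r > 0. *)
case NE : ('N[mu]_+oo[EFin \o f])%E N0 => [M| |] // M0; last first.
  rewrite expe2 mulyy gt0_muley ?lte_fin// addey ?leey//.
  by rewrite gt_eqF// (lt_le_trans _ bE0)// ltNy0.
rewrite lee_fin in M0.
have fM : {ae mu, forall x, `|f x| <= M} by apply/(Lnormy_le muT mf M0); rewrite NE.
(* The bound by M only holds almost everywhere, hence the truncation. *)
pose g x := clamp M (f x).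
have fg : {ae mu, forall x, f x = g x}.
  by apply: filterS fM => x fxM; rewrite /g clamp_id.
have mg : measurable_fun setT g by exact: measurable_clamp.
have gL : g \in L2.
  by apply: (Lfun2_dominated mg fL); apply: filterS fg => x ->.
have gm : \int[mu]_x g x = 0.
  by rewrite -(ae_eq_Rintegral mf mg fg) /Rintegral f0.
have gM x : `|g x| <= M by exact: clamp_le.
have gf : (E g <= E f)%E.
  by apply: energy_contraction => // x y; exact: clamp_contraction.
have -> : (\int[mu]_x (f x ^+ 2)%:E = \int[mu]_x (g x ^+ 2)%:E)%E.
  rewrite -(innerE fL) -(innerE gL) (inner_ae_eq fL gL fL fg) innerC.
  by rewrite (inner_ae_eq fL gL gL fg).
(* a is the radius at which the tail term k a^-eps equals r. *)
pose a := (r / k) `^ (- eps^-1).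
have a0 : 0 < a by rewrite powR_gt0// divr_gt0.
pose rho := Num.max 1 a.
have rho1 : 1 <= rho by rewrite le_max lexx.
have arho : a <= rho by rewrite le_max lexx orbT.
have rho0 : 0 < rho by exact: lt_le_trans rho1.
apply: (le_trans (weak_poincare_bounded gL gm gM rho0)).
apply: leeD; last first.
  rewrite -EFin_expe -EFinM lee_fin ler_wpM2r ?sqr_ge0//.
  rewrite -/k mulrC -ler_pdivlMr//.
  have -> : r / k = a `^ (- eps).
    by rewrite /a -powRrM mulrNN mulVf ?gt_eqF// powRr1// divr_ge0 ?ltW.
  exact: le_powRN.
apply: (@le_trans _ _ ((c1 * (1 + rho ^+ 2) `^ ((alpha - eps) / 2))%:E * E f)%E).
  by rewrite lee_wpmul2l// lee_fin mulr_ge0 ?powR_ge0 ?(ltW c10).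
rewrite lee_wpmul2r// lee_fin (_ : c * _ = c1 *
  (2 `^ ((alpha - eps) / 2) * ((1 + k `^ theta) * (1 + r `^ (- theta))))); last first.
  by rewrite /c; ring.
apply: ler_wpM2l; first exact: ltW.
apply: (@le_trans _ _ ((2 * rho ^+ 2) `^ ((alpha - eps) / 2))).
  rewrite ge0_ler_powR ?nnegrE ?divr_ge0 ?(ltW ae0)//.
  - by rewrite addr_ge0// sqr_ge0.
  - by rewrite mulr_ge0// sqr_ge0.
  - by have := ler_pM ler01 ler01 rho1 rho1; rewrite expr2; lra.
rewrite powRM ?sqr_ge0// ler_wpM2l ?powR_ge0// (powR_sqr _ (ltW rho0)).
have aE : a `^ (alpha - eps) = k `^ theta * r `^ (- theta).
  rewrite /a -powRrM (_ : - eps^-1 * _ = - theta); last by rewrite /theta; ring.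
  rewrite powRM ?invr_ge0 ?ltW// mulrC; congr (_ * _).
  by rewrite -powR_inv1 ?ltW// -powRrM mulN1r opprK.
have [ra|ra] := leP a 1.
  rewrite /rho (max_l ra) powR1 mulrDr mulr1 mulrDl mul1r.
  by rewrite -addrA lerDl !addr_ge0// ?mulr_ge0 ?addr_ge0 ?powR_ge0.
rewrite /rho max_r ?(ltW ra)// aE.
have := powR_ge0 k theta; have := powR_ge0 r (- theta).
have := mulr_ge0 (powR_ge0 k theta) (powR_ge0 r (- theta)).
lra.
Qed.

End weak_poincare.

(** * Super Poincare inequality *)

Section super_poincare.
Context {R : realType} {d : nat} {alpha eps : R}.
Hypothesis alpha0 : 0 < alpha.
Hypothesis alpha_eps : alpha < eps.
Local Notation T := (d.-tuple R).
Implicit Types (x y : T) (f : T -> R).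
Local Notation dist x y := (enorm (tuple_sub x y)).
Local Notation leb := (@lebesgue_tuple R d).
Local Notation V := (log_potential d eps).
Local Notation mu := (gibbs V).
Local Notation Z := (partition_function V).
Local Notation w := (@weight R d eps).
Local Notation E f := (dirichlet_form alpha V f f).
Local Notation L2 := (Lfun mu 2%:E).

Let eps0 : 0 < eps. Proof. exact: lt_trans alpha_eps. Qed.

Let Z0 : 0 < Z. Proof. exact: partition_function_gt0. Qed.

Let muT : mu setT = 1%E. Proof. exact: gibbsT. Qed.

(* Integrate c^2 <= (c - f)^2 + 2 |c| |f| over Q and absorb |c| by AM-GM. *)
Lemma sqr_average_le f (Q : set T) (c v M : R) : measurable_fun setT f ->
  measurable Q -> 0 < v -> (leb Q = v%:E)%E ->
  (\int[leb]_y (\1_Q y * `|f y|)%:E <= M%:E)%E ->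
  ((c ^+ 2)%:E <= (2 / v)%:E * \int[leb]_y (\1_Q y * (c - f y) ^+ 2)%:E
                 + (4 * M ^+ 2 / v ^+ 2)%:E)%E.
Proof.
move=> mf mQ v0 Qv fM.
have mQ1 : measurable_fun setT (\1_Q : T -> R) by exact: measurable_indic.
have mcf : measurable_fun setT (fun y => c - f y) by exact: measurable_funB.
pose g1 y : \bar R := (\1_Q y * (c - f y) ^+ 2)%:E.
pose g2 y : \bar R := (\1_Q y * `|f y|)%:E.
have m1 : measurable_fun setT g1.
  by apply/measurable_EFinP; apply: measurable_funM => //; exact: measurable_funX.
have m2 : measurable_fun setT g2.
  by apply/measurable_EFinP; apply: measurable_funM => //; exact: measurableT_comp.
have n1 y : setT y -> (0 <= g1 y)%E by rewrite lee_fin mulr_ge0 ?sqr_ge0.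
have n2 y : setT y -> (0 <= g2 y)%E by rewrite lee_fin mulr_ge0.
have c0 : (0 <= (2 * `|c|)%:E)%E by rewrite lee_fin mulr_ge0.
have H : ((c ^+ 2 * v)%:E <= \int[leb]_y g1 y + (2 * `|c| * M)%:E)%E.
  apply: (@le_trans _ _ (\int[leb]_y (g1 y + (2 * `|c|)%:E * g2 y))%E); last first.
    rewrite (ge0_integralD _ measurableT n1 m1 _ (measurable_funeM _ m2)); last first.
      by move=> y /n2; exact: mule_ge0.
    by rewrite (ge0_integralZl _ measurableT m2 n2 c0) leeD2l// (EFinM (2 * `|c|)) lee_wpmul2l.
  have -> : ((c ^+ 2 * v)%:E = \int[leb]_y ((c ^+ 2)%:E * (\1_Q y)%:E))%E.
    have mQE : measurable_fun setT (fun y => (\1_Q y : R)%:E) by exact/measurable_EFinP.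
    have nQ y : setT y -> (0 <= (\1_Q y : R)%:E)%E by rewrite lee_fin.
    have cc : (0 <= (c ^+ 2)%:E)%E by rewrite lee_fin sqr_ge0.
    rewrite (ge0_integralZl _ measurableT mQE nQ cc) integral_indic// setIT EFinM.
    by congr (_ * _)%E; exact: esym.
  apply: ge0_le_integral => //.
  - by move=> y _; rewrite mule_ge0 ?lee_fin ?sqr_ge0.
  - by apply: measurable_funeM; exact/measurable_EFinP.
  - by apply: (emeasurable_funD m1); exact: measurable_funeM.
  - move=> y _; rewrite /g1 /g2 -!EFinM -EFinD lee_fin.
    rewrite indicE; case: (y \in Q); last by rewrite !(mul0r, mulr0) addr0.
    rewrite mulr1 !mul1r; have : c * f y <= `|c| * `|f y| by rewrite -normrM ler_norm.
    by have := sqr_ge0 (f y); rewrite !expr2; lra.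
have I0 : (0 <= \int[leb]_y g1 y)%E by exact: integral_ge0.
rewrite -/(\int[leb]_y g1 y)%E.
case IE : (\int[leb]_y g1 y)%E I0 H => [i| |] // I0 H; last first.
  by rewrite gt0_muley ?lte_fin ?divr_gt0// addye ?leey.
rewrite -EFinD lee_fin in H; rewrite -EFinM -EFinD lee_fin.
rewrite [leRHS](_ : _ = (2 * i * v + 4 * M ^+ 2) / v ^+ 2); last first.
  by field; rewrite gt_eqF.
rewrite ler_pdivlMr ?exprn_gt0//.
have := ler_wpM2r (ltW v0) H.
have := sqr_ge0 (`|c| * v - 2 * M).
have -> : c ^+ 2 = `|c| ^+ 2 by rewrite real_normK ?num_real.
rewrite !expr2; lra.
Qed.

(** The lower bound m of the weight on Q converts Lebesgue measure into mu, at the cost Z / m. *)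
Lemma integral_norm_le f (Q : set T) m : f \in L2 -> measurable Q -> 0 < m ->
  (forall y, Q y -> m <= w y) ->
  (\int[leb]_y (\1_Q y * `|f y|)%:E <= (m^-1 * Z * \int[mu]_x `|f x|)%:E)%E.
Proof.
move=> fL mQ m0 Qm; have mf := Lfun_measurable fL.
have mw := @measurable_weight R d eps.
have mfa : measurable_fun setT (fun y => `|f y|%:E).
  by apply/measurable_EFinP; exact: measurableT_comp.
have mfw : measurable_fun setT (fun y => `|f y|%:E * (w y)%:E)%E.
  by apply: emeasurable_funM => //; exact/measurable_EFinP.
have nfw y : setT y -> (0 <= `|f y|%:E * (w y)%:E)%E.
  by move=> _; rewrite mule_ge0 ?lee_fin ?weight_ge0.
have mi0 : (0 <= (m^-1)%:E)%E by rewrite lee_fin invr_ge0 ltW.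
rewrite EFinM EFin_Rintegral ?(integrable_abs_Lfun2 muT)//.
rewrite (gibbs_integral eps0 mfa); last by move=> y; rewrite lee_fin.
rewrite muleA -EFinM mulfK ?gt_eqF// -(ge0_integralZl _ measurableT mfw nfw mi0).
apply: ge0_le_integral => //.
- apply/measurable_EFinP; apply: measurable_funM; first exact: measurable_indic.
  exact: measurableT_comp.
- exact: measurable_funeM.
- move=> y _; rewrite -!EFinM lee_fin mulrCA indicE.
  have [|_] := boolP (y \in Q); last first.
    by rewrite mul0r !mulr_ge0 ?weight_ge0// invr_ge0 ltW.
  rewrite inE => /Qm mwy; rewrite mul1r ler_peMr//.
  by rewrite mulrC ler_pdivlMr// mul1r.
Qed.

Lemma measurable_boxes (s : R) :
  measurable [set z : T * T | box z.1 s z.2].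
Proof.
rewrite (_ : [set z | _] = \bigcap_(i in [set: 'I_d])
    (setT `&` (fun z : T * T => tnth z.2 i - tnth z.1 i) @^-1` `[- s, s])).
  apply: fin_bigcap_measurable => // i _.
  have mi : measurable_fun setT (fun y : T => tnth y i) by exact: measurable_tnth.
  have mii : measurable_fun setT (fun z : T * T => tnth z.2 i - tnth z.1 i).
    apply: measurable_funB; first exact: (measurable_snd_comp mi).
    exact: (measurable_fst_comp mi).
  by apply: mii => //; exact: measurable_itv.
apply/seteqP; split => [z zs i _|z zs i].
  by split => //; rewrite /preimage/= in_itv/= -ler_norml.
by have [_] := zs i I; rewrite /preimage/= in_itv/= -ler_norml.
Qed.

Section scales.
Variables s r : R.
Hypothesis s01 : 0 < s <= 1.
Hypothesis r1 : 1 <= r.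
(** This puts the cube of half-width 1 around the origin inside the ball of radius r, so that its
    points y satisfy |y| <= |x| for every x outside the ball. *)
Hypothesis dr : d%:R <= r ^+ 2.

(** m1 bounds the weight from below on all the cubes used, by |y|^2 <= 2 |x|^2 + 2 |x - y|^2; m2
    does so on the central cube only, but independently of r. v1 and v2 are the volumes of the two
    kinds of cubes. A is the energy cost for |x| <= r, B the one for |x| > r, and L the coefficient
    of mu(|f|)^2. *)
Let b : R := (d%:R + eps) / 2.
Let m1 : R := (1 + (2 * r ^+ 2 + 2 * d%:R)) `^ (- b).
Let m2 : R := (1 + d%:R) `^ (- b).
Let v1 : R := (2 * s) ^+ d.
Let v2 : R := (2 * 1) ^+ d.
Let A : R := 2 / v1 * (d%:R * s ^+ 2) `^ ((d%:R + alpha) / 2).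
Let B : R := 2 / v2 * 2 `^ (d%:R + alpha) * r `^ (- (eps - alpha)) / m2.
Let L : R := 4 * (m1^-1 * Z) ^+ 2 / v1 ^+ 2.

Let N : set T := [set x | r < enorm x].

(* f x is compared with its average over a cube: of half-width s centred at x if
   |x| <= r, of half-width 1 centred at the origin otherwise. *)
Let K (z : T * T) : R :=
  \1_(~` N) z.1 * (2 / v1) * (\1_[set z : T * T | box z.1 s z.2] z * w z.1) +
  \1_N z.1 * (2 / v2) * (\1_(box tuple0 1) z.2 * w z.1).

Let s0 : 0 < s. Proof. by case/andP: s01. Qed.
Let s1 : s <= 1. Proof. by case/andP: s01. Qed.
Let r0 : 0 < r. Proof. exact: lt_le_trans r1. Qed.
Let v10 : 0 < v1. Proof. by rewrite exprn_gt0// mulr_gt0 ?s0. Qed.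
Let v20 : 0 < v2. Proof. by rewrite exprn_gt0. Qed.
Let m20 : 0 < m2. Proof. by rewrite powR_gt0// ltr_wpDr. Qed.
Let m10 : 0 < m1.
Proof. by rewrite powR_gt0// ltr_wpDr// addr_ge0// mulr_ge0 ?sqr_ge0. Qed.

Lemma weight_ge_box0 y : box tuple0 1 y -> m2 <= w y /\ m1 <= w y.
Proof.
move=> /(box_edist ler01); rewrite edist0 expr1n mulr1 => yd.
split; first exact: (weight_ge (lt_trans alpha0 alpha_eps)).
apply: (weight_ge (lt_trans alpha0 alpha_eps)); apply: (le_trans yd).
by have := sqr_ge0 r; have := ler0n R d; lra.
Qed.

Lemma weight_ge_near x y : enorm x <= r -> box x s y -> m1 <= w y.
Proof.
move=> xr /(box_edist (ltW s0)) xy.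
apply: (weight_ge (lt_trans alpha0 alpha_eps)); apply: (le_trans (sqr_enorm_le x y)).
rewrite lerD// ler_wpM2l//.
  by rewrite lerXn2r ?nnegrE ?enorm_ge0// (ltW r0).
apply: (le_trans xy); rewrite ler_piMr// expr_le1 ?s1// ltW//; exact: s0.
Qed.

Lemma kernel_energy_le x y :
  K (x, y) * dist x y `^ (d%:R + alpha) <= A * w x + B * w y.
Proof.
have A0 : 0 <= A by rewrite mulr_ge0 ?powR_ge0// divr_ge0// ltW// v10.
have B0 : 0 <= B.
  rewrite mulr_ge0 ?invr_ge0 ?(ltW m20)// mulr_ge0 ?powR_ge0//.
  by rewrite mulr_ge0 ?powR_ge0// divr_ge0// (ltW v20).
have wx := weight_ge0 (eps := eps) x; have wy := weight_ge0 (eps := eps) y.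
have q0 := powR_ge0 (dist x y) (d%:R + alpha).
have da0 : 0 <= d%:R + alpha by rewrite addr_ge0// ltW.
have Aw0 := mulr_ge0 A0 wx; have Bw0 := mulr_ge0 B0 wy.
have AB0 := addr_ge0 Aw0 Bw0.
rewrite /K /= !indicE in_setC; have [|xN] := boolP (x \in N).
  rewrite inE /N/= => rx; rewrite !mul0r add0r mul1r.
  have [|_] := boolP (y \in box tuple0 1); last by rewrite mul0r mulr0 mul0r.
  rewrite inE => ybox; have [m2y _] := weight_ge_box0 ybox.
  have yx : enorm y <= enorm x.
    rewrite (le_trans _ (ltW rx))// -(ler_pXn2r (n := 2))// ?nnegrE ?enorm_ge0 ?(ltW r0)//.
    by have := box_edist ler01 ybox; rewrite edist0 expr1n mulr1 => /le_trans; apply.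
  apply: (@le_trans _ _ (B * w y)); last by rewrite lerDr.
  have := weight_edist_le (eps := eps) (ltW alpha0) yx; rewrite edistC => wq.
  have xr : (1 + enorm x ^+ 2) `^ ((alpha - eps) / 2) <= r `^ (- (eps - alpha)).
    rewrite (_ : (alpha - eps) / 2 = - ((eps - alpha) / 2)); last by field.
    rewrite powRN [leRHS]powRN -(powR_sqr _ (ltW r0)) -!powRN.
    apply: le_powRN; rewrite ?exprn_gt0 ?divr_gt0 ?subr_gt0 ?r0//.
    rewrite (@le_trans _ _ (enorm x ^+ 2))//; last by rewrite lerDr.
    by rewrite lerXn2r ?nnegrE ?enorm_ge0 ?(ltW r0) ?(ltW rx).
  pose X := 2 `^ (d%:R + alpha) * r `^ (- (eps - alpha)).
  have X0 : 0 <= X by rewrite mulr_ge0 ?powR_ge0.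
  have wqX : w x * dist x y `^ (d%:R + alpha) <= X.
    by apply: (le_trans wq); rewrite ler_wpM2l ?powR_ge0.
  (* Since w y >= m2 on the central cube, the constant X becomes a multiple of the weight at y. *)
  have XX : X <= X / m2 * w y.
    by rewrite mulrAC (ler_pdivlMr _ _ m20); exact: ler_wpM2l.
  have -> : B * w y = 2 / v2 * (X / m2 * w y) by rewrite /B /X; ring.
  rewrite mul1r -[leLHS]mulrA; apply: ler_wpM2l; last exact: le_trans XX.
  by rewrite divr_ge0 ?(ltW v20).
rewrite !mul0r addr0 mul1r; have [|_] := boolP ((x, y) \in _); last first.
  by rewrite mul0r mulr0 mul0r.
rewrite inE /= => xybox; rewrite mul1r.
apply: (@le_trans _ _ (A * w x)); last by rewrite lerDl.
rewrite /A -[leLHS]mulrA -[leRHS]mulrA; apply: ler_wpM2l.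
  by rewrite divr_ge0 ?(ltW v10).
rewrite mulrC; apply: (ler_wpM2r wx); rewrite -(powR_sqr _ (enorm_ge0 _)).
rewrite ge0_ler_powR ?nnegrE ?divr_ge0 ?sqr_ge0//.
  by rewrite mulr_ge0 ?sqr_ge0.
exact: (box_edist (ltW s0)).
Qed.

Lemma measurable_kernel : measurable_fun setT K.
Proof.
have mN : measurable N by exact: measurable_enorm_gt.
have mC : measurable_fun setT (fun x => \1_(~` N) x * (2 / v1) : R).
  by apply: measurable_funM => //; apply: measurable_indic; exact: measurableC.
have mN1 : measurable_fun setT (fun x => \1_N x * (2 / v2) : R).
  by apply: measurable_funM => //; exact: measurable_indic.
have mb : measurable_fun setT (\1_[set z : T * T | box z.1 s z.2] : T * T -> R).
  by apply: measurable_indic; exact: measurable_boxes.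
have mb0 : measurable_fun setT (\1_(box tuple0 1) : T -> R).
  by apply: measurable_indic; exact: measurable_box.
have mw1 := measurable_weight_fst (R := R) (d := d) (eps := eps).
apply: measurable_funD; apply: measurable_funM.
- exact: (measurable_fst_comp mC).
- exact: measurable_funM.
- exact: (measurable_fst_comp mN1).
- by apply: measurable_funM => //; exact: (measurable_snd_comp mb0).
Qed.

Lemma kernel_ge0 z : 0 <= K z.
Proof.
have w0 := weight_ge0 (eps := eps) z.1.
by apply: addr_ge0; apply: mulr_ge0; apply: mulr_ge0 => //;
  rewrite divr_ge0// ltW// ?v10 ?v20.
Qed.

(** [sqr_average_le] with c = f x, multiplied by w x. [gen] treats both regimes at once: they differ
    only by the cube Q, and w >= m1 on Q and v >= v1 hold in either. *)
Lemma sqr_le_kernel f x : f \in L2 ->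
  ((f x ^+ 2 * w x)%:E <=
   \int[leb]_y ((f x - f y) ^+ 2 * K (x, y))%:E
   + (L * (\int[mu]_x `|f x|) ^+ 2 * w x)%:E)%E.
Proof.
move=> fL; have mf := Lfun_measurable fL.
set N1 := \int[mu]_x `|f x|.
have N10 : 0 <= N1 by exact: Rintegral_ge0.
have wx := weight_ge0 (eps := eps) x; have wx0 : (0 <= (w x)%:E)%E by rewrite lee_fin.
pose M := m1^-1 * Z * N1.
have M0 : 0 <= M by apply: mulr_ge0 => //; rewrite mulr_ge0 ?invr_ge0 ?(ltW m10) ?(ltW Z0).
have LE : L * N1 ^+ 2 = 4 * M ^+ 2 / v1 ^+ 2 by rewrite /L /M; ring.
suff gen (Q : set T) v : measurable Q -> 0 < v -> (leb Q = v%:E)%E ->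
    (forall y, Q y -> m1 <= w y) -> v1 <= v ->
    (forall y, K (x, y) = 2 / v * (\1_Q y * w x)) ->
    ((f x ^+ 2 * w x)%:E <= \int[leb]_y ((f x - f y) ^+ 2 * K (x, y))%:E
      + (L * N1 ^+ 2 * w x)%:E)%E.
  have [rx|xr] := ltP r (enorm x).
    apply: (gen (box tuple0 1) v2).
    - exact: measurable_box.
    - exact: v20.
    - exact: (lebesgue_tuple_box tuple0 ler01).
    - by move=> y /weight_ge_box0[].
    - rewrite /v1 /v2 lerXn2r ?nnegrE ?mulr_ge0 ?(ltW s0)//.
      by rewrite ler_wpM2l// s1.
    - move=> y; rewrite /K/= !indicE in_setC mem_set//=.
      by rewrite !mul0r add0r mul1r.
  apply: (gen (box x s) v1).
  - exact: measurable_box.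
  - exact: v10.
  - exact: (lebesgue_tuple_box x (ltW s0)).
  - by move=> y; exact: weight_ge_near.
  - exact: lexx.
  - move=> y; rewrite /K/= !indicE in_setC memNset/=; last by rewrite /N/= ltNge xr.
    rewrite !mul0r addr0 mul1r.
    have -> // : ((x, y) \in [set z : T * T | box z.1 s z.2]) = (y \in box x s).
    by apply/idP/idP; rewrite !inE.
move=> mQ v0 Qv Qm vv KE.
have mQ1 : measurable_fun setT (\1_Q : T -> R) by exact: measurable_indic.
pose g1 y : \bar R := (\1_Q y * (f x - f y) ^+ 2)%:E.
have m1' : measurable_fun setT g1.
  apply/measurable_EFinP; apply: measurable_funM => //; apply: measurable_funX.
  exact: measurable_funB.
have n1 y : setT y -> (0 <= g1 y)%E by rewrite lee_fin mulr_ge0 ?sqr_ge0.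
have c0 : (0 <= (2 / v)%:E)%E by rewrite lee_fin divr_ge0 ?ltW.
have cw0 : (0 <= (2 / v * w x)%:E)%E by rewrite (EFinM (2 / v)) mule_ge0.
have I0 : (0 <= \int[leb]_y g1 y)%E by apply: integral_ge0 => y _; exact: n1.
have := sqr_average_le (f x) mf mQ v0 Qv (integral_norm_le fL mQ m10 Qm).
rewrite -/N1 -/M => /(lee_wpmul2r wx0); rewrite -EFinM => /le_trans; apply.
have M40 : 0 <= 4 * M ^+ 2 by apply: mulr_ge0 => //; exact: sqr_ge0.
have c40 : (0 <= (4 * M ^+ 2 / v ^+ 2)%:E)%E.
  by rewrite lee_fin (divr_ge0 M40)// sqr_ge0.
rewrite (ge0_muleDl _ (mule_ge0 c0 I0) c40).
apply: leeD.
  rewrite muleAC -EFinM -(ge0_integralZl _ measurableT m1' n1 cw0).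
  rewrite le_eqVlt; apply/orP; left; apply/eqP; apply: eq_integral => y _.
  by rewrite KE /g1 -EFinM; congr (_%:E); ring.
rewrite -EFinM lee_fin; apply: (ler_wpM2r wx); rewrite LE; apply: (ler_wpM2l M40).
have vv2 : v1 ^+ 2 <= v ^+ 2.
  by apply: lerXn2r => //; rewrite nnegrE ltW.
by rewrite lef_pV2 ?posrE ?(exprn_gt0 _ v10) ?(exprn_gt0 _ v0).
Qed.

(** Integrate [sqr_le_kernel] in x; the kernel term is bounded by the energy through
    [kernel_energy_le]. *)
Lemma super_poincare_scales f : f \in L2 ->
  (\int[mu]_x (f x ^+ 2)%:E <=
    (A + B)%:E * E f + (L * (\int[mu]_x `|f x|) ^+ 2)%:E)%E.
Proof.
move=> fL; have mf := Lfun_measurable fL.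
set N1 := \int[mu]_x `|f x|.
have mw := @measurable_weight R d eps.
have mwE : measurable_fun setT (EFin \o w) by exact/measurable_EFinP.
have L0 : 0 <= L * N1 ^+ 2.
  apply: (mulr_ge0 _ (sqr_ge0 _)); apply: (divr_ge0 _ (sqr_ge0 _)).
  by apply: (mulr_ge0 _ (sqr_ge0 _)).
have mf2 : measurable_fun setT (fun x => (f x ^+ 2)%:E).
  by apply/measurable_EFinP; exact: measurable_funX.
rewrite (gibbs_integral eps0 mf2); last by move=> x; rewrite lee_fin sqr_ge0.
pose H z : \bar R := ((f z.1 - f z.2) ^+ 2 * K z)%:E.
have mH : measurable_fun setT H.
  apply/measurable_EFinP; apply: measurable_funM; last exact: measurable_kernel.
  by apply: measurable_funX; exact: measurable_difference.
have H0 z : (0 <= H z)%E.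
  by rewrite lee_fin; apply: mulr_ge0; [exact: sqr_ge0|exact: kernel_ge0].
have mFH := measurable_fun_fubini_tonelli_F (m2 := leb) _ mH H0.
have FH0 x : setT x -> (0 <= fubini_F leb H x)%E.
  by move=> _; apply: integral_ge0 => y _; exact: H0.
pose G x : \bar R := (L * N1 ^+ 2 * w x)%:E.
have mG : measurable_fun setT G by apply/measurable_EFinP; exact: measurable_funM.
have G0 x : setT x -> (0 <= G x)%E by rewrite lee_fin mulr_ge0 ?weight_ge0.
have step : (\int[leb]_x ((f x ^+ 2)%:E * (w x)%:E) <=
    (A + B)%:E * (Z%:E * E f) + (L * N1 ^+ 2)%:E * Z%:E)%E.
  apply: (@le_trans _ _ (\int[leb]_x (fubini_F leb H x + G x))%E).
    apply: ge0_le_integral => //.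
    - by move=> x _; rewrite mule_ge0 ?lee_fin ?sqr_ge0 ?weight_ge0.
    - exact: emeasurable_funM.
    - exact: (emeasurable_funD mFH mG).
    - by move=> x _; rewrite -EFinM; exact: sqr_le_kernel.
  rewrite (ge0_integralD _ measurableT FH0 mFH G0 mG) leeD//.
    rewrite -(fubini_tonelli1 _ mH H0).
    apply: energy_comparison => //.
    - exact: measurable_kernel.
    - exact: kernel_ge0.
    - by rewrite mulr_ge0 ?powR_ge0// divr_ge0// ltW// v10.
    - rewrite mulr_ge0 ?invr_ge0 ?(ltW m20)// mulr_ge0 ?powR_ge0//.
      by rewrite mulr_ge0 ?powR_ge0// divr_ge0// (ltW v20).
    - exact: kernel_energy_le.
  have wE0 x : setT x -> (0 <= (w x)%:E)%E by rewrite lee_fin weight_ge0.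
  have LE0 : (0 <= (L * N1 ^+ 2)%:E)%E by rewrite lee_fin.
  rewrite /G; under eq_integral do rewrite EFinM.
  by rewrite (ge0_integralZl _ measurableT mwE wE0 LE0) (partition_functionE eps0).
have Zi0 : (0 <= Z^-1%:E)%E by rewrite lee_fin invr_ge0 (ltW Z0).
apply: (le_trans (lee_wpmul2l Zi0 step)).
have A0 : 0 <= A by rewrite mulr_ge0 ?powR_ge0// divr_ge0// ltW// v10.
have B0 : 0 <= B.
  rewrite mulr_ge0 ?invr_ge0 ?(ltW m20)// mulr_ge0 ?powR_ge0//.
  by rewrite mulr_ge0 ?powR_ge0// divr_ge0// (ltW v20).
have AB0 : (0 <= (A + B)%:E)%E by rewrite lee_fin addr_ge0.
have ZE0 : (0 <= Z%:E)%E by rewrite lee_fin (ltW Z0).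
have T1 := mule_ge0 AB0 (mule_ge0 ZE0 (dirichlet_form_ge0 (alpha := alpha) (eps := eps) f)).
have T2 : (0 <= (L * N1 ^+ 2)%:E * Z%:E)%E by rewrite mule_ge0 ?lee_fin.
rewrite (ge0_muleDr _ T1 T2); apply: leeD.
  by rewrite !muleA -!EFinM mulrAC mulVf ?mul1r// gt_eqF.
by rewrite -!EFinM lee_fin mulrCA mulVf ?mulr1// gt_eqF.
Qed.

End scales.
End super_poincare.

(** * Choice of the two scales and the resulting rate *)

Section super_poincare_rate.
Context {R : realType}.

Lemma powRN_le_sum (r a p : R) : 0 < r -> 0 <= a <= p ->
  r `^ (- a) <= 1 + r `^ (- p).
Proof.
move=> r0 /andP[a0 ap]; have rp := powR_ge0 r (- p).
have [r1|r1] := leP 1 r.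
  rewrite (le_trans (y := 1)) ?lerDl// -[leRHS](powRr0 r) ler_powR// oppr_le0//.
rewrite (le_trans (y := r `^ (- p))) ?lerDr//.
by rewrite ger_powR ?lerN2// r0 ltW.
Qed.

(** Of the four terms of the expanded product one is 1, and each of the others is at most 1 +
    r^-p. *)
Lemma powRN_mul_le (r a b p : R) : 0 < r -> 0 <= a -> 0 <= b -> a + b <= p ->
  (1 + r `^ (- a)) * (1 + r `^ (- b)) <= 4 * (1 + r `^ (- p)).
Proof.
move=> r0 a0 b0 abp.
have ha : r `^ (- a) <= 1 + r `^ (- p) by apply: powRN_le_sum => //; apply/andP; split; lra.
have hb : r `^ (- b) <= 1 + r `^ (- p) by apply: powRN_le_sum => //; apply/andP; split; lra.
have hab : r `^ (- a) * r `^ (- b) <= 1 + r `^ (- p).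
  rewrite -powRD; last by apply/implyP => _; rewrite gt_eqF.
  by rewrite -opprD; apply: powRN_le_sum => //; apply/andP; split; lra.
have := powR_ge0 r (- p); move: ha hb hab; rewrite mulrDl !mulrDr !mulr1 !mul1r; lra.
Qed.

Context {d : nat} {alpha eps : R}.
Hypothesis d0 : (0 < d)%N.
Hypothesis alpha0 : 0 < alpha.
Hypothesis alpha_eps : alpha < eps.
Local Notation T := (d.-tuple R).
Local Notation V := (log_potential d eps).
Local Notation mu := (gibbs V).
Local Notation Z := (partition_function V).

Let eps0 : 0 < eps. Proof. exact: lt_trans alpha_eps. Qed.

Let Z0 : 0 < Z. Proof. exact: partition_function_gt0. Qed.

Let b : R := (d%:R + eps) / 2.
(** The constants of [super_poincare_scales] satisfy A = cA s^alpha, B = cB r^-(eps-alpha) and L <=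
    cL r^(2(d+eps)) s^(-2d); the 2d + 3 comes from 1 + 2 r^2 + 2d <= (2d + 3) r^2 for r >= 1. *)
Let cA : R := 2 / 2 ^+ d * d%:R `^ ((d%:R + alpha) / 2).
Let cB : R := 2 / (2 * 1) ^+ d * 2 `^ (d%:R + alpha) / (1 + d%:R) `^ (- b).
Let cL : R := 4 * ((2 * d%:R + 3) `^ b * Z) ^+ 2.

Let dR0 : 0 < d%:R :> R. Proof. by rewrite ltr0n. Qed.

Let cA0 : 0 < cA.
Proof. by rewrite mulr_gt0 ?divr_gt0 ?exprn_gt0 ?powR_gt0 ?dR0. Qed.

Let cB0 : 0 < cB.
Proof.
by rewrite mulr_gt0 ?invr_gt0 ?powR_gt0 ?ltr_wpDr// mulr_gt0 ?divr_gt0 ?exprn_gt0 ?powR_gt0.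
Qed.

Let cL0 : 0 < cL.
Proof.
have : 0 < ((2 * d%:R + 3) `^ b * Z) ^+ 2.
  by rewrite exprn_gt0// mulr_gt0 ?Z0// powR_gt0//; have := dR0; lra.
exact: mulr_gt0.
Qed.

Lemma near_constantE (s : R) : 0 < s ->
  2 / (2 * s) ^+ d * (d%:R * s ^+ 2) `^ ((d%:R + alpha) / 2) = cA * s `^ alpha.
Proof.
move=> s0; rewrite powRM ?sqr_ge0 ?(ltW dR0)// (powR_sqr _ (ltW s0)).
rewrite powRD; last by apply/implyP => _; rewrite gt_eqF.
rewrite powR_mulrn ?(ltW s0)// exprMn /cA; field.
by rewrite !expf_neq0// gt_eqF.
Qed.

Lemma local_constant_le (s r : R) : 0 < s -> 1 <= r ->
  4 * (((1 + (2 * r ^+ 2 + 2 * d%:R)) `^ (- b))^-1 * Z) ^+ 2 / ((2 * s) ^+ d) ^+ 2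
  <= cL * (r `^ (2 * (d%:R + eps)) * s `^ (- (2 * d%:R))).
Proof.
move=> s0 r1; have r0 : 0 < r by exact: lt_le_trans r1.
have r21 : 1 <= r ^+ 2 by rewrite exprn_ege1.
have d3 : 0 <= 2 * d%:R + 3 :> R by rewrite addr_ge0// mulr_ge0.
have b0 : 0 <= b by rewrite divr_ge0// addr_ge0// (ltW eps0).
set a := 1 + _; have a0 : 0 <= a by rewrite /a; have := ltW dR0; lra.
have aE : (a `^ (- b))^-1 <= (2 * d%:R + 3) `^ b * r `^ (d%:R + eps).
  rewrite powRN invrK -(powR_sqr _ (ltW r0)) -powRM ?sqr_ge0// ge0_ler_powR ?nnegrE//.
    by apply: (mulr_ge0 d3); exact: sqr_ge0.
  rewrite /a mulrDl; have := ler_wpM2l (ltW dR0) r21; lra.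
have sE : (((2 * s) ^+ d) ^+ 2)^-1 <= s `^ (- (2 * d%:R)).
  have sd : s `^ (2 * d%:R) = (s ^+ d) ^+ 2.
    by rewrite -exprM -powR_mulrn ?(ltW s0)// natrM mulrC.
  rewrite powRN sd.
  rewrite lef_pV2 ?posrE ?exprn_gt0 ?mulr_gt0//.
  rewrite lerXn2r ?nnegrE ?exprn_ge0 ?mulr_ge0 ?(ltW s0)//.
  by rewrite lerXn2r ?nnegrE ?mulr_ge0 ?(ltW s0)//; lra.
have -> : r `^ (2 * (d%:R + eps)) = (r `^ (d%:R + eps)) ^+ 2.
  by rewrite -powR_mulrn ?powR_ge0// -powRrM mulrC.
have ai0 : 0 <= (a `^ (- b))^-1 by rewrite invr_ge0 powR_ge0.
have -> : cL * ((r `^ (d%:R + eps)) ^+ 2 * s `^ (- (2 * d%:R))) =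
    4 * ((2 * d%:R + 3) `^ b * r `^ (d%:R + eps) * Z) ^+ 2 * s `^ (- (2 * d%:R)).
  by rewrite /cL; ring.
apply: ler_pM => //.
- by apply: mulr_ge0 => //; exact: sqr_ge0.
- by rewrite invr_ge0 sqr_ge0.
- apply: ler_wpM2l => //; apply: lerXn2r; rewrite ?nnegrE.
  + by rewrite mulr_ge0 ?(ltW Z0).
  + by rewrite !mulr_ge0 ?powR_ge0 ?(ltW Z0).
  + by rewrite ler_wpM2r ?(ltW Z0).
Qed.

Lemma log_potential_super_poincare :
  let p := d%:R / alpha
    + (d%:R + eps) * (2 * alpha + d%:R) / (alpha * (eps - alpha)) in
  exists2 c : R, 0 < c &
    super_poincare_inequality alpha V (fun r => c * (1 + r `^ (- p))).
Proof.
set p := _ + _ => p'; rewrite {}/p'.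
have ea0 : 0 < eps - alpha by rewrite subr_gt0.
(* The cubes yield the exponent e1 + e2, which is at most the stated p. *)
pose e1 := 2 * d%:R / alpha; pose e2 := 2 * (d%:R + eps) / (eps - alpha).
have e10 : 0 <= e1 by rewrite divr_ge0 ?mulr_ge0// ltW.
have de0 : 0 <= d%:R + eps by rewrite addr_ge0// (ltW eps0).
have e20 : 0 <= e2 by rewrite divr_ge0 ?mulr_ge0// ltW.
have e12 : e1 + e2 <= p.
  rewrite -subr_ge0 (_ : p - _ = d%:R * (d%:R + alpha) / (alpha * (eps - alpha))).
    apply: (divr_ge0 _ (ltW (mulr_gt0 alpha0 ea0))); apply: mulr_ge0 => //.
    by rewrite addr_ge0// ltW.
  by rewrite /p /e1 /e2; field; rewrite !gt_eqF.
pose k1 := (2 * cA) `^ e1; pose k2 := (2 * cB) `^ e2.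
pose k3 := (d%:R : R) `^ (2 * (d%:R + eps)).
have [k10 k20 k30] : [/\ 0 <= k1, 0 <= k2 & 0 <= k3] by split; exact: powR_ge0.
have k30' : 0 < k3 by rewrite powR_gt0// dR0.
pose c := cL * ((1 + k1) * (k3 + k2) * 4).
have c0 : 0 < c.
  by apply: (mulr_gt0 cL0); apply: mulr_gt0 => //; apply: mulr_gt0; lra.
exists c => // r f r0 [fL fE].
(* The budget r is shared equally: cA s^alpha <= r / 2 means s^alpha <= t, and cB q^-(eps-alpha) <=
   r / 2 means q^-(eps-alpha) <= u. *)
pose t := r / (2 * cA); pose u := r / (2 * cB).
have cA2 : 0 < 2 * cA by rewrite mulr_gt0 ?cA0.
have cB2 : 0 < 2 * cB by rewrite mulr_gt0 ?cB0.
have t0 : 0 < t by rewrite divr_gt0.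
have u0 : 0 < u by rewrite divr_gt0.
(* The critical values of s and q, cut off at 1 and at d: [super_poincare_scales] requires s <= 1, q
   >= 1 and d <= q^2, and the last two follow from q >= d >= 1. *)
pose s := Num.min 1 (t `^ alpha^-1); pose q := Num.max d%:R (u `^ (- (eps - alpha)^-1)).
have s0 : 0 < s by rewrite lt_min ltr01 powR_gt0.
have s1 : s <= 1 by rewrite ge_min lexx.
have d1 : 1 <= d%:R :> R by rewrite ler1n.
have dq : d%:R <= q by rewrite le_max lexx.
have q1 : 1 <= q by exact: le_trans dq.
have q0 : 0 < q by exact: lt_le_trans q1.
have dq2 : d%:R <= q ^+ 2.
  by rewrite expr2 (le_trans dq)// ler_peMr// ltW.
have s01 : 0 < s <= 1 by rewrite s0.
have := super_poincare_scales alpha0 alpha_eps s01 q1 dq2 fL.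
rewrite (near_constantE s0) -/b; set B := _ / _ `^ _; set L := _ / _ ^+ 2; set N1 := \int[mu]_x _.
move=> /le_trans; apply; apply: leeD.
  apply: lee_wpmul2r; first exact: dirichlet_form_ge0.
  rewrite lee_fin [leRHS]splitr lerD//.
    rewrite (_ : r / 2 = cA * t); last by rewrite /t; field; rewrite gt_eqF ?cA0.
    rewrite ler_wpM2l ?(ltW cA0)// (@le_trans _ _ ((t `^ alpha^-1) `^ alpha))//.
      by rewrite ge0_ler_powR ?nnegrE ?(ltW s0) ?powR_ge0 ?(ltW alpha0)// ge_min lexx orbT.
    by rewrite -powRrM mulVf ?gt_eqF// powRr1// ltW.
  rewrite (_ : r / 2 = cB * u); last by rewrite /u; field; rewrite gt_eqF ?cB0.
  rewrite (_ : B = cB * q `^ (- (eps - alpha))); last by rewrite /B /cB mulrAC.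
  rewrite ler_wpM2l ?(ltW cB0)//.
  apply: (@le_trans _ _ ((u `^ (- (eps - alpha)^-1)) `^ (- (eps - alpha)))).
    by apply: le_powRN => //; rewrite ?powR_gt0// le_max lexx orbT.
  by rewrite -powRrM mulrNN mulVf ?gt_eqF// powRr1// ltW.
rewrite -(EFin_Rintegral (integrable_abs_Lfun2 (gibbsT eps0) fL)) -EFin_expe -EFinM lee_fin.
rewrite ler_wpM2r ?sqr_ge0//.
apply: (le_trans (local_constant_le s0 q1)).
have tE : t `^ (- e1) = k1 * r `^ (- e1).
  rewrite powRM ?invr_ge0 ?ltW// mulrC; congr (_ * _).
  by rewrite -powR_inv1 ?ltW// -powRrM mulN1r opprK.
have uE : u `^ (- e2) = k2 * r `^ (- e2).
  rewrite powRM ?invr_ge0 ?ltW// mulrC; congr (_ * _).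
  by rewrite -powR_inv1 ?ltW// -powRrM mulN1r opprK.
have sle : s `^ (- (2 * d%:R)) <= (1 + k1) * (1 + r `^ (- e1)).
  have re1 := powR_ge0 r (- e1); have kr1 := mulr_ge0 k10 re1.
  rewrite /s; have [t1|t1] := leP 1 (t `^ alpha^-1).
    by rewrite powR1 mulrDl !mulrDr !mulr1 !mul1r; lra.
  rewrite -powRrM (_ : alpha^-1 * _ = - e1); last by rewrite /e1; ring.
  by rewrite tE mulrDl !mulrDr !mulr1 !mul1r; lra.
have qle : q `^ (2 * (d%:R + eps)) <= (k3 + k2) * (1 + r `^ (- e2)).
  have re2 := powR_ge0 r (- e2); have kr2 := mulr_ge0 k20 re2; have kr3 := mulr_ge0 k30 re2.
  rewrite /q; have [u1|u1] := leP (u `^ (- (eps - alpha)^-1)) d%:R.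
    by rewrite -/k3 mulrDl !mulrDr !mulr1; lra.
  rewrite -powRrM (_ : - (eps - alpha)^-1 * _ = - e2); last by rewrite /e2; ring.
  by rewrite uE mulrDl !mulrDr !mulr1; lra.
rewrite /c -[leRHS]mulrA; apply: (ler_wpM2l (ltW cL0)).
apply: (@le_trans _ _ ((k3 + k2) * (1 + r `^ (- e2)) * ((1 + k1) * (1 + r `^ (- e1))))).
  by apply: ler_pM; rewrite ?powR_ge0.
rewrite (_ : _ * _ =
  (1 + k1) * (k3 + k2) * ((1 + r `^ (- e1)) * (1 + r `^ (- e2)))); last by ring.
rewrite -[leRHS]mulrA; apply: ler_wpM2l; first by apply: mulr_ge0; lra.
exact: powRN_mul_le.
Qed.

End super_poincare_rate.

(** * Sharpness *)

Section sharpness.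
Context {R : realType} {d : nat} {alpha eps : R}.
Hypothesis d0 : (0 < d)%N.
Hypothesis alpha02 : 0 < alpha < 2.
Hypothesis eps0 : 0 < eps.
Local Notation T := (d.-tuple R).
Implicit Types (x y : T) (f : T -> R).
Local Notation dist x y := (enorm (tuple_sub x y)).
Local Notation leb := (@lebesgue_tuple R d).
Local Notation V := (log_potential d eps).
Local Notation mu := (gibbs V).
Local Notation Z := (partition_function V).
Local Notation w := (@weight R d eps).
Local Notation E f := (dirichlet_form alpha V f f).
Local Notation L2 := (Lfun mu 2%:E).

Let alpha0 : 0 < alpha. Proof. by case/andP: alpha02. Qed.

Let Z0 : 0 < Z. Proof. exact: partition_function_gt0. Qed.

Let muT : mu setT = 1%E. Proof. exact: gibbsT. Qed.

Let dR0 : 0 < d%:R :> R. Proof. by rewrite ltr0n. Qed.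

Definition ramp (t : R) : R := Num.min 1 (Num.max 0 (t - 1)).

Lemma ramp_itv t : 0 <= ramp t <= 1.
Proof. by rewrite /ramp le_min ler01 le_max lexx/= ge_min lexx. Qed.

Lemma ramp_eq0 t : t <= 1 -> ramp t = 0.
Proof. by move=> t1; rewrite /ramp max_l ?subr_le0// min_r. Qed.

Lemma ramp_eq1 t : 2 <= t -> ramp t = 1.
Proof. by move=> t2; rewrite /ramp min_l// le_max; apply/orP; right; lra. Qed.

Lemma ramp_lipschitz s t : `|ramp s - ramp t| <= `|s - t|.
Proof.
wlog st : s t / s <= t => [H|].
  have [/H//|/ltW ts] := leP s t; rewrite distrC [leRHS]distrC; exact: H.
have rst : ramp s <= ramp t by rewrite /ramp le_min2// le_max2// lerB.
rewrite distrC [leRHS]distrC !ger0_norm ?subr_ge0//.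
rewrite /ramp /Num.max /Num.min; do ![case: ifPn]; rewrite -?leNgt; lra.
Qed.

Lemma ramp_dist_le1 s t : `|ramp s - ramp t| <= 1.
Proof.
have /andP[s0 s1] := ramp_itv s; have /andP[t0 t1] := ramp_itv t.
by rewrite ler_norml; apply/andP; split; lra.
Qed.

Let i0 : 'I_d := Ordinal d0.

(* A function of one coordinate, which makes the Lipschitz bound immediate. *)
Definition test_function (n : R) x : R := ramp (`|tnth x i0| / n).

(** The constants of [integral_edist_gt] and [integral_edist_le] for the exponent alpha. *)
Let C1 : R := 4 ^+ d / (1 - 2 `^ (- alpha)).
Let C2 : R := 2 ^+ d * 2 `^ (d%:R + alpha) / (1 - 2 `^ (- (2 - alpha))).

Lemma energy_cst_gt0 : 0 < C1 + C2.
Proof.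
apply: addr_gt0; apply: divr_gt0.
- by rewrite exprn_gt0.
- by rewrite subr_gt0 powR2N_lt1.
- by apply: mulr_gt0; [rewrite exprn_gt0 | rewrite powR_gt0].
- by rewrite subr_gt0 powR2N_lt1//; case/andP: alpha02; lra.
Qed.

Section scale.
Variable n : R.
Hypothesis n0 : 0 < n.
Local Notation f := (test_function n).

Lemma measurable_test_function : measurable_fun setT f.
Proof.
have mx : measurable_fun setT (fun x : T => `|tnth x i0| / n - 1).
  apply: measurable_funB => //; apply: measurable_funM => //.
  by apply: measurableT_comp => //; exact: measurable_tnth.
apply: (measurable_minr (f := cst 1)) => //.
exact: (measurable_maxr (f := cst 0)).
Qed.

Lemma test_function_itv x : 0 <= f x <= 1.
Proof. exact: ramp_itv. Qed.

Lemma test_function_dist x y : `|f x - f y| <= dist x y / n.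
Proof.
apply: (le_trans (ramp_lipschitz _ _)); rewrite -mulrBl normrM.
rewrite [`|n^-1|]ger0_norm ?invr_ge0 ?(ltW n0)// ler_wpM2r ?invr_ge0 ?(ltW n0)//.
exact: le_trans (ler_dist_dist _ _) (tnth_le_edist _ _ _).
Qed.

Lemma test_function_Lfun2 : f \in L2.
Proof.
apply: (Lfun2_dominated measurable_test_function (Lfun2_cst muT 1)).
apply/nearW => x; have /andP[f0 f1] := test_function_itv x.
by rewrite /= normr1 ger0_norm.
Qed.

(** Split at |x - y| = n: beyond, the difference of f is at most 1; below, it is at most |x - y| /
    n. Both parts scale as n^-alpha, the second as n^-2 n^(2-alpha), and 0 < alpha < 2 makes both
    integrals converge. *)
Lemma jump_test_function_le x :
  (\int[leb]_y (jump (alpha := alpha) f (x, y))%:E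
   <= ((C1 + C2) * n `^ (- alpha))%:E)%E.
Proof.
pose g1 y : R := if n <= dist x y then dist x y `^ (- (d%:R + alpha)) else 0.
pose g2 y : R := if dist x y <= n
  then dist x y ^+ 2 * dist x y `^ (- (d%:R + alpha)) else 0.
have md := measurable_edistr x.
have mdp : measurable_fun setT (fun y => dist x y `^ (- (d%:R + alpha))).
  exact: (measurableT_comp (measurable_powR _) md).
have m1 : measurable_fun setT (fun y => (g1 y)%:E).
  apply/measurable_EFinP; apply: measurable_fun_ifT => //.
  exact: (measurable_fun_ler (measurable_cst _) md).
have m2 : measurable_fun setT (fun y => (g2 y)%:E).
  apply/measurable_EFinP; apply: measurable_fun_ifT => //.
    exact: (measurable_fun_ler md (measurable_cst _)).
  by apply: measurable_funM => //; exact: measurable_funX.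
have g10 y : 0 <= g1 y by rewrite /g1; case: ifP => // _; exact: powR_ge0.
have g20 y : 0 <= g2 y.
  by rewrite /g2; case: ifP => // _; apply: mulr_ge0; [exact: sqr_ge0|exact: powR_ge0].
have n1 y : setT y -> (0 <= (g1 y)%:E)%E by rewrite lee_fin.
have n2 y : setT y -> (0 <= (g2 y)%:E)%E by rewrite lee_fin.
have nn : (0 <= (n^-1 ^+ 2)%:E)%E by rewrite lee_fin sqr_ge0.
have m2' := measurable_funeM (n^-1 ^+ 2)%:E m2.
have n2' y : setT y -> (0 <= (n^-1 ^+ 2)%:E * (g2 y)%:E)%E by move=> /n2; exact: mule_ge0.
apply: (@le_trans _ _ (\int[leb]_y ((g1 y)%:E + (n^-1 ^+ 2)%:E * (g2 y)%:E))%E).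
  apply: ge0_le_integral => //.
  - by move=> y _; rewrite lee_fin jump_ge0.
  - apply/measurable_EFinP.
    exact: (measurableT_comp (measurable_jump measurable_test_function)
      (@pair1_measurable _ _ _ _ x)).
  - exact: (emeasurable_funD m1 m2').
  - move=> y _; rewrite -EFinM -EFinD lee_fin /jump/= -expr2 -powRN.
    set q := _ `^ _; have q0 : 0 <= q by exact: powR_ge0.
    have [nxy|xyn] := leP n (dist x y).
      rewrite (@le_trans _ _ (g1 y))//; last first.
        by rewrite lerDl; apply: mulr_ge0 => //; exact: sqr_ge0.
      rewrite /g1 nxy -/q ler_piMl// -real_normK ?num_real// expr_le1//.
      exact: ramp_dist_le1.
    rewrite (@le_trans _ _ (n^-1 ^+ 2 * g2 y))//; last by rewrite lerDr.
    rewrite /g2 (ltW xyn) -/q mulrA; apply: ler_wpM2r => //.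
    rewrite -exprMn mulrC -real_normK ?num_real//.
    apply: lerXn2r; rewrite ?nnegrE//; last exact: test_function_dist.
    by rewrite divr_ge0 ?enorm_ge0// ltW.
rewrite (ge0_integralD _ measurableT n1 m1 n2' m2') (ge0_integralZl _ measurableT m2 n2 nn).
rewrite mulrDl EFinD; apply: leeD; first exact: (integral_edist_gt x alpha0 n0).
apply: (le_trans (lee_wpmul2l nn (integral_edist_le x alpha02 n0))).
rewrite -EFinM lee_fin -/C2 mulrCA powRD; last by apply/implyP => _; rewrite gt_eqF.
rewrite powR_mulrn ?(ltW n0)// le_eqVlt; apply/orP; left; apply/eqP.
by field; rewrite gt_eqF.
Qed.

Lemma energy_test_function_le : (E f <= ((C1 + C2) * n `^ (- alpha))%:E)%E.
Proof.
have mJ := measurable_jump (alpha := alpha) measurable_test_function.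
have mJE : measurable_fun setT (fun z => (jump (alpha := alpha) f z)%:E).
  exact/measurable_EFinP.
have J0 z : (0 <= (jump (alpha := alpha) f z)%:E)%E by rewrite lee_fin jump_ge0.
apply: (@le_trans _ _ (\int[mu]_x ((C1 + C2) * n `^ (- alpha))%:E)%E); last first.
  by rewrite integral_cst// [X in (_ * X)%E]muT mule1.
apply: ge0_le_integral => //.
- by move=> x _; apply: integral_ge0 => y _; exact: (J0 (x, y)).
- exact: (measurable_fun_fubini_tonelli_F _ mJE J0).
- by move=> x _; exact: jump_test_function_le.
Qed.

Lemma form_domain_test_function : form_domain alpha V f.
Proof.
by split; [exact: test_function_Lfun2 | rewrite (le_lt_trans energy_test_function_le)// ltry].
Qed.

(** f vanishes on |x| <= n, because one coordinate is at most the norm. *)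
Lemma test_function_mean_le :
  \int[mu]_x f x <= Z^-1 * @tail_cst R d eps * n `^ (- eps).
Proof.
rewrite -lee_fin (EFin_Rintegral (integrable_Lfun2 muT test_function_Lfun2)).
apply: le_trans (gibbs_tail eps0 n0).
have mA := @measurable_enorm_gt R d n.
have -> : (mu [set x | (n < enorm x)%R] =
    \int[mu]_x (\1_[set x | (n < enorm x)%R] x)%:E)%E by rewrite integral_indic// setIT.
apply: ge0_le_integral => //.
- by move=> x _; rewrite lee_fin; case/andP: (test_function_itv x).
- by apply/measurable_EFinP; exact: measurable_test_function.
- by apply/measurable_EFinP; exact: measurable_indic.
- move=> x _; rewrite lee_fin indicE.
  have [_|xn] := boolP (x \in _); first by case/andP: (test_function_itv x).
  rewrite /test_function ramp_eq0// ler_pdivrMr// mul1r.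
  move: xn; rewrite notin_setE/= => /negP; rewrite -leNgt.
  exact: le_trans (tnth_le_enorm x i0).
Qed.

(** The cube of half-width n around (3n, ..., 3n) lies in the region where f = 1; on it |x|^2 <= 16
    d n^2, and 1 + 16 d n^2 <= 17 d n^2. *)
Lemma test_function_sqr_ge : 1 <= n ->
  Z^-1 * ((17 * d%:R) `^ (- ((d%:R + eps) / 2)) * 2 ^+ d) * n `^ (- eps)
  <= \int[mu]_x (f x ^+ 2).
Proof.
move=> n1; have fL := test_function_Lfun2; have mf := measurable_test_function.
have -> : \int[mu]_x (f x ^+ 2) = inner (mu := mu) f f by [].
rewrite -lee_fin (innerE fL).
have mf2 : measurable_fun setT (fun x => (f x ^+ 2)%:E).
  by apply/measurable_EFinP; exact: measurable_funX.
rewrite (gibbs_integral eps0 mf2); last by move=> x; rewrite lee_fin sqr_ge0.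
have Zi0 : (0 <= Z^-1%:E)%E by rewrite lee_fin invr_ge0 (ltW Z0).
rewrite -mulrA EFinM; apply: (lee_wpmul2l Zi0).
pose c : T := [tuple 3 * n | i < d].
have cbox x : box c n x -> forall i, 2 * n <= tnth x i <= 4 * n.
  move=> xc i; have := xc i; rewrite tnth_mktuple ler_norml => /andP[? ?].
  by apply/andP; split; lra.
have n0' := ltW n0.
have M0 x : box c n x -> enorm x ^+ 2 <= 16 * d%:R * n ^+ 2.
  move=> /cbox xc; rewrite sqr_enorm -mulrA mulrCA mulr_natl -[d in leRHS]card_ord -sumr_const.
  apply: ler_sum => i _; have /andP[x2 x4] := xc i.
  rewrite (_ : 16 * n ^+ 2 = (4 * n) ^+ 2); last by ring.
  by apply: lerXn2r; rewrite ?nnegrE//; lra.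
have := box_weight_ge eps0 n0' M0; set k := _ `^ _ => bw.
apply: (@le_trans _ _ ((k * (2 * n) ^+ d)%:E)).
  rewrite lee_fin exprMn mulrAC (_ : k * _ = k * n ^+ d * 2 ^+ d); last by ring.
  apply: ler_wpM2r; first exact: exprn_ge0.
  have n21 : 1 <= n ^+ 2 by rewrite exprn_ege1.
  have d1 : 1 <= d%:R :> R by rewrite ler1n.
  have de0 : 0 < (d%:R + eps) / 2 by rewrite divr_gt0// addr_gt0.
  have -> : (17 * d%:R) `^ (- ((d%:R + eps) / 2)) * n `^ (- eps) =
      (17 * d%:R * n ^+ 2) `^ (- ((d%:R + eps) / 2)) * n ^+ d.
    rewrite [in RHS]powRM ?sqr_ge0 ?mulr_ge0// -mulrA; congr (_ * _).
    rewrite -mulNr (powR_sqr _ n0') -powR_mulrn// -powRD; last first.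
      by apply/implyP => _; rewrite gt_eqF.
    by congr powR; ring.
  apply: ler_wpM2r; first exact: exprn_ge0.
  apply: le_powRN => //.
    by have := sqr_ge0 n; have := mulr_ge0 (ltW dR0) (sqr_ge0 n); lra.
  have : 1 <= d%:R * n ^+ 2 by rewrite (le_trans d1)// ler_peMr// ltW.
  lra.
apply: (le_trans bw); apply: ge0_le_integral => //.
- by move=> x _; rewrite lee_fin; apply: mulr_ge0 => //; exact: weight_ge0.
- apply/measurable_EFinP; apply: measurable_funM; last exact: measurable_weight.
  by apply: measurable_indic; exact: measurable_box.
- apply: emeasurable_funM => //.
  by apply/measurable_EFinP; exact: measurable_weight.
- move=> x _; rewrite -EFinM lee_fin; apply: ler_wpM2r; first exact: weight_ge0.
  rewrite indicE; have [|_] := boolP (x \in _); last exact: sqr_ge0.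
  rewrite inE => /cbox/(_ i0)/andP[x2 _].
  rewrite /test_function ramp_eq1 ?expr1n// ler_pdivlMr// (le_trans x2)//.
  exact: ler_norm.
Qed.

End scale.
End sharpness.

(** * Necessity and sharpness *)

Section necessity.
Context {R : realType} {d : nat} {alpha eps : R}.
Hypothesis d0 : (0 < d)%N.
Hypothesis alpha02 : 0 < alpha < 2.
Hypothesis eps0 : 0 < eps.
Local Notation T := (d.-tuple R).
Implicit Types (x y : T) (f : T -> R).
Local Notation V := (log_potential d eps).
Local Notation mu := (gibbs V).
Local Notation Z := (partition_function V).
Local Notation E f := (dirichlet_form alpha V f f).
Local Notation L2 := (Lfun mu 2%:E).

Let muT : mu setT = 1%E. Proof. exact: gibbsT. Qed.

(** Collects the estimates on the ramps with constants independent of n; since f >= 0, the bound on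
    its mean is one on its L^1 norm. *)
Lemma log_potential_test_functions : exists cE cl cu : R,
  [/\ 0 < cE, 0 < cl, 0 < cu & forall n, 1 <= n -> exists f,
    [/\ form_domain alpha V f, (E f <= (cE * n `^ (- alpha))%:E)%E,
        cl * n `^ (- eps) <= \int[mu]_x (f x ^+ 2),
        \int[mu]_x f x <= cu * n `^ (- eps) & forall x, 0 <= f x <= 1]].
Proof.
have Zi0 : 0 < Z^-1 by rewrite invr_gt0 partition_function_gt0.
do 3!eexists; split; last first.
- move=> n n1; have n0 := lt_le_trans ltr01 n1.
  exists (test_function d0 n); split.
  + exact: form_domain_test_function.
  + exact: energy_test_function_le.
  + exact: test_function_sqr_ge.
  + exact: test_function_mean_le.
  + exact: test_function_itv.
- by apply: (mulr_gt0 Zi0); exact: tail_cst_gt0.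
- apply: (mulr_gt0 Zi0); apply: mulr_gt0; last by rewrite exprn_gt0.
  by rewrite powR_gt0// mulr_gt0// ltr0n.
- exact: energy_cst_gt0.
Qed.

Lemma large_scale (K : R) : exists2 n, 1 <= n & K <= n `^ eps.
Proof.
exists (Num.max 1 (`|K| `^ eps^-1)); first by rewrite le_max lexx.
rewrite (le_trans (ler_norm K))// (@le_trans _ _ ((`|K| `^ eps^-1) `^ eps))//.
  by rewrite -powRrM mulVf ?gt_eqF// powRr1.
by rewrite ge0_ler_powR ?nnegrE ?powR_ge0 ?(ltW eps0)// le_max ?lexx ?orbT ?ler01.
Qed.

Lemma powR_mulVN (n a : R) : 0 < n -> n `^ a * n `^ (- a) = 1.
Proof.
by move=> n0; rewrite powRN divff// gt_eqF// powR_gt0.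
Qed.

(** If eps <= alpha, the energy is at most of order n^-eps, the order of mu(f^2), whereas mu(|f|)^2
    is at most of order n^(-2 eps): a small fixed r and a large n give a contradiction. *)
Lemma super_poincare_necessity (beta : R -> R) :
  (forall r, 0 < r -> 0 < beta r) ->
  super_poincare_inequality alpha V beta -> alpha < eps.
Proof.
move=> beta0 sP; rewrite ltNge; apply/negP => ea.
have [cE [cl [cu [cE0 cl0 cu0 testf]]]] := log_potential_test_functions.
(* This r makes the energy term at most half of the lower bound cl n^-eps; the choice of n then
   makes the remaining term at most a quarter of it. *)
pose r := cl / (2 * cE); have r0 : 0 < r by rewrite divr_gt0// mulr_gt0.
pose B := beta r * cu ^+ 2; have B0 : 0 < B by rewrite mulr_gt0 ?beta0 ?exprn_gt0.
have [n n1 Kn] := large_scale (4 * B / cl).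
have n0 : 0 < n by exact: lt_le_trans n1.
have [f [fD fE f2 f1 f01]] := testf n n1.
have fL : f \in L2 by case: fD.
have := sP r f r0 fD; rewrite -(innerE fL).
have -> : (\int[mu]_x `|f x|%:E = (\int[mu]_x f x)%:E)%E.
  rewrite (EFin_Rintegral (integrable_Lfun2 muT fL)); apply: eq_integral => x _.
  by rewrite ger0_norm//; case/andP: (f01 x).
move=> H.
have f10 : 0 <= \int[mu]_x f x by apply: Rintegral_ge0 => x _; case/andP: (f01 x).
have r0E : (0 <= r%:E)%E by rewrite lee_fin ltW.
have {H} := le_trans H (leeD2r _ (lee_wpmul2l r0E fE)).
rewrite -EFin_expe -!EFinM -EFinD lee_fin => H.
pose v := n `^ (- eps); have v0 : 0 < v by rewrite powR_gt0.
have av : n `^ (- alpha) <= v by rewrite ler_powR// lerN2.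
have m2 : (\int[mu]_x f x) ^+ 2 <= (cu * v) ^+ 2.
  by apply: lerXn2r; rewrite ?nnegrE// mulr_ge0// ltW.
have Bv : B * v <= cl / 4.
  have h := ler_wpM2r (ltW v0) Kn.
  rewrite (powR_mulVN eps n0) mulrAC ler_pdivrMr// in h.
  by move: h; clear; lra.
have h1 : cl * v <= r * (cE * v) + beta r * (cu * v) ^+ 2.
  apply: (le_trans f2); apply: (le_trans H); apply: lerD.
    by apply: (ler_wpM2l (ltW r0)); apply: (ler_wpM2l (ltW cE0)).
  by rewrite ler_wpM2l// ltW// beta0.
have e1 : r * (cE * v) = cl / 2 * v by rewrite /r; field; rewrite gt_eqF.
have e2 : beta r * (cu * v) ^+ 2 = B * v * v by rewrite /B; ring.
have := ler_wpM2r (ltW v0) Bv; have := mulr_gt0 cl0 v0.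
by move: h1; rewrite e1 e2; clear; lra.
Qed.

(** The scale n is tuned to r by n^-eps = v with r = q v. Of the lower bound cl v = 4 q v for
    mu(f^2), the squared mean takes at most 2 q v and the term with r at most q v, so that beta(r)
    cE n^-alpha >= q v remains. *)
Lemma weak_poincare_lower_bound (beta : R -> R) : eps < alpha ->
  weak_poincare_inequality alpha V beta ->
  exists2 k : R, 0 < k & exists2 r0 : R, 0 < r0 & forall r, 0 < r -> r < r0 ->
    0 < beta r -> k <= r `^ ((alpha - eps) / eps) * beta r.
Proof.
move=> ea wP; have [cE [cl [cu [cE0 cl0 cu0 testf]]]] := log_potential_test_functions.
set theta := _ / eps.
pose q := cl / 4; have q0 : 0 < q by rewrite divr_gt0.
exists (q / cE * q `^ theta); first by rewrite mulr_gt0 ?powR_gt0 ?divr_gt0.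
(* v < u guarantees n >= 1 and that the squared mean, which is at most cu^2 v^2, does not exceed cl
   v / 2. *)
pose u := Num.min 1 (cl / (2 * cu ^+ 2)).
have u0 : 0 < u by rewrite lt_min ltr01 divr_gt0// mulr_gt0// exprn_gt0.
exists (q * u); first by rewrite mulr_gt0.
move=> r r0 rqu br0; pose v := r / q.
have v0 : 0 < v by rewrite divr_gt0.
have vu : v < u by rewrite /v ltr_pdivrMr// mulrC.
have v1 : v < 1 by apply: (lt_le_trans vu); rewrite ge_min lexx.
have vc : v * (2 * cu ^+ 2) < cl.
  rewrite -ltr_pdivlMr ?mulr_gt0 ?exprn_gt0//; apply: (lt_le_trans vu).
  by rewrite ge_min lexx orbT.
pose n := v `^ (- eps^-1).
have n1 : 1 <= n by rewrite powRN_ge1 ?v0 ?(ltW v1)// invr_ge0 ltW.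
have n0 : 0 < n by exact: lt_le_trans n1.
have nv : n `^ (- eps) = v.
  by rewrite /n -powRrM mulrNN mulVf ?gt_eqF// powRr1// ltW.
have [f [fD fE f2 f1 f01]] := testf n n1; rewrite nv in f2 f1.
have fL : f \in L2 by case: fD.
set m := \int[mu]_x f x in f1.
have m0 : 0 <= m by apply: Rintegral_ge0 => x _; case/andP: (f01 x).
(* Centering preserves the energy and keeps |g| <= 1, since f and m both lie in [0, 1]. *)
pose g x := f x - m.
have mL := Lfun2_cst muT m.
have gL : g \in L2 by exact: (Lfun2B fL mL).
have fi := integrable_Lfun2 muT fL.
have gm : \int[mu]_x g x = 0.
  rewrite /g RintegralB//; last exact: (integrable_Lfun2 muT mL).
  by rewrite (Rintegral_probability_cst muT) subrr.
have gmE : (\int[mu]_x (g x)%:E = 0)%E.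
  by rewrite -(EFin_Rintegral (integrable_Lfun2 muT gL)) gm.
have EgE : E g = E f.
  apply: eq_integral => x _; apply: eq_integral => y _.
  by rewrite /g (_ : f x - m - (f y - m) = f x - f y)//; ring.
have gD : form_domain alpha V g by split => //; rewrite EgE; case: fD.
have g2 : inner (mu := mu) g g = inner (mu := mu) f f - m ^+ 2.
  rewrite /g (innerBl fL mL gL) innerC (innerBl fL mL fL).
  have -> : inner (mu := mu) (cst m) f = m ^+ 2.
    by rewrite /inner RintegralZl// expr2.
  have -> : inner (mu := mu) (cst m) g = 0.
    by rewrite /inner RintegralZl ?gm ?mulr0//; exact: integrable_Lfun2.
  by rewrite subr0.
have f1m : m <= 1.
  rewrite -(Rintegral_probability_cst muT 1); apply: ae_le_Rintegral => //.
    exact: (integrable_Lfun2 muT (Lfun2_cst muT 1)).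
  by apply/nearW => x; case/andP: (f01 x).
have gN : ('N[mu]_+oo [EFin \o g] <= 1%:E)%E.
  apply/(Lnormy_le muT (Lfun_measurable gL) ler01)/nearW => x.
  by have /andP[? ?] := f01 x; rewrite /g ler_norml; apply/andP; split; lra.
have := wP r g r0 gD gmE; rewrite -(innerE gL) g2 EgE => H.
have brE : (0 <= (beta r)%:E)%E by rewrite lee_fin ltW.
have rE : (0 <= r%:E)%E by rewrite lee_fin ltW.
have N1 : (('N[mu]_+oo [EFin \o g]) ^+ 2 <= 1%:E)%E.
  by rewrite -[leRHS](_ : (1%:E ^+ 2 = 1%:E)%E) ?lee_sqr ?Lnorm_ge0// -EFin_expe expr1n.
have {H} := le_trans H (leeD (lee_wpmul2l brE fE) (lee_wpmul2l rE N1)).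
rewrite -!EFinM -EFinD lee_fin mulr1 => H.
have m2 : m ^+ 2 <= cu ^+ 2 * v ^+ 2.
  by rewrite -exprMn; apply: lerXn2r; rewrite ?nnegrE// mulr_ge0// ltW.
have m2' : m ^+ 2 <= cl / 2 * v.
  apply: (le_trans m2); rewrite expr2 mulrA; apply: (ler_wpM2r (ltW v0)).
  by move: vc; lra.
have rqv : r = q * v by rewrite /v mulrCA divff ?mulr1// gt_eqF.
have f2' : cl * v <= inner (mu := mu) f f by exact: f2.
have key : q * v <= beta r * (cE * n `^ (- alpha)).
  by move: H f2' m2'; rewrite {2}rqv /q; lra.
have nE : n `^ (- alpha) = v * v `^ theta.
  have -> : v * v `^ theta = v `^ (1 + theta).
    rewrite powRD; last by apply/implyP => _; rewrite gt_eqF.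
    by rewrite powRr1// ltW.
  by rewrite /n -powRrM; congr powR; rewrite /theta; field; rewrite gt_eqF.
have vt0 : 0 < v `^ theta by rewrite powR_gt0.
have key2 : q <= beta r * (cE * v `^ theta).
  by rewrite -(ler_pM2r v0) (le_trans key)// nE le_eqVlt; apply/orP; left; apply/eqP; ring.
have -> : r `^ theta = q `^ theta * v `^ theta by rewrite rqv powRM ?ltW.
rewrite mulrC -mulrA; apply: ler_wpM2l; first exact: powR_ge0.
rewrite ler_pdivrMr//; apply: (le_trans key2).
by rewrite le_eqVlt; apply/orP; left; apply/eqP; ring.
Qed.

Lemma weak_poincare_sharp : eps < alpha -> ~ exists beta : R -> R,
  [/\ forall r, 0 < r -> 0 < beta r,
      r `^ ((alpha - eps) / eps) * beta r @[r --> 0^'+] --> 0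
    & weak_poincare_inequality alpha V beta].
Proof.
move=> ea [beta [beta0 lim wP]].
have [k k0 [r0 r00 lb]] := weak_poincare_lower_bound ea wP.
move/cvgrPdist_lt: lim => /(_ _ k0) small.
near (0 : R)^'+ => r.
have rgt0 : 0 < r by near: r; exact: nbhs_right_gt.
have rr0 : r < r0 by near: r; exact: nbhs_right_lt.
have kr : `|0 - r `^ ((alpha - eps) / eps) * beta r| < k by near: r.
have := lb r rgt0 rr0 (beta0 r rgt0).
move: kr; rewrite /= sub0r normrN => /(le_lt_trans (ler_norm _)).
by move=> /lt_le_trans h /h; rewrite ltxx.
Unshelve. all: by end_near. Qed.

(** A Poincare constant C is a constant rate in the weak inequality, and r^((alpha-eps)/eps) C tends
    to 0 when eps < alpha, against [weak_poincare_sharp]. *)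
Lemma poincare_necessity C : 0 < C -> poincare_inequality alpha V C -> alpha <= eps.
Proof.
move=> C0 CP; rewrite leNgt; apply/negP => ea; apply: (weak_poincare_sharp ea).
exists (fun=> C); split => //.
  have th0 : 0 < (alpha - eps) / eps by rewrite divr_gt0// subr_gt0.
  have lim : r `^ ((alpha - eps) / eps) * C @[r --> 0^'+] --> 0 * C.
    by apply: cvgM; [exact: powR_cvg0|exact: cvg_cst].
  by rewrite mul0r in lim.
move=> r f r0 fD f0; apply: (le_trans (CP f fD f0)); rewrite leeDl// mule_ge0//.
  by rewrite lee_fin ltW.
by rewrite expe2 mule_ge0 ?Lnorm_ge0.
Qed.

End necessity.

Theorem corollary1p2 (R : realType) (d : nat) (alpha eps : R) :
  (1 <= d)%N -> 0 < alpha < 2 -> 0 < eps ->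
  let V : {mfun d.-tuple R >-> R} := log_potential d eps in
  let mu : {measure set (d.-tuple R) -> \bar R} := gibbs V in
  let associated P :=
    associated_semigroup mu (dirichlet_form alpha V) (form_domain alpha V) P in
  [/\ (exists2 C : R, 0 < C & poincare_inequality alpha V C) <-> alpha <= eps,
    ((exists2 beta : R -> R, (forall r, 0 < r -> 0 < beta r) &
        super_poincare_inequality alpha V beta) <-> alpha < eps) /\
    (alpha < eps ->
      let p : R := d%:R / alpha +
        (d%:R + eps) * (2 * alpha + d%:R) / (alpha * (eps - alpha)) in
      let super_rate := exists2 c : R, 0 < c &
        super_poincare_inequality alpha V (fun r => c * (1 + r `^ (- p))) in
      super_rate /\
      (forall P, associated P ->
        (super_rate <->
         exists2 lambda : R, 0 < lambda & forall t, 0 < t ->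
           (operator_norm mu 1 +oo (P t) <=
              (lambda * (1 + t `^ (- p)))%:E)%E)))
  &
    eps < alpha ->
    [/\ exists2 c : R, 0 < c &
          weak_poincare_inequality alpha V
            (fun r => c * (1 + r `^ (- ((alpha - eps) / eps)))),
        forall P, associated P ->
          exists2 lambda : R, 0 < lambda & forall t, 0 < t ->
            (operator_norm mu +oo 2%:E
               (fun f x => P t f x - \int[mu]_y f y)%R ^+ 2 <=
             (lambda / t `^ (eps / (alpha - eps)))%:E)%E
      & ~ exists beta : R -> R,
          [/\ forall r, 0 < r -> 0 < beta r,
              r `^ ((alpha - eps) / eps) * beta r @[r --> 0^'+] --> 0
            & weak_poincare_inequality alpha V beta] ] ].
Proof.
move=> d1 alpha02 eps0 V mu associated.
have alpha0 : 0 < alpha by case/andP: alpha02.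
have muT : mu setT = 1%E := gibbsT eps0.
split.
- split=> [[C C0 CP]|ae]; first exact: poincare_necessity d1 alpha02 eps0 C C0 CP.
  exact: log_potential_poincare.
- split.
    split=> [[beta beta0 sP]|ae].
      exact: super_poincare_necessity d1 alpha02 eps0 beta beta0 sP.
    have [c c0 sP] := log_potential_super_poincare d1 alpha0 ae.
    eexists; last exact: sP.
    by move=> r r0 /=; rewrite mulr_gt0// addr_gt0// powR_gt0.
  move=> ae p super_rate.
  have super : super_rate by exact: log_potential_super_poincare.
  (* [super_rate] has just been established, so the implication back from the semigroup bound is
     immediate and the forward one remains. *)
  split=> // P asP; split=> // _.
  have [c c0 sP] := super.
  have p0 : 0 < p.
    rewrite addr_gt0// ?divr_gt0 ?ltr0n// mulr_gt0 ?subr_gt0//.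
    + by rewrite addr_gt0// ltr0n.
    + by rewrite addr_gt0 ?mulr_gt0// ltr0n.
  by apply: (super_poincare_ultracontractive muT asP c0 p0) => r f r0 fD _; exact: sP.
- move=> ea; split.
  + exact: log_potential_weak_poincare.
  + move=> P asP.
    have [c c0 wP] := @log_potential_weak_poincare R d alpha eps eps0 ea.
    have theta0 : 0 < (alpha - eps) / eps by rewrite divr_gt0// subr_gt0.
    have [lambda l0 decay] := weak_poincare_semigroup muT asP c0 theta0
      (fun r f r0 fD _ => wP r f r0 fD).
    exists lambda => // t t0.
    by have := decay t t0; rewrite invf_div.
  + exact: weak_poincare_sharp.
Qed.
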